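(* For $\omega<0$ let $\Phi(\cdot,\omega)\in H^2_{\rm NK}(\mathcal{T})$ be the real positive solution of the stationary NLS equation $-\Delta\Phi-3\Phi^5=\omega\Phi$ given by $\Phi=\left(\tfrac13\mathcal{B}(\omega)\right)^{1/4}\Psi$, where $\Psi$ is a global minimizer (chosen real and positive) of $\mathcal{B}(\omega)=\inf\{B_\omega(U):\ U\in H^1_{\rm C}(\mathcal{T}),\ \|U\|_{L^6(\mathcal{T})}=1\}$. Let $\mu(\omega):=Q(\Phi(\cdot,\omega))$ and let $\omega_1\in(-\infty,0)$ be the number such that $\mu'(\omega)>0$ for $\omega\in(-\infty,\omega_1)$ and $\mu'(\omega)<0$ for $\omega\in(\omega_1,0)$. Then for $\omega\in(\omega_1,0)$ the standing wave $\Phi(\cdot,\omega)$ is a local constrained minimizer of the energy $E(U)$, $U \in H^1_{\rm C}(\mathcal{T})$, subject to the constraint $Q(U)=\mu(\omega)$, whereas for $\omega\in(-\infty,\omega_1)$ it is a saddle point of the energy $E(U)$ subject to the constraint $Q(U)=\mu(\omega)$.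
   Context: The tadpole graph $\mathcal{T}$ consists of a circle, identified with $[-\pi,\pi]$ with both end points attached to a single vertex, and a half-line $[0,\infty)$ attached at $0$ to the same vertex. Functions on $\mathcal{T}$ are (complex-valued) pairs $U=(u,v)$ with $u$ on $[-\pi,\pi]$ and $v$ on $[0,\infty)$; $\|U\|_{L^q(\mathcal{T})}^q=\|u\|_{L^q(-\pi,\pi)}^q+\|v\|_{L^q(0,\infty)}^q$, and $\nabla U=(u',v')$, $\Delta U=(u'',v'')$ componentwise. $H^1_{\rm C}(\mathcal{T})$ is the space of $(u,v)\in H^1(-\pi,\pi)\times H^1(0,\infty)$ with $u(\pi)=u(-\pi)=v(0)$. $H^2_{\rm NK}(\mathcal{T})$ is the space of $(u,v)\in H^2(-\pi,\pi)\times H^2(0,\infty)$ satisfying $u(\pi)=u(-\pi)=v(0)$ and $u'(\pi)-u'(-\pi)=v'(0)$. $B_\omega(U):=\|\nabla U\|_{L^2(\mathcal{T})}^2-\omega\|U\|_{L^2(\mathcal{T})}^2$; mass $Q(U):=\|U\|_{L^2(\mathcal{T})}^2$; energy $E(U):=\|\nabla U\|_{L^2(\mathcal{T})}^2-\|U\|_{L^6(\mathcal{T})}^6$. For every $\omega<0$ a global minimizer $\Psi$ exists; $\Phi=(u,v)$ is real up to phase rotation, positive up to sign, $u$ is even on $[-\pi,\pi]$, $u$ is monotonically decreasing on $[0,\pi]$ and $v$ on $[0,\infty)$; the positive solution with these properties is unique, the map $\omega\mapsto\mu(\omega)$ is $C^1$ on $(-\infty,0)$, and the number $\omega_1$ in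 the claim exists and is unique. A local constrained minimizer is a $\Phi$ that minimizes $E$ among all $U\in H^1_{\rm C}(\mathcal{T})$ with $Q(U)=\mu(\omega)$ in some $H^1$-neighborhood of $\Phi$; a saddle point is a critical point of $E$ restricted to $\{Q(U)=\mu(\omega)\}$ which is neither a local minimum nor a local maximum of $E$ on this set. *)

(* Defs.v *)
From HB Require Import structures.
From mathcomp Require Import all_boot all_order all_algebra.
From mathcomp Require Import all_classical all_reals all_analysis.
From mathcomp Require Import complex.

Set Implicit Arguments.
Unset Strict Implicit.
Unset Printing Implicit Defensive.
Import Order.TTheory GRing.Theory Num.Theory numFieldNormedType.Exports.
Import ComplexField.Normc.

Local Open Scope classical_set_scope.
Local Open Scope ring_scope.
Local Open Scope complex_scope.

Section Interval.
Context {R : realType}.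
Local Notation leb := (@lebesgue_measure R).
Implicit Types (D : set R) (u g : R -> R[i]).

Definition Cintegrable D u : Prop :=
  leb.-integrable D (EFin \o (@complex.Re R \o u)) /\
  leb.-integrable D (EFin \o (@complex.Im R \o u)).

Definition Cintegral D u : R[i] :=
  (\int[leb]_(x in D) complex.Re (u x)) +i* (\int[leb]_(x in D) complex.Im (u x)).

Definition square_integrable D u : Prop :=
  [/\ measurable_fun D (@complex.Re R \o u), measurable_fun D (@complex.Im R \o u) &
      leb.-integrable D (fun x => (normc (u x) ^+ 2)%:E)].

(* On an interval D, [u] is the locally absolutely continuous representative of
   a function whose weak derivative is (the class of) [g].  The values of [u]
   outside D play no role. *)
Definition weak_derivative D u g : Prop :=
  forall x y, D x -> D y -> x <= y ->
    Cintegrable `[x, y] g /\ u y - u x = Cintegral `[x, y] g.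

(* Elements of H^1(D) are given by their continuous representative, so that
   traces at end points are plain values. *)
Definition H1 D u : Prop :=
  square_integrable D u /\
  exists2 g, weak_derivative D u g & square_integrable D g.

(* A chosen weak derivative (unique up to a null set when D is an interval);
   0 if there is none. *)
Definition wderiv D u : R -> R[i] :=
  xget (fun=> 0) [set g | weak_derivative D u g].

End Interval.

Section Tadpole.
Context {R : realType}.
Local Notation leb := (@lebesgue_measure R).

Definition loop : set R := `[- pi, pi].
Definition tail : set R := `[0, +oo[.

(* Only the restrictions of the components to [loop] and [tail] matter. *)
Definition tadfun : Type := ((R -> R[i]) * (R -> R[i]))%type.

Implicit Types (U V W G : tadfun) (w m c : R).

Definition tad_eq U V : Prop :=
  (forall x, loop x -> U.1 x = V.1 x) /\ (forall x, tail x -> U.2 x = V.2 x).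

Definition tad_sub U V : tadfun :=
  (fun x => U.1 x - V.1 x, fun x => U.2 x - V.2 x).

(* [U + t W] for a real parameter [t] *)
Definition tad_line U W (t : R) : tadfun :=
  (fun x => U.1 x + t%:C * W.1 x, fun x => U.2 x + t%:C * W.2 x).

Definition tad_scale c U : tadfun :=
  (fun x => c%:C * U.1 x, fun x => c%:C * U.2 x).

(* the q-th power of the L^q norm *)
Definition Lq_pow (q : nat) U : R :=
  \int[leb]_(x in loop) (normc (U.1 x) ^+ q) +
  \int[leb]_(x in tail) (normc (U.2 x) ^+ q).

Definition Lq_norm (q : nat) U : R := Lq_pow q U `^ (q%:R)^-1.

Definition is_grad U G : Prop :=
  weak_derivative loop U.1 G.1 /\ weak_derivative tail U.2 G.2.

Definition grad U : tadfun := (wderiv loop U.1, wderiv tail U.2).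

Definition H1C U : Prop :=
  [/\ H1 loop U.1, H1 tail U.2, U.1 pi = U.1 (- pi) & U.1 pi = U.2 0].

(* [G] is the H^1, hence continuous, representative of the derivative. *)
Definition H2NK U : Prop :=
  H1C U /\
  exists G, [/\ is_grad U G, H1 loop G.1, H1 tail G.2 &
                G.1 pi - G.1 (- pi) = G.2 0].

Definition mass U : R := Lq_norm 2 U ^+ 2.

Definition dirichlet U : R := Lq_norm 2 (grad U) ^+ 2.

Definition energy U : R := dirichlet U - Lq_norm 6 U ^+ 6.

Definition Bform w U : R := dirichlet U - w * mass U.

Definition Binf w : R :=
  inf [set Bform w U | U in [set U | H1C U /\ Lq_norm 6 U = 1]].

Definition global_minimizer w U : Prop :=
  [/\ H1C U, Lq_norm 6 U = 1 & Bform w U = Binf w].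

(* In the order of R[i], [0 < z] says that [z] is real and positive. *)
Definition real_positive U : Prop :=
  (forall x, loop x -> 0 < U.1 x) /\ (forall x, tail x -> 0 < U.2 x).

Definition even_decreasing U : Prop :=
  [/\ forall x, loop x -> U.1 (- x) = U.1 x,
      forall x y, 0 <= x -> x < y -> y <= pi -> U.1 y < U.1 x &
      forall x y, 0 <= x -> x < y -> U.2 y < U.2 x].

(* -Lap U - 3 U^5 = w U almost everywhere *)
Definition stationary_NLS w U : Prop :=
  exists G L : tadfun,
    [/\ is_grad U G, is_grad G L,
        {ae leb, forall x, loop x ->
           - L.1 x - 3 * U.1 x ^+ 5 = w%:C * U.1 x} &
        {ae leb, forall x, tail x ->
           - L.2 x - 3 * U.2 x ^+ 5 = w%:C * U.2 x}].

Definition positive_solution w U : Prop :=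
  [/\ H2NK U, real_positive U, even_decreasing U & stationary_NLS w U].

Definition scaled_minimizer w U : Prop :=
  exists V, [/\ global_minimizer w V, real_positive V &
                tad_eq U (tad_scale ((Binf w / 3) `^ (4^-1)) V)].

Definition H1_norm U : R := Num.sqrt (dirichlet U + mass U).

Definition near_on_mass m U (P : tadfun -> Prop) : Prop :=
  exists2 e : R, 0 < e &
    forall V, H1C V -> mass V = m -> H1_norm (tad_sub V U) < e -> P V.

Definition local_constrained_min m U : Prop :=
  [/\ H1C U, mass U = m &
      near_on_mass m U (fun V => energy U <= energy V)].

Definition local_constrained_max m U : Prop :=
  [/\ H1C U, mass U = m &
      near_on_mass m U (fun V => energy V <= energy U)].

(* The derivative of the energy at [U] vanishes along every direction tangent
   to the constraint manifold at [U], i.e. on the kernel of the derivative of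
   the mass. *)
Definition constrained_critical m U : Prop :=
  [/\ H1C U, mass U = m &
      forall W, H1C W ->
        is_derive (0 : R) (1 : R) (fun t : R => mass (tad_line U W t) : R) 0 ->
        is_derive (0 : R) (1 : R) (fun t : R => energy (tad_line U W t) : R) 0].

Definition saddle_point m U : Prop :=
  [/\ constrained_critical m U,
      ~ local_constrained_min m U & ~ local_constrained_max m U].

End Tadpole.

Arguments tadfun : clear implicits.

(* Main.v *)
Require Import Defs.
From HB Require Import structures.
From mathcomp Require Import all_boot all_order all_algebra.
From mathcomp Require Import all_classical all_reals all_analysis.
From mathcomp Require Import measurable_realfun.
From mathcomp Require Import complex.
From mathcomp Require Import ring lra.
Import Order.TTheory GRing.Theory Num.Theory numFieldNormedType.Exports.
Local Open Scope classical_set_scope.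
Local Open Scope ring_scope.

(** Let [S_w(U) = E(U) - w Q(U) = B_w(U) - |U|_6^6] be the action, and write
    [p(w) = |Phi_w|_6^6].  The normalization of [Phi_w] gives
    [B_w(Phi_w) = 3 p(w)], so that [S_w(Phi_w) = 2 p(w)], and the minimality of
    [Psi] becomes [27 p(w)^2 |U|_6^6 <= B_w(U)^3] for all [U], with equality at
    [Phi_w] (predicate [ground_state]).  No spectral analysis of the linearized
    operators is used: everything is deduced from this inequality, from the
    uniqueness of the wave and from the sign of [mu'].

    _The action_ (lemma [p_derive]).  Testing the inequality at a frequency with
    the wave of another one, in both ways, squeezes the increment of [p] and shows
    that [2 p] has derivative [- mu].  Hence [2 p] is strictly convex where
    [mu' < 0] and strictly concave where [mu' > 0].

    _Minimum_ (lemma [wave_local_min]).  Let [V] be near [Phi_w] with mass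
    [mu(w)].  By continuity of [p] there is a frequency [w'] near [w] with
    [|V|_6^6 = p(w')], and then [S_w'(V) >= 2 p(w')].  By convexity
    [E(V) >= 2 p(w') + w' mu(w) >= 2 p(w) + w mu(w) = E(Phi_w)].

    _Critical point_ (lemma [ground_state_critical]).  On a line through [Phi_w]
    the inequality compares two polynomials that agree at [Phi_w], so their
    derivatives agree.

    _Not a maximum_ (lemma [ground_state_not_local_max]).  Adding [i t sin(n x)] on
    the circle changes mass and L^6 norm at order [t^2] with constants that do not
    depend on [n], whereas the Dirichlet integral grows like [n^2 t^2]; a rescaling
    restores the mass.

    _Not a minimum_ (lemma [wave_not_local_min]).  Rescale [Phi_w'] to mass
    [mu(w)].  If [s] is the quotient of the masses, its energy is
    [(3 s - s^3) p(w') + w' mu(w) <= 2 p(w') + w' mu(w)], which is less than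
    [E(Phi_w)] by strict concavity.  It remains to see that [Phi_w'] tends to
    [Phi_w] in [H^1] for some sequence [w' -> w] (lemma [wave_limit]).  By the
    weak form of the equation of [Phi_w], the form [B_w(Phi_w' - Phi_w)] only
    involves [p(w)], [p(w')], [mu(w')] and the integral of [Phi_w^5 Phi_w'], so
    pointwise convergence is enough.  This comes from the profile equation
    [u'' = - 3 u^5 - w u]: the waves are bounded together with their first two
    derivatives, they have a pointwise limit along an ultrafilter, which solves the
    equation again, Gronwall's inequality turns convergence of the Cauchy data
    into convergence everywhere along a sequence (lemma [profile_compact]), and
    the uniqueness of the positive wave identifies the limit. *)

Set Implicit Arguments.
Unset Strict Implicit.
Unset Printing Implicit Defensive.

(** * Integrals of real functions *)

Section RealIntegrals.
Context {R : realType}.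
Local Notation leb := (@lebesgue_measure R).
Implicit Types (D : set R) (f g : R -> R).

Lemma aeS (P Q : R -> Prop) : (forall x, P x -> Q x) ->
  {ae leb, forall x, P x} -> {ae leb, forall x, Q x}.
Proof. by move=> PQ; apply: (@filterS _ _ (ae_filter_ringOfSetsType leb)). Qed.

Lemma aeI (P Q : R -> Prop) : {ae leb, forall x, P x} ->
  {ae leb, forall x, Q x} -> {ae leb, forall x, P x /\ Q x}.
Proof. by apply: (@filterI _ _ (ae_filter_ringOfSetsType leb)). Qed.

Definition rintegrable D f : Prop := leb.-integrable D (EFin \o f).

Lemma rintegrable_measurable D f : rintegrable D f -> measurable_fun D f.
Proof. by move=> /measurable_int/measurable_EFinP. Qed.

Lemma rintegrableD D f g : measurable D -> rintegrable D f -> rintegrable D g ->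
  rintegrable D (fun x => f x + g x).
Proof. by move=> mD fi gi; exact: integrableD fi gi. Qed.

Lemma rintegrableZ D f k : measurable D -> rintegrable D f ->
  rintegrable D (fun x => k * f x).
Proof. by move=> mD fi; exact: integrableZl fi. Qed.

Lemma rintegrableB D f g : measurable D -> rintegrable D f -> rintegrable D g ->
  rintegrable D (fun x => f x - g x).
Proof. by move=> mD fi gi; exact: integrableB fi gi. Qed.

Lemma rintegrable_le D f g : measurable D -> measurable_fun D f ->
  rintegrable D g -> (forall x, D x -> `|f x| <= g x) -> rintegrable D f.
Proof.
move=> mD mf gi fg; apply: le_integrable gi => //; first exact/measurable_EFinP.
by move=> x Dx /=; rewrite lee_fin (le_trans (fg _ Dx))// ler_norm.
Qed.

Lemma rintegrableS D D' f : measurable D -> measurable D' -> D' `<=` D ->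
  rintegrable D f -> rintegrable D' f.
Proof. by move=> mD mD' DD' fi; exact: integrableS fi. Qed.

Lemma Rintegral_subset D D' f : measurable D -> measurable D' -> D' `<=` D ->
  (forall x, D x -> 0 <= f x) -> rintegrable D f ->
  \int[leb]_(x in D') f x <= \int[leb]_(x in D) f x.
Proof.
move=> mD mD' DD' f0 fi; rewrite /Rintegral fine_le//.
- by apply: integrable_fin_num => //; exact: rintegrableS fi.
- exact: integrable_fin_num.
- apply: ge0_subset_integral => //.
    by apply/measurable_EFinP; exact: rintegrable_measurable.
Qed.

Lemma ae_eq_rintegrable D f g : measurable D -> measurable_fun D g ->
  {ae leb, forall x, D x -> f x = g x} -> rintegrable D f -> rintegrable D g.
Proof.
move=> mD mg fg /integrableP[mf fi]; apply/integrableP.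
have mg' : measurable_fun D (EFin \o g) by apply/measurable_EFinP.
split => //; rewrite -(_ : (\int[leb]_(x in D) `|(EFin \o f) x| = \int[leb]_(x in D) `|(EFin \o g) x|)%E)//.
apply: ae_eq_integral => //; try exact: measurableT_comp.
by apply: aeS fg => x fg Dx /=; rewrite fg.
Qed.

Lemma ae_eq_Rintegral D f g : measurable D -> measurable_fun D f ->
  measurable_fun D g -> {ae leb, forall x, D x -> f x = g x} ->
  \int[leb]_(x in D) f x = \int[leb]_(x in D) g x.
Proof.
move=> mD mf mg fg; congr fine; apply: ae_eq_integral => //.
- exact/measurable_EFinP.
- exact/measurable_EFinP.
- by apply: aeS fg => x fg Dx /=; rewrite fg.
Qed.

Lemma Rintegral_cst_itv (x y c : R) : x <= y ->
  \int[leb]_(t in `[x, y]) c = c * (y - x).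
Proof.
move=> xy; rewrite Rintegral_cst//= lebesgue_measure_itv/= lte_fin.
by move: xy; rewrite le_eqVlt => /predU1P[->|->//]; rewrite ltxx subrr.
Qed.

Lemma rintegrable_cst (x y c : R) : rintegrable `[x, y] (fun=> c).
Proof.
apply: measurable_bounded_integrable => //.
  by rewrite /= lebesgue_measure_itv/=; case: ifP => // _; rewrite -EFinB ltry.
by exists `|c|; split => // k ck t _ /=; exact: ltW.
Qed.

Lemma Rintegral_norm_le (x y c : R) f : x <= y -> rintegrable `[x, y] f ->
  (forall t, x <= t <= y -> `|f t| <= c) ->
  `|\int[leb]_(t in `[x, y]) f t| <= c * (y - x).
Proof.
move=> xy fi fc; apply: (le_trans (le_normr_Rintegral _ fi)) => //.
rewrite -Rintegral_cst_itv//; apply: le_Rintegral => //.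
- exact: integrable_norm.
- exact: rintegrable_cst.
Qed.

(** Cauchy-Schwarz against a constant: [0 <= \int (f - c)^2] at the mean value
    [c] of [f]. *)
Lemma sqr_Rintegral_le (x y : R) f : x < y -> rintegrable `[x, y] f ->
  rintegrable `[x, y] (fun t => f t ^+ 2) ->
  (\int[leb]_(t in `[x, y]) f t) ^+ 2 <=
  (y - x) * \int[leb]_(t in `[x, y]) (f t ^+ 2).
Proof.
move=> xy fi f2i; set F := \int[leb]_(t in _) f t; set c := F / (y - x).
have : 0 <= \int[leb]_(t in `[x, y]) (f t ^+ 2 - (2 * c) * f t + c ^+ 2).
  apply: Rintegral_ge0 => t _; have := sqr_ge0 (f t - c).
  by rewrite sqrrB -mulr_natl [f t * c]mulrC mulrA.
have i1 := rintegrableZ (2 * c) (measurable_itv `[x, y]) fi.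
have i2 := rintegrableB (measurable_itv `[x, y]) f2i i1.
rewrite RintegralD//; last exact: rintegrable_cst.
rewrite RintegralB// RintegralZl// Rintegral_cst_itv -/F; last exact: ltW.
have d0 : y - x != 0 by rewrite subr_eq0 gt_eqF.
have -> : 2 * c * F = 2 * F ^+ 2 / (y - x) by rewrite /c; field.
have -> : c ^+ 2 * (y - x) = F ^+ 2 / (y - x) by rewrite /c; field.
rewrite -(@pmulr_rge0 _ (y - x)) ?subr_gt0//.
have -> (I : R) : (y - x) * (I - 2 * F ^+ 2 / (y - x) + F ^+ 2 / (y - x)) =
   (y - x) * I - F ^+ 2 by field.
by rewrite subr_ge0.
Qed.

(** By Lebesgue differentiation: [f] is almost everywhere the derivative of its
    indefinite integral, which is constant. *)
Lemma Rintegral_eq0_ae (a b : R) f : rintegrable `[a, b] f ->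
  (forall x, a <= x -> x <= b -> \int[leb]_(t in `[a, x]) f t = 0) ->
  {ae leb, forall x, `[a, b]%classic x -> f x = 0}.
Proof.
move=> fi f0.
have mab : measurable `[a, b] by exact: measurable_itv.
have gi : leb.-integrable setT (EFin \o (f \_ `[a, b])).
  by have /integrable_mkcond := fi; rewrite -restrict_EFin; exact.
have loc : locally_integrable setT (f \_ `[a, b]) by exact: integrable_locally.
have F0 x : \int[leb]_(t in `]-oo, x]) (f \_ `[a, b]) t = 0.
  rewrite -Rintegral_mkcondr; have [xa|ax] := ltP x a.
    rewrite (_ : _ `&` _ = set0) ?Rintegral_set0//; apply/seteqP; split => t //=.
    rewrite !in_itv/= => -[tx /andP[at_ _]].
    by have := le_lt_trans (le_trans at_ tx) xa; rewrite ltxx.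
  have [xb|bx] := leP x b.
    rewrite (_ : _ `&` _ = `[a, x]%classic) ?f0//; apply/seteqP; split => t /=;
      rewrite !in_itv/=; first by move=> [-> /andP[->]].
    by move=> /andP[at_ tx]; rewrite tx at_ (le_trans tx).
  have [ab|ba] := leP a b; last first.
    rewrite (_ : _ `&` _ = set0) ?Rintegral_set0//; apply/seteqP; split => t //=.
    rewrite !in_itv/= => -[_ /andP[at_ tb]].
    by have := le_lt_trans (le_trans at_ tb) ba; rewrite ltxx.
  rewrite (_ : _ `&` _ = `[a, b]%classic) ?f0//; apply/seteqP; split => t /=;
    rewrite !in_itv/=; first by move=> [].
  by move=> /andP[at_ tb]; rewrite at_ tb (le_trans tb (ltW bx)).
have gi' y : leb.-integrable `]-oo, y] (EFin \o (f \_ `[a, b])).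
  by apply: integrableS gi.
apply: aeS (FTC1Ny gi' loc) => x /= [_ dF] xab.
have -> : f x = (f \_ `[a, b]) x by rewrite patchE mem_set.
rewrite -dF (_ : (fun _ => _) = cst 0); last by apply/funext => z; exact: F0.
by rewrite derive1_cst.
Qed.

End RealIntegrals.

(** * Square-integrable functions with complex values *)

Section ComplexL2.
Local Open Scope complex_scope.
Context {R : realType}.
Local Notation leb := (@lebesgue_measure R).
Local Notation Re := (@complex.Re R).
Local Notation Im := (@complex.Im R).
Implicit Types (D : set R) (u w g k : R -> R[i]) (z : R[i]) (t : R).

(** The euclidean inner product of the real plane [R[i]].  All the quadratic
    quantities below are real bilinear, and expressing them through it keeps the
    complex structure out of the integrals. *)
Definition dotc (z z' : R[i]) : R := Re z * Re z' + Im z * Im z'.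

Lemma sqr_normc_dotc z : ComplexField.Normc.normc z ^+ 2 = dotc z z.
Proof. by case: z => a b; rewrite sqr_sqrtr ?addr_ge0 ?sqr_ge0// !expr2. Qed.

Lemma normcX6_dotc z : ComplexField.Normc.normc z ^+ 6 = dotc z z ^+ 3.
Proof. by rewrite -sqr_normc_dotc -exprM. Qed.

Lemma dotc_ge0 z : 0 <= dotc z z.
Proof. by rewrite -sqr_normc_dotc sqr_ge0. Qed.

Lemma Re_line z z' t : Re (z + t%:C * z') = Re z + t * Re z'.
Proof. by case: z z' => a b [c d] /=; rewrite mul0r subr0. Qed.

Lemma Im_line z z' t : Im (z + t%:C * z') = Im z + t * Im z'.
Proof. by case: z z' => a b [c d] /=; rewrite mul0r addr0. Qed.

Lemma dotc_line z z' t : dotc (z + t%:C * z') (z + t%:C * z') =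
  dotc z z + 2 * t * dotc z z' + t ^+ 2 * dotc z' z'.
Proof. by rewrite /dotc Re_line Im_line; ring. Qed.

Lemma normr_dotc_le z z' (e : R) : 0 < e ->
  2 * `|dotc z z'| <= e * dotc z z + e^-1 * dotc z' z'.
Proof.
move=> e0; have key s : s ^+ 2 = 1 -> 2 * (s * dotc z z') <=
    e * dotc z z + e^-1 * dotc z' z'.
  move=> s1; rewrite -subr_ge0.
  have -> : e * dotc z z + e^-1 * dotc z' z' - 2 * (s * dotc z z') =
    e * (s ^+ 2) * dotc z z + e^-1 * dotc z' z' - 2 * (s * dotc z z').
    by rewrite s1 mulr1.
  have -> : e * (s ^+ 2) * dotc z z + e^-1 * dotc z' z' - 2 * (s * dotc z z') =
    e^-1 * ((e * s * Re z - Re z') ^+ 2 + (e * s * Im z - Im z') ^+ 2).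
    by rewrite /dotc; field; rewrite gt_eqF.
  by rewrite mulr_ge0 ?invr_ge0 ?(ltW e0)// addr_ge0 ?sqr_ge0.
have [d0|d0] := leP 0 (dotc z z').
  by rewrite ger0_norm// -[dotc z z']mul1r; apply: key; rewrite expr1n.
by rewrite ltr0_norm// -mulN1r; apply: key; rewrite sqrrN expr1n.
Qed.

Lemma measurable_dotc D u w : measurable_fun D (Re \o u) ->
  measurable_fun D (Im \o u) -> measurable_fun D (Re \o w) ->
  measurable_fun D (Im \o w) -> measurable_fun D (fun x => dotc (u x) (w x)).
Proof. by move=> *; apply: measurable_funD; exact: measurable_funM. Qed.

Lemma square_integrableP D u : square_integrable D u <->
  [/\ measurable_fun D (Re \o u), measurable_fun D (Im \o u) &
      rintegrable D (fun x => dotc (u x) (u x))].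
Proof.
have e : (fun x => (ComplexField.Normc.normc (u x) ^+ 2)%:E) =
    EFin \o (fun x => dotc (u x) (u x)).
  by apply/funext => x /=; rewrite sqr_normc_dotc.
by rewrite /square_integrable e.
Qed.

Lemma rintegrable_dotc D u w : measurable D -> square_integrable D u ->
  square_integrable D w -> rintegrable D (fun x => dotc (u x) (w x)).
Proof.
move=> mD /square_integrableP[mu1 mu2 ui] /square_integrableP[mw1 mw2 wi].
apply: rintegrable_le (rintegrableD mD ui wi) _ => //.
  exact: measurable_dotc.
move=> x _; have := normr_dotc_le (u x) (w x) ltr01.
rewrite invr1 !mul1r; apply: le_trans.
by rewrite ler_peMl// ler1n.
Qed.

Lemma measurable_Re_line D u w t : measurable_fun D (Re \o u) ->
  measurable_fun D (Re \o w) ->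
  measurable_fun D (Re \o (fun x => u x + t%:C * w x)).
Proof.
move=> mu mw; rewrite (_ : _ \o _ = fun x => (Re \o u) x + t * (Re \o w) x).
  by apply: measurable_funD => //; apply: measurable_funM.
by apply/funext => x /=; rewrite Re_line.
Qed.

Lemma measurable_Im_line D u w t : measurable_fun D (Im \o u) ->
  measurable_fun D (Im \o w) ->
  measurable_fun D (Im \o (fun x => u x + t%:C * w x)).
Proof.
move=> mu mw; rewrite (_ : _ \o _ = fun x => (Im \o u) x + t * (Im \o w) x).
  by apply: measurable_funD => //; apply: measurable_funM.
by apply/funext => x /=; rewrite Im_line.
Qed.

Definition L2ip D u w : R := \int[leb]_(x in D) dotc (u x) (w x).

Lemma L2ip_ge0 D u : 0 <= L2ip D u u.
Proof. by apply: Rintegral_ge0 => x _; exact: dotc_ge0. Qed.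

Section Line.
Variables (D : set R) (u w : R -> R[i]).
Hypotheses (mD : measurable D) (ui : square_integrable D u)
           (wi : square_integrable D w).

Let i1 (c : R) := rintegrableZ c mD (rintegrable_dotc mD ui wi).
Let i2 (c : R) := rintegrableZ c mD (rintegrable_dotc mD wi wi).
Let i3 (a b : R) := rintegrableD mD (rintegrableD mD (rintegrable_dotc mD ui ui) (i1 a)) (i2 b).

Lemma square_integrable_line t : square_integrable D (fun x => u x + t%:C * w x).
Proof.
have [mu1 mu2 _] := ui; have [mw1 mw2 _] := wi.
apply/square_integrableP; split.
- exact: measurable_Re_line.
- exact: measurable_Im_line.
- under [X in rintegrable _ X]eq_fun do rewrite dotc_line.
  exact: i3.
Qed.

Lemma L2ip_line t : L2ip D (fun x => u x + t%:C * w x) (fun x => u x + t%:C * w x) =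
  L2ip D u u + 2 * t * L2ip D u w + t ^+ 2 * L2ip D w w.
Proof.
rewrite /L2ip; under eq_Rintegral do rewrite dotc_line.
rewrite RintegralD//; [|exact: rintegrableD (rintegrable_dotc _ _ _) (i1 _)|exact: i2].
rewrite RintegralD//; [|exact: rintegrable_dotc|exact: i1].
by rewrite !RintegralZl//; exact: rintegrable_dotc.
Qed.

End Line.

Lemma weak_derivative_line D u w g k t : weak_derivative D u g ->
  weak_derivative D w k ->
  weak_derivative D (fun x => u x + t%:C * w x) (fun x => g x + t%:C * k x).
Proof.
move=> ug wk x y Dx Dy xy.
have [[gr gi] eg] := ug _ _ Dx Dy xy; have [[kr ki] ek] := wk _ _ Dx Dy xy.
have mxy : measurable `[x, y] by exact: measurable_itv.
split.
  split.
    rewrite (_ : _ \o _ = EFin \o (fun x => Re (g x) + t * Re (k x))).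
      exact: rintegrableD mxy gr (rintegrableZ t mxy kr).
    by apply/funext => z /=; rewrite Re_line.
  rewrite (_ : _ \o _ = EFin \o (fun x => Im (g x) + t * Im (k x))).
    exact: rintegrableD mxy gi (rintegrableZ t mxy ki).
  by apply/funext => z /=; rewrite Im_line.
rewrite opprD addrACA -mulrBr eg ek /Cintegral.
apply/eqP; rewrite eq_complex Re_line Im_line /=.
apply/andP; split; apply/eqP.
  under [in RHS]eq_Rintegral do rewrite Re_line.
  by rewrite RintegralD// ?RintegralZl//; exact: rintegrableZ.
under [in RHS]eq_Rintegral do rewrite Im_line.
by rewrite RintegralD// ?RintegralZl//; exact: rintegrableZ.
Qed.

Lemma weak_derivative_Re D u g x y : weak_derivative D u g -> D x -> D y ->
  x <= y -> rintegrable `[x, y] (Re \o g) /\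
  Re (u y) - Re (u x) = \int[leb]_(t in `[x, y]) (Re \o g) t.
Proof.
move=> ug Dx Dy xy; have [[gr _] /(congr1 Re)] := ug _ _ Dx Dy xy.
by case: (u y) (u x) => a b [c d] /=.
Qed.

Lemma weak_derivative_Im D u g x y : weak_derivative D u g -> D x -> D y ->
  x <= y -> rintegrable `[x, y] (Im \o g) /\
  Im (u y) - Im (u x) = \int[leb]_(t in `[x, y]) (Im \o g) t.
Proof.
move=> ug Dx Dy xy; have [[_ gi] /(congr1 Im)] := ug _ _ Dx Dy xy.
by case: (u y) (u x) => a b [c d] /=.
Qed.

End ComplexL2.

(** * Weak derivatives on the circle and on the half-line *)

Section Branches.
Local Open Scope complex_scope.
Context {R : realType}.
Local Notation leb := (@lebesgue_measure R).
Local Notation Re := (@complex.Re R).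
Local Notation Im := (@complex.Im R).
Implicit Types (D : set R) (u w g k : R -> R[i]) (z : R[i]) (t : R).

(** What the circle and the half-line have in common: both are intervals with
    a left end point, exhausted by segments, and of length at least one. *)
Record branch D : Prop := Branch {
  branch_measurable : measurable D;
  branch_itv : forall x y, D x -> D y -> `[x, y] `<=` D;
  branch_exhaust : exists (a : R) (b : nat -> R), [/\ D a, forall n, D (b n),
    forall x, D x -> a <= x & forall x, D x -> exists n, x <= b n];
  branch_unit : forall x, D x -> exists y, [/\ D y, D (y + 1), y <= x & x <= y + 1] }.

Lemma pi_ge1 : (1 : R) <= pi.
Proof. by rewrite (le_trans _ (pi_ge2 R))// ler1n. Qed.

Lemma loop_branch : branch (loop : set R).
Proof.
have p1 := pi_ge1; split.
- exact: measurable_itv.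
- move=> x y; rewrite /loop/= !in_itv/= => /andP[px xp] /andP[py yp] z /=.
  by rewrite !in_itv/= => /andP[xz zy]; rewrite (le_trans px)//= (le_trans zy).
- exists (- pi), (fun=> pi); rewrite /loop/=; split.
  + by rewrite in_itv/= lexx/=; lra.
  + by move=> _; rewrite in_itv/= lexx andbT; lra.
  + by move=> x; rewrite in_itv/= => /andP[].
  + by move=> x; rewrite in_itv/= => /andP[_ xp]; exists 0%N.
- move=> x; rewrite /loop/= in_itv/= => /andP[px xp]; have [x0|x0] := leP x 0.
    by exists x; rewrite !in_itv/=; split; try (apply/andP; split); lra.
  by exists (x - 1); rewrite !in_itv/=; split; try (apply/andP; split); lra.
Qed.

Lemma tail_branch : branch (tail : set R).
Proof.
split.
- exact: measurable_itv.
- move=> x y; rewrite /tail/= !in_itv/= !andbT => px py z /=.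
  by rewrite !in_itv/= andbT => /andP[xz zy]; rewrite (le_trans px).
- exists 0, (fun n => n%:R); rewrite /tail/=; split.
  + by rewrite in_itv/= lexx.
  + by move=> n; rewrite in_itv/= ler0n.
  + by move=> x; rewrite in_itv/= andbT.
  + move=> x; rewrite in_itv/= andbT => x0; exists (Num.bound x).
    by rewrite ltW// archi_boundP.
- move=> x; rewrite /tail/= in_itv/= andbT => x0.
  by exists x; rewrite !in_itv/= !andbT; split; lra.
Qed.

Section Branch.
Variables (D : set R) (bD : branch D).
Let mD : measurable D := branch_measurable bD.

Lemma branch_measurable_fun (f : R -> R) :
  (forall x y, D x -> D y -> x <= y -> rintegrable `[x, y] f) ->
  measurable_fun D f.
Proof.
move=> fi; have [a [b [Da Db ab abD]]] := branch_exhaust bD.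
have -> : D = \bigcup_n `[a, b n]%classic.
  apply/seteqP; split => [x Dx|x [n _]].
    by have [n xb] := abD _ Dx; exists n => //=; rewrite in_itv/= ab.
  exact: branch_itv.
apply/measurable_fun_bigcup => [n|n]; first exact: measurable_itv.
by apply: rintegrable_measurable; apply: fi => //; exact: ab.
Qed.

Lemma weak_derivative_measurable u g : weak_derivative D u g ->
  measurable_fun D (Re \o g) /\ measurable_fun D (Im \o g).
Proof.
move=> ug; split; apply: branch_measurable_fun => x y Dx Dy xy.
  exact: (weak_derivative_Re ug Dx Dy xy).1.
exact: (weak_derivative_Im ug Dx Dy xy).1.
Qed.

Lemma branch_Rintegral_eq0_ae (f : R -> R) :
  (forall x y, D x -> D y -> x <= y -> rintegrable `[x, y] f) ->
  (forall x y, D x -> D y -> x <= y -> \int[leb]_(t in `[x, y]) f t = 0) ->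
  {ae leb, forall x, D x -> f x = 0}.
Proof.
move=> fi f0; have [a [b [Da Db ab abD]]] := branch_exhaust bD.
have H n : {ae leb, forall x, `[a, b n]%classic x -> f x = 0}.
  apply: Rintegral_eq0_ae; first exact/fi/ab.
  move=> x ax xb; apply: f0 => //; apply: (branch_itv bD Da (Db n)).
  by rewrite /= in_itv/= ax.
apply: aeS (ae_foralln H) => x Hx Dx; have [n xb] := abD _ Dx.
by apply: (Hx n); rewrite /= in_itv/= ab.
Qed.

(** This makes the Dirichlet integral independent of the representative that is
    chosen for the weak derivative. *)
Lemma weak_derivative_unique u g k : weak_derivative D u g ->
  weak_derivative D u k -> {ae leb, forall x, D x -> g x = k x}.
Proof.
move=> ug uk.
have HR : {ae leb, forall x, D x -> Re (g x) - Re (k x) = 0}.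
  apply: branch_Rintegral_eq0_ae => x y Dx Dy xy;
    have [gi eg] := weak_derivative_Re ug Dx Dy xy;
    have [ki ek] := weak_derivative_Re uk Dx Dy xy.
    exact: rintegrableB.
  by rewrite RintegralB// -eg -ek subrr.
have HI : {ae leb, forall x, D x -> Im (g x) - Im (k x) = 0}.
  apply: branch_Rintegral_eq0_ae => x y Dx Dy xy;
    have [gi eg] := weak_derivative_Im ug Dx Dy xy;
    have [ki ek] := weak_derivative_Im uk Dx Dy xy.
    exact: rintegrableB.
  by rewrite RintegralB// -eg -ek subrr.
apply: aeS (aeI HR HI) => x [gr gi] Dx; apply/eqP; rewrite eq_complex.
by rewrite -subr_eq0 gr// eqxx -subr_eq0 gi// eqxx.
Qed.

Lemma L2ip_ae_eq g k : measurable_fun D (Re \o g) -> measurable_fun D (Im \o g) ->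
  measurable_fun D (Re \o k) -> measurable_fun D (Im \o k) ->
  {ae leb, forall x, D x -> g x = k x} -> L2ip D g g = L2ip D k k.
Proof.
move=> *; apply: ae_eq_Rintegral => //; try exact: measurable_dotc.
by apply: aeS; last eassumption; move=> x gk Dx; rewrite gk.
Qed.

Lemma H1_weak_derivative u g : H1 D u -> weak_derivative D u g ->
  square_integrable D g.
Proof.
move=> [_ [k uk ki]] ug; have [mg1 mg2] := weak_derivative_measurable ug.
have [mk1 mk2] := weak_derivative_measurable uk.
have /square_integrableP[_ _ kk] := ki; apply/square_integrableP; split => //.
apply: ae_eq_rintegrable kk => //; first exact: measurable_dotc.
by apply: aeS (weak_derivative_unique uk ug) => x gk Dx; rewrite gk.
Qed.

(** Functions of class H^1 are Hoelder continuous of exponent 1/2. *)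
Lemma weak_derivative_hoelder u g x y : weak_derivative D u g ->
  square_integrable D g -> D x -> D y -> x <= y ->
  dotc (u y - u x) (u y - u x) <= (y - x) * L2ip D g g.
Proof.
move=> ug gi Dx Dy; rewrite le_eqVlt => /predU1P[->|xy].
  by rewrite !subrr mul0r /dotc/= !mulr0 addr0.
have [gr er] := weak_derivative_Re ug Dx Dy (ltW xy).
have [gm em] := weak_derivative_Im ug Dx Dy (ltW xy).
have mxy : measurable `[x, y] by exact: measurable_itv.
have sxy : `[x, y] `<=` D by exact: branch_itv.
have /square_integrableP[mg1 mg2 gg] := gi.
have ggx : rintegrable `[x, y] (fun t => dotc (g t) (g t)) by exact: rintegrableS gg.
have gr2 : rintegrable `[x, y] (fun t => (Re \o g) t ^+ 2).
  apply: rintegrable_le ggx _ => //.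
    by apply: measurable_funX; exact: measurable_funS mg1.
  by move=> t _; rewrite ger0_norm ?sqr_ge0// /dotc -!expr2 lerDl sqr_ge0.
have gm2 : rintegrable `[x, y] (fun t => (Im \o g) t ^+ 2).
  apply: rintegrable_le ggx _ => //.
    by apply: measurable_funX; exact: measurable_funS mg2.
  by move=> t _; rewrite ger0_norm ?sqr_ge0// /dotc -!expr2 lerDr sqr_ge0.
have -> : dotc (u y - u x) (u y - u x) =
    (Re (u y) - Re (u x)) ^+ 2 + (Im (u y) - Im (u x)) ^+ 2.
  by rewrite /dotc -!expr2; case: (u y) (u x) => a b [c d].
rewrite er em; apply: (le_trans (lerD (sqr_Rintegral_le xy gr gr2) (sqr_Rintegral_le xy gm gm2))).
rewrite -mulrDr ler_pM2l ?subr_gt0// -RintegralD//.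
by apply: Rintegral_subset => // t _; exact: dotc_ge0.
Qed.

(** The Sobolev embedding into bounded functions: compare the value at [x] with
    the mean value over a segment of length one. *)
Lemma weak_derivative_bounded u g x : square_integrable D u ->
  weak_derivative D u g -> square_integrable D g -> D x ->
  dotc (u x) (u x) <= 2 * (L2ip D u u + L2ip D g g).
Proof.
move=> ui ug gi Dx; have [y [Dy Dy1 yx xy]] := branch_unit bD Dx.
have /square_integrableP[mu1 mu2 uu] := ui.
have mys : measurable `[y, y + 1] by exact: measurable_itv.
have sD : `[y, y + 1] `<=` D by exact: branch_itv.
have uuy : rintegrable `[y, y + 1] (fun t => dotc (u t) (u t)) by exact: rintegrableS uu.
have key s : `[y, y + 1]%classic s ->
    dotc (u x) (u x) <= 2 * dotc (u s) (u s) + 2 * L2ip D g g.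
  move=> sy; have Ds := sD _ sy; move: sy; rewrite /= in_itv/= => /andP[ys sy].
  have : dotc (u x - u s) (u x - u s) <= L2ip D g g.
    have [xs|sx] := leP x s.
      rewrite (_ : dotc _ _ = dotc (u s - u x) (u s - u x)); last first.
        by rewrite /dotc; case: (u s) (u x) => a b [c d] /=; ring.
      apply: (le_trans (weak_derivative_hoelder ug gi Dx Ds xs)).
      by rewrite ler_piMl ?L2ip_ge0//; lra.
    apply: (le_trans (weak_derivative_hoelder ug gi Ds Dx (ltW sx))).
    by rewrite ler_piMl ?L2ip_ge0//; lra.
  rewrite -(ler_pM2l (ltr0n _ 2)) => H; apply: le_trans (lerD (lexx _) H).
  rewrite -subr_ge0; set z := u x; set z' := u s.
  have -> : 2 * dotc z' z' + 2 * dotc (z - z') (z - z') - dotc z z =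
     (Re z - 2 * Re z') ^+ 2 + (Im z - 2 * Im z') ^+ 2.
    by rewrite /dotc; case: z z' => a b [c d] /=; ring.
  by rewrite addr_ge0 ?sqr_ge0.
have i1 := rintegrableZ 2 mys uuy.
have : \int[leb]_(s in `[y, y + 1]) dotc (u x) (u x) <=
    \int[leb]_(s in `[y, y + 1]) (2 * dotc (u s) (u s) + 2 * L2ip D g g).
  apply: le_Rintegral => //; first exact: rintegrable_cst.
  exact: rintegrableD mys i1 (rintegrable_cst _ _ _).
have y1 : y <= y + 1 by rewrite lerDl.
rewrite Rintegral_cst_itv// RintegralD//; last exact: rintegrable_cst.
rewrite RintegralZl// Rintegral_cst_itv// addrAC subrr add0r !mulr1 => H.
apply: (le_trans H); rewrite mulrDr lerD2r ler_pM2l//.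
by apply: Rintegral_subset => // t _; exact: dotc_ge0.
Qed.

Lemma H1_line u w t : H1 D u -> H1 D w -> H1 D (fun x => u x + t%:C * w x).
Proof.
move=> [ui [g ug gi]] [wi [k wk ki]]; split; first exact: square_integrable_line.
exists (fun x => g x + t%:C * k x); first exact: weak_derivative_line.
exact: square_integrable_line.
Qed.

Lemma H1_wderiv u : H1 D u ->
  weak_derivative D u (wderiv D u) /\ square_integrable D (wderiv D u).
Proof.
move=> Hu; have [_ [g ug _]] := Hu.
have uw : weak_derivative D u (wderiv D u).
  by rewrite /wderiv; case: xgetP => [h -> //|/(_ g)]; exact.
by split=> //; exact: H1_weak_derivative uw.
Qed.

Lemma L2ip_wderiv u g : H1 D u -> weak_derivative D u g ->
  L2ip D (wderiv D u) (wderiv D u) = L2ip D g g.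
Proof.
move=> Hu ug; have [uw _] := H1_wderiv Hu.
have [? ?] := weak_derivative_measurable ug.
have [? ?] := weak_derivative_measurable uw.
by apply: L2ip_ae_eq => //; exact: weak_derivative_unique uw ug.
Qed.

End Branch.
End Branches.

(** * Mass, Dirichlet and L^6 integrals on the tadpole *)

Section TadpoleForms.
Local Open Scope complex_scope.
Context {R : realType}.
Local Notation leb := (@lebesgue_measure R).
Implicit Types (U V W G : tadfun R) (t : R).

Definition mass_ip U W : R := L2ip loop U.1 W.1 + L2ip tail U.2 W.2.

Lemma sqr_Lq_norm2 U : Lq_norm 2 U ^+ 2 = mass_ip U U.
Proof.
have -> : mass_ip U U = Lq_pow 2 U.
  by congr (_ + _); apply: eq_Rintegral => x _; rewrite sqr_normc_dotc.
have L0 : 0 <= Lq_pow 2 U.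
  by apply: addr_ge0; apply: Rintegral_ge0 => x _; exact: sqr_ge0.
by rewrite /Lq_norm -powR_mulrn ?powR_ge0// -powRrM mulVf ?powRr1// pnatr_eq0.
Qed.

Definition L6int U : R := \int[leb]_(x in loop) (dotc (U.1 x) (U.1 x) ^+ 3) +
  \int[leb]_(x in tail) (dotc (U.2 x) (U.2 x) ^+ 3).

Lemma L6int_ge0 U : 0 <= L6int U.
Proof.
by apply: addr_ge0; apply: Rintegral_ge0 => x _; rewrite exprn_ge0// dotc_ge0.
Qed.

Lemma Lq_pow6 U : Lq_pow 6 U = L6int U.
Proof. by congr (_ + _); apply: eq_Rintegral => x _; rewrite normcX6_dotc. Qed.

Lemma expr6_Lq_norm U : Lq_norm 6 U ^+ 6 = L6int U.
Proof.
rewrite /Lq_norm Lq_pow6 -powR_mulrn ?powR_ge0// -powRrM mulVf ?pnatr_eq0//.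
by rewrite powRr1// L6int_ge0.
Qed.

Definition grad_ip U W : R := mass_ip (grad U) (grad W).

Lemma massE U : mass U = mass_ip U U. Proof. exact: sqr_Lq_norm2. Qed.
Lemma dirichletE U : dirichlet U = grad_ip U U. Proof. exact: sqr_Lq_norm2. Qed.
Lemma energyE U : energy U = dirichlet U - L6int U.
Proof. by rewrite /energy expr6_Lq_norm. Qed.

Lemma mass_ge0 U : 0 <= mass U.
Proof. by rewrite massE addr_ge0 ?L2ip_ge0. Qed.
Lemma dirichlet_ge0 U : 0 <= dirichlet U.
Proof. by rewrite dirichletE addr_ge0 ?L2ip_ge0. Qed.

Lemma H1C_line U W t : H1C U -> H1C W -> H1C (tad_line U W t).
Proof.
move=> [Hu Hv eu ev] [Ku Kv fu fv]; split => /=.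
- exact: (H1_line loop_branch).
- exact: (H1_line tail_branch).
- by rewrite eu fu.
- by rewrite ev fv.
Qed.

Lemma mass_line U W t : H1C U -> H1C W ->
  mass (tad_line U W t) = mass U + 2 * t * mass_ip U W + t ^+ 2 * mass W.
Proof.
move=> [[Uu _] [Uv _] _ _] [[Wu _] [Wv _] _ _]; rewrite !massE /mass_ip /=.
rewrite !L2ip_line//; first ring.
- exact: branch_measurable tail_branch.
- exact: branch_measurable loop_branch.
Qed.

Lemma dirichlet_grad U G : H1C U -> is_grad U G -> dirichlet U = mass_ip G G.
Proof.
move=> [Hu Hv _ _] [gu gv]; rewrite dirichletE /grad_ip /mass_ip /=.
by rewrite (L2ip_wderiv loop_branch Hu gu) (L2ip_wderiv tail_branch Hv gv).
Qed.

Lemma dirichlet_line U W t : H1C U -> H1C W ->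
  dirichlet (tad_line U W t) = dirichlet U + 2 * t * grad_ip U W + t ^+ 2 * dirichlet W.
Proof.
move=> HU HW; have [Hu Hv _ _] := HU; have [Ku Kv _ _] := HW.
have [ug ui] := H1_wderiv loop_branch Hu; have [vg vi] := H1_wderiv tail_branch Hv.
have [kg ki] := H1_wderiv loop_branch Ku; have [lg li] := H1_wderiv tail_branch Kv.
rewrite (@dirichlet_grad _ (tad_line (grad U) (grad W) t)); last 2 first.
- exact: H1C_line.
- by split; exact: weak_derivative_line.
rewrite !dirichletE /grad_ip /mass_ip /=.
rewrite (L2ip_line (branch_measurable loop_branch) ui ki).
rewrite (L2ip_line (branch_measurable tail_branch) vi li).
have key (a b c a' b' c' : R) : a + 2 * t * b + t ^+ 2 * c +
  (a' + 2 * t * b' + t ^+ 2 * c') = a + a' + 2 * t * (b + b') + t ^+ 2 * (c + c').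
  by ring.
exact: key.
Qed.

Lemma H1C_bounded U : H1C U ->
  (forall x, loop x -> dotc (U.1 x) (U.1 x) <= 2 * (dirichlet U + mass U)) /\
  (forall x, tail x -> dotc (U.2 x) (U.2 x) <= 2 * (dirichlet U + mass U)).
Proof.
move=> [Hu Hv _ _]; rewrite massE dirichletE /grad_ip /mass_ip /=.
have [ug ui] := H1_wderiv loop_branch Hu; have [vg vi] := H1_wderiv tail_branch Hv.
split=> x Dx.
  apply: (le_trans (weak_derivative_bounded loop_branch Hu.1 ug ui Dx)).
  by rewrite ler_pM2l// [leRHS]addrC lerD// lerDl L2ip_ge0.
apply: (le_trans (weak_derivative_bounded tail_branch Hv.1 vg vi Dx)).
by rewrite ler_pM2l// [leRHS]addrC lerD// lerDr L2ip_ge0.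
Qed.

Lemma tad_subE U V : tad_sub U V = tad_line U V (-1).
Proof.
rewrite /tad_sub /tad_line; congr pair; apply/funext => x;
by rewrite rmorphN rmorph1 mulN1r.
Qed.

Lemma tad_scaleE c U : tad_scale c U = tad_line U U (c - 1).
Proof.
rewrite /tad_scale /tad_line; congr pair; apply/funext => x;
by rewrite rmorphB rmorph1 mulrBl mul1r addrC subrK.
Qed.

Lemma H1C_scale c U : H1C U -> H1C (tad_scale c U).
Proof. by move=> HU; rewrite tad_scaleE; exact: H1C_line. Qed.

Lemma H1C_sub U V : H1C U -> H1C V -> H1C (tad_sub U V).
Proof. by move=> HU HV; rewrite tad_subE; exact: H1C_line. Qed.

Lemma mass_scale c U : H1C U -> mass (tad_scale c U) = c ^+ 2 * mass U.
Proof. by move=> HU; rewrite tad_scaleE mass_line// -massE; ring. Qed.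

Lemma dirichlet_scale c U : H1C U -> dirichlet (tad_scale c U) = c ^+ 2 * dirichlet U.
Proof. by move=> HU; rewrite tad_scaleE dirichlet_line// -dirichletE; ring. Qed.

End TadpoleForms.

(** * Expansion of the L^6 integral on a branch *)

Section SixthPower.
Local Open Scope complex_scope.
Context {R : realType}.
Local Notation leb := (@lebesgue_measure R).
Local Notation Re := (@complex.Re R).
Local Notation Im := (@complex.Im R).
Implicit Types (D : set R) (t : R).

Lemma rintegrable_cube D (f : R -> R) (M : R) : measurable D -> rintegrable D f ->
  (forall x, D x -> 0 <= f x) -> (forall x, D x -> f x <= M) ->
  rintegrable D (fun x => f x ^+ 3).
Proof.
move=> mD fi f0 fM; apply: rintegrable_le (rintegrableZ (M ^+ 2) mD fi) _ => //.
  by apply: measurable_funX; exact: rintegrable_measurable.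
move=> x Dx; rewrite ger0_norm ?exprn_ge0 ?f0// exprSr.
by rewrite ler_wpM2r ?f0// lerXn2r ?nnegrE ?f0 ?fM// (le_trans (f0 _ Dx) (fM _ Dx)).
Qed.

Lemma Rintegral_approx D (f g h : R -> R) : measurable D -> rintegrable D f ->
  rintegrable D g -> rintegrable D h -> (forall x, D x -> `|f x - g x| <= h x) ->
  `|\int[leb]_(x in D) f x - \int[leb]_(x in D) g x| <= \int[leb]_(x in D) h x.
Proof.
move=> mD fi gi hi fgh; rewrite -RintegralB//.
have fgi := rintegrableB mD fi gi.
apply: (le_trans (@le_normr_Rintegral _ _ _ leb D (fun x => f x - g x) mD fgi)).
apply: le_Rintegral => //; exact: integrable_norm.
Qed.

(** With [a = |u|^2], [b = u . w] and [c = |w|^2], the cube on the left is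
    [|u + t w|^6]; the remainder is controlled by [a + c], hence integrable. *)
Lemma cube_expand (a b c t M : R) : 0 <= a -> 0 <= c -> a <= M -> c <= M ->
  `|b| <= a + c -> `|t| <= 1 ->
  `|(a + 2 * t * b + t ^+ 2 * c) ^+ 3 - (a ^+ 3 + 6 * t * (a ^+ 2 * b))|
  <= 228 * M ^+ 2 * t ^+ 2 * (a + c).
Proof.
move=> a0 c0 aM cM bac t1.
(* everything is compared with s, and d is the increment of |u + t w|^2 *)
pose s := a + c; pose d := 2 * t * b + t ^+ 2 * c.
have s0 : 0 <= s by rewrite /s addr_ge0.
have sM : s <= 2 * M by rewrite /s; lra.
have tt : t ^+ 2 <= `|t| by rewrite -(real_normK (num_real t)) expr2 ler_piMr.
have ds : `|d| <= 3 * `|t| * s.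
  have -> : 3 * `|t| * s = 2 * `|t| * s + `|t| * s by ring.
  apply: (le_trans (ler_normD _ _)); apply: lerD.
    by rewrite !normrM normr_nat ler_wpM2l// mulr_ge0.
  rewrite normrM ger0_norm ?sqr_ge0// ler_pM ?sqr_ge0//.
  by rewrite ger0_norm// lerDr.
have d2 : d ^+ 2 <= 9 * t ^+ 2 * s ^+ 2.
  have -> : 9 * t ^+ 2 * s ^+ 2 = (3 * `|t| * s) ^+ 2.
    by rewrite !exprMn -normrX (ger0_norm (sqr_ge0 t)); ring.
  by rewrite -(real_normK (num_real d)) lerXn2r ?nnegrE// !mulr_ge0.
have -> : (a + 2 * t * b + t ^+ 2 * c) ^+ 3 - (a ^+ 3 + 6 * t * (a ^+ 2 * b)) =
  3 * a ^+ 2 * (t ^+ 2 * c) + d ^+ 2 * (3 * a + d) by rewrite /d; ring.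
have as_ : a <= s by rewrite lerDl.
have cs : c <= s by rewrite lerDr.
have s3 : s ^+ 3 <= 4 * M ^+ 2 * s.
  rewrite exprSr ler_wpM2r//.
  have -> : 4 * M ^+ 2 = (2 * M) ^+ 2 by ring.
  by rewrite lerXn2r ?nnegrE// (le_trans s0).
apply: (@le_trans _ _ (57 * t ^+ 2 * s ^+ 3)); last first.
  have -> : 228 * M ^+ 2 * t ^+ 2 * (a + c) = 57 * t ^+ 2 * (4 * M ^+ 2 * s).
    by rewrite /s; ring.
  by rewrite ler_wpM2l// mulr_ge0 ?sqr_ge0.
have -> : 57 * t ^+ 2 * s ^+ 3 =
   3 * s ^+ 2 * (t ^+ 2 * s) + 9 * t ^+ 2 * s ^+ 2 * (6 * s) by ring.
apply: (le_trans (ler_normD _ _)); apply: lerD.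
  have a2 : a ^+ 2 <= s ^+ 2 by rewrite lerXn2r ?nnegrE.
  have := sqr_ge0 t; have := sqr_ge0 a; move: (t ^+ 2) (a ^+ 2) (s ^+ 2) a2.
  move=> x y z yz y0 x0; rewrite ger0_norm; last by rewrite !mulr_ge0.
  by rewrite !ler_pM ?mulr_ge0.
rewrite normrM (ger0_norm (sqr_ge0 d)); apply: ler_pM; rewrite ?sqr_ge0//.
apply: (le_trans (ler_normD _ _)); rewrite ger0_norm ?mulr_ge0//.
have : `|d| <= 3 * s.
  by apply: (le_trans ds); rewrite ler_wpM2r// -[leRHS]mulr1 ler_wpM2l.
by move=> ?; lra.
Qed.

Lemma cube_dist (a b M : R) : 0 <= a -> 0 <= b -> a <= M -> b <= M ->
  `|b ^+ 3 - a ^+ 3| <= 3 * M ^+ 2 * `|b - a|.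
Proof.
move=> a0 b0 aM bM; rewrite subrXX normrM mulrC ler_wpM2r//.
have M0 : 0 <= M by exact: le_trans aM.
rewrite !big_ord_recr big_ord0 /= add0r subn0 subSS subn0 !expr0 !expr1 mul1r mulr1.
have H (x y : R) : 0 <= x -> 0 <= y -> x <= M -> y <= M -> x * y <= M ^+ 2.
  by move=> *; rewrite expr2 ler_pM.
rewrite ger0_norm; last by rewrite !addr_ge0 ?mulr_ge0 ?sqr_ge0 ?subr_ge0.
have := H b b b0 b0 bM bM; have := H b a b0 a0 bM aM; have := H a a a0 a0 aM aM.
by rewrite -!expr2; set x := M ^+ 2; set y := b ^+ 2; set z := a ^+ 2; set v := b * a;
  lra.
Qed.

Definition quintic_on D (u w : R -> R[i]) : R :=
  \int[leb]_(x in D) (dotc (u x) (u x) ^+ 2 * dotc (u x) (w x)).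

Section OnBranch.
Variables (D : set R) (u w : R -> R[i]) (M : R).
Hypotheses (mD : measurable D) (ui : square_integrable D u)
  (wi : square_integrable D w)
  (uM : forall x, D x -> dotc (u x) (u x) <= M)
  (wM : forall x, D x -> dotc (w x) (w x) <= M).

Let aci := rintegrableD mD (rintegrable_dotc mD ui ui) (rintegrable_dotc mD wi wi).

Lemma rintegrable_sixth : rintegrable D (fun x => dotc (u x) (u x) ^+ 3).
Proof.
by apply: rintegrable_cube uM => // [|x _]; [exact: rintegrable_dotc|exact: dotc_ge0].
Qed.

Lemma normr_dotc_leD (z z' : R[i]) : `|dotc z z'| <= dotc z z + dotc z' z'.
Proof.
have := normr_dotc_le z z' ltr01; rewrite invr1 !mul1r; apply: le_trans.
by rewrite ler_peMl// ler1n.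
Qed.

Lemma rintegrable_quintic :
  rintegrable D (fun x => dotc (u x) (u x) ^+ 2 * dotc (u x) (w x)).
Proof.
have [mu1 mu2 _] := ui; have [mw1 mw2 _] := wi.
apply: rintegrable_le (rintegrableZ (M ^+ 2) mD aci) _ => //.
  by apply: measurable_funM; [apply: measurable_funX|]; exact: measurable_dotc.
move=> x Dx; rewrite normrM ler_pM ?normr_dotc_leD//.
rewrite ger0_norm ?sqr_ge0// lerXn2r ?nnegrE ?dotc_ge0 ?uM//.
exact: le_trans (dotc_ge0 _) (uM Dx).
Qed.

Lemma sixth_line t : `|t| <= 1 ->
  (forall x, D x -> dotc (u x + t%:C * w x) (u x + t%:C * w x) <= 4 * M) ->
  `|\int[leb]_(x in D) (dotc (u x + t%:C * w x) (u x + t%:C * w x) ^+ 3)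
    - (\int[leb]_(x in D) (dotc (u x) (u x) ^+ 3) + 6 * t * quintic_on D u w)|
  <= 228 * M ^+ 2 * t ^+ 2 * (L2ip D u u + L2ip D w w).
Proof.
move=> t1 uwM.
have i6 : rintegrable D (fun x => dotc (u x + t%:C * w x) (u x + t%:C * w x) ^+ 3).
  apply: rintegrable_cube uwM => // [|x _]; last exact: dotc_ge0.
  by apply: rintegrable_dotc => //; exact: square_integrable_line.
have i5 := rintegrableZ (6 * t) mD rintegrable_quintic.
rewrite -RintegralZl//; last exact: rintegrable_quintic.
rewrite -RintegralD//; last exact: rintegrable_sixth.
rewrite /L2ip -RintegralD//; [|exact: rintegrable_dotc|exact: rintegrable_dotc].
rewrite -[leRHS]RintegralZl//.
apply: Rintegral_approx => //.
- exact: rintegrableD rintegrable_sixth i5.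
- exact: rintegrableZ.
- move=> x Dx; rewrite dotc_line; apply: cube_expand => //.
  + exact: dotc_ge0.
  + exact: dotc_ge0.
  + exact: uM.
  + exact: wM.
  + exact: normr_dotc_leD.
Qed.

Lemma sixth_line_ortho t : `|t| <= 1 -> (forall x, D x -> dotc (u x) (w x) = 0) ->
  \int[leb]_(x in D) (dotc (u x + t%:C * w x) (u x + t%:C * w x) ^+ 3) <=
  \int[leb]_(x in D) (dotc (u x) (u x) ^+ 3) + 7 * M ^+ 2 * t ^+ 2 * L2ip D w w.
Proof.
move=> t1 uw0; have i2 := rintegrable_dotc mD wi wi.
have tt : t ^+ 2 <= 1 by rewrite -(real_normK (num_real t)) exprn_ile1.
have e x : D x -> dotc (u x + t%:C * w x) (u x + t%:C * w x) =
    dotc (u x) (u x) + t ^+ 2 * dotc (w x) (w x).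
  by move=> Dx; rewrite dotc_line uw0// mulr0 addr0.
have i3 := rintegrableZ (7 * M ^+ 2 * t ^+ 2) mD i2.
rewrite /L2ip -RintegralZl// -RintegralD//; last exact: rintegrable_sixth.
apply: le_Rintegral => //.
- apply: (@rintegrable_cube _ _ (2 * M)) => // [|x _|x Dx].
  + by apply: rintegrable_dotc => //; exact: square_integrable_line.
  + exact: dotc_ge0.
  + rewrite e// mulr_natl mulr2n lerD ?uM//; apply: le_trans (wM Dx).
    by rewrite ler_piMl ?dotc_ge0.
- exact: rintegrableD rintegrable_sixth i3.
- move=> x Dx; rewrite e//; set a := dotc (u x) (u x); set c := dotc (w x) (w x).
  have a0 : 0 <= a by exact: dotc_ge0.
  have c0 : 0 <= c by exact: dotc_ge0.
  have aM : a <= M by exact: uM.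
  have cM : c <= M by exact: wM.
  have s0 := sqr_ge0 t; move: (t ^+ 2) s0 tt => s s0 s1.
  have scM : s * c <= M by rewrite (le_trans _ cM)// ler_piMl.
  have -> : (a + s * c) ^+ 3 =
     a ^+ 3 + s * c * (3 * (a * a) + 3 * (a * (s * c)) + (s * c) * (s * c)) by ring.
  rewrite lerD2l.
  have -> : 7 * M ^+ 2 * s * c = s * c * (7 * (M * M)) by ring.
  rewrite ler_wpM2l ?mulr_ge0//.
  have -> : 7 * (M * M) = 3 * (M * M) + 3 * (M * M) + M * M by ring.
  by rewrite !lerD ?ler_wpM2l ?ler_pM ?mulr_ge0.
Qed.

Lemma sixth_dist (e : R) : 0 < e ->
  (forall x, D x -> dotc (u x + 1%:C * w x) (u x + 1%:C * w x) <= M) ->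
  `|\int[leb]_(x in D) (dotc (u x + 1%:C * w x) (u x + 1%:C * w x) ^+ 3)
    - \int[leb]_(x in D) (dotc (u x) (u x) ^+ 3)|
  <= 3 * M ^+ 2 * (e * L2ip D u u + (e^-1 + 1) * L2ip D w w).
Proof.
move=> e0 uwM.
have i1 := rintegrableZ e mD (rintegrable_dotc mD ui ui).
have i2 := rintegrableZ (e^-1 + 1) mD (rintegrable_dotc mD wi wi).
rewrite /L2ip -[e * _]RintegralZl//; last exact: rintegrable_dotc.
rewrite -[(e^-1 + 1) * _]RintegralZl//; last exact: rintegrable_dotc.
rewrite -RintegralD// -[leRHS]RintegralZl//; last exact: rintegrableD.
apply: Rintegral_approx => //.
- apply: rintegrable_cube uwM => // [|x _]; last exact: dotc_ge0.
  by apply: rintegrable_dotc => //; exact: square_integrable_line.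
- exact: rintegrable_sixth.
- by apply: rintegrableZ => //; exact: rintegrableD.
- move=> x Dx.
  apply: (le_trans (cube_dist (dotc_ge0 _) (dotc_ge0 _) (uM Dx) (uwM _ Dx))).
  have M0 : 0 <= M by exact: le_trans (dotc_ge0 _) (uM Dx).
  rewrite ler_wpM2l ?mulr_ge0 ?sqr_ge0//.
  rewrite dotc_line expr1n mul1r mulr1.
  rewrite (_ : _ - _ = 2 * dotc (u x) (w x) + dotc (w x) (w x)); last by ring.
  apply: (le_trans (ler_normD _ _)).
  rewrite normrM normr_nat (ger0_norm (dotc_ge0 (w x))).
  apply: (le_trans (lerD (normr_dotc_le (u x) (w x) e0) (lexx _))).
  by rewrite -addrA lerD2l mulrDl mul1r.
Qed.

End OnBranch.
End SixthPower.

(** * The scale-invariant variational inequality *)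

Section Variational.
Local Open Scope complex_scope.
Context {R : realType}.
Local Notation leb := (@lebesgue_measure R).
Implicit Types (U V W G : tadfun R) (w t c : R).

Definition quintic U W : R := quintic_on loop U.1 W.1 + quintic_on tail U.2 W.2.

Local Notation mloop := (branch_measurable loop_branch).
Local Notation mtail := (branch_measurable tail_branch).

Lemma H1C_bound U : H1C U -> exists M, [/\ 0 <= M,
  forall x, loop x -> dotc (U.1 x) (U.1 x) <= M &
  forall x, tail x -> dotc (U.2 x) (U.2 x) <= M].
Proof.
move=> HU; have [b1 b2] := H1C_bounded HU.
exists (2 * (dirichlet U + mass U)); split; [|exact: b1|exact: b2].
exact: (mulr_ge0 (ler0n _ 2) (addr_ge0 (dirichlet_ge0 U) (mass_ge0 U))).
Qed.

(** The L^6 integral is a polynomial along lines; only its expansion to first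
    order matters, with [6 * quintic U W] as the derivative at 0. *)
Lemma L6int_line U W : H1C U -> H1C W -> exists K, forall t, `|t| <= 1 ->
  `|L6int (tad_line U W t) - (L6int U + 6 * t * quintic U W)| <= K * t ^+ 2.
Proof.
move=> HU HW; have [MU [MU0 bU1 bU2]] := H1C_bound HU.
have [MW [MW0 bW1 bW2]] := H1C_bound HW; pose M := MU + MW.
have [[u1 _] [u2 _] _ _] := HU; have [[w1 _] [w2 _] _ _] := HW.
have key (z z' : R[i]) t : `|t| <= 1 -> dotc z z <= MU -> dotc z' z' <= MW ->
    dotc (z + t%:C * z') (z + t%:C * z') <= 4 * M.
  move=> t1 zM zM'; rewrite dotc_line.
  have tt : t ^+ 2 <= 1 by rewrite -(real_normK (num_real t)) exprn_ile1.
  have h1 : t ^+ 2 * dotc z' z' <= dotc z' z' by rewrite ler_piMl ?dotc_ge0.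
  have h2 : 2 * t * dotc z z' <= dotc z z + dotc z' z'.
    apply: (le_trans (ler_norm _)); rewrite !normrM normr_nat -mulrA.
    have := normr_dotc_le z z' ltr01; rewrite invr1 !mul1r; apply: le_trans.
    by rewrite ler_wpM2l// ler_piMl.
  by rewrite /M; move: (dotc z z) (dotc z' z') zM zM' h1 h2 => *; lra.
exists (228 * M ^+ 2 * (L2ip loop U.1 U.1 + L2ip loop W.1 W.1)
  + 228 * M ^+ 2 * (L2ip tail U.2 U.2 + L2ip tail W.2 W.2)) => t t1.
have := @sixth_line R loop U.1 W.1 M mloop u1 w1 _ _ t t1 _.
have := @sixth_line R tail U.2 W.2 M mtail u2 w2 _ _ t t1 _.
have MUM : MU <= M by rewrite lerDl.
have MWM : MW <= M by rewrite lerDr.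
move=> /(_ (fun x Dx => le_trans (bU2 x Dx) MUM) (fun x Dx => le_trans (bW2 x Dx) MWM)
  (fun x Dx => key _ _ _ t1 (bU2 x Dx) (bW2 x Dx))) H2.
move=> /(_ (fun x Dx => le_trans (bU1 x Dx) MUM) (fun x Dx => le_trans (bW1 x Dx) MWM)
  (fun x Dx => key _ _ _ t1 (bU1 x Dx) (bW1 x Dx))) H1.
have e (a b a' b' q q' : R) : a + b - (a' + b' + 6 * t * (q + q')) =
  (a - (a' + 6 * t * q)) + (b - (b' + 6 * t * q')) by ring.
rewrite /L6int /quintic e; apply: (le_trans (ler_normD _ _)).
apply: (le_trans (lerD H1 H2)); rewrite le_eqVlt; apply/orP; left; apply/eqP.
by move: (L2ip _ _ _) (L2ip loop _ _) (L2ip tail _ _) (L2ip tail _ _) => *; ring.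
Qed.

(** A perturbation out of phase with [U] does not change the L^6 integral to
    first order. *)
Lemma L6int_line_ortho U W M t : H1C U -> H1C W -> `|t| <= 1 ->
  (forall x, loop x -> dotc (U.1 x) (U.1 x) <= M /\ dotc (W.1 x) (W.1 x) <= M) ->
  (forall x, tail x -> dotc (U.2 x) (U.2 x) <= M /\ dotc (W.2 x) (W.2 x) <= M) ->
  (forall x, loop x -> dotc (U.1 x) (W.1 x) = 0) ->
  (forall x, tail x -> dotc (U.2 x) (W.2 x) = 0) ->
  L6int (tad_line U W t) <= L6int U + 7 * M ^+ 2 * t ^+ 2 * mass W.
Proof.
move=> HU HW t1 b1 b2 o1 o2.
have [[u1 _] [u2 _] _ _] := HU; have [[w1 _] [w2 _] _ _] := HW.
have H1 := sixth_line_ortho mloop u1 w1 (fun x Dx => (b1 x Dx).1)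
  (fun x Dx => (b1 x Dx).2) t1 o1.
have H2 := sixth_line_ortho mtail u2 w2 (fun x Dx => (b2 x Dx).1)
  (fun x Dx => (b2 x Dx).2) t1 o2.
by rewrite massE /mass_ip mulrDr addrACA; exact: lerD.
Qed.

Lemma tad_line_sub U V : tad_line U (tad_sub V U) 1 = V.
Proof.
rewrite /tad_line /tad_sub /=; case: V => v1 v2 /=.
by congr pair; apply/funext => x; rewrite rmorph1 mul1r addrC subrK.
Qed.

(** Continuity for the energy norm: functions of class H^1 are bounded, so the
    difference of the sixth powers is controlled by that of the squares. *)
Lemma L6int_continuous U : H1C U -> forall e, 0 < e -> exists2 d, 0 < d &
  forall V, H1C V -> dirichlet (tad_sub V U) + mass (tad_sub V U) < d ->
  `|L6int V - L6int U| < e.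
Proof.
move=> HU e e0; have [MU [MU0 bU1 bU2]] := H1C_bound HU.
pose M := 2 * MU + 4; have M0 : 0 < M by rewrite /M; lra.
have [m mE m0] : exists2 m, mass U = m & 0 <= m by exists (mass U); rewrite ?mass_ge0.
have M30 : 0 < 3 * M ^+ 2 by rewrite mulr_gt0// exprn_gt0.
pose h := e / (2 * (3 * M ^+ 2) * (m + 1)).
have h0 : 0 < h by rewrite /h divr_gt0// !mulr_gt0//; lra.
pose d := Num.min 1 (e / (2 * (3 * M ^+ 2) * (h^-1 + 1))).
have h10 : 0 < h^-1 + 1 by rewrite addr_gt0// invr_gt0.
exists d; first by rewrite lt_min ltr01/= divr_gt0// !mulr_gt0.
move=> V HV; set W := tad_sub V U => Wd.
have HW : H1C W by exact: H1C_sub.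
have [bW1 bW2] := H1C_bounded HW.
have : mass W <= dirichlet W + mass W by rewrite lerDr; exact: dirichlet_ge0.
move EN : (dirichlet W + mass W) Wd bW1 bW2 => N Nd bW1 bW2.
move En : (mass W) => n nN.
have N1 : N < 1 by rewrite (lt_le_trans Nd)// /d ge_min lexx.
have [MW [MW2 MWE]] : exists MW, MW <= 2 /\ 2 * N = MW by exists (2 * N); split => //; rewrite -[leRHS]mulr1 ler_wpM2l// ltW.
rewrite MWE in bW1 bW2.
have [[u1 _] [u2 _] _ _] := HU; have [[w1 _] [w2 _] _ _] := HW.
have key (z z' : R[i]) : dotc z z <= MU -> dotc z' z' <= MW ->
    dotc (z + 1%:C * z') (z + 1%:C * z') <= M.
  clear mE En EN; move=> zM zM'; rewrite dotc_line expr1n mul1r mulr1.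
  have := ler_norm (2 * dotc z z'); rewrite normrM normr_nat => h1.
  have := normr_dotc_le z z' ltr01; rewrite invr1 !mul1r => h2.
  by rewrite /M; move: (dotc z z) (dotc z' z') (dotc z z') zM zM' h1 h2 => *; lra.
have MUM : MU <= M by clear mE En EN; rewrite /M; lra.
have MWM : MW <= M by clear mE En EN; rewrite /M; lra.
have H1 := @sixth_dist R loop U.1 W.1 M mloop u1 w1 (fun x Dx => le_trans (bU1 x Dx) MUM)
  h h0 (fun x Dx => key _ _ (bU1 x Dx) (bW1 x Dx)).
have H2 := @sixth_dist R tail U.2 W.2 M mtail u2 w2 (fun x Dx => le_trans (bU2 x Dx) MUM)
  h h0 (fun x Dx => key _ _ (bU2 x Dx) (bW2 x Dx)).
rewrite -{1}(tad_line_sub U V) -/W.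
have er (a b a' b' : R) : a + b - (a' + b') = (a - a') + (b - b') by ring.
rewrite /L6int er; apply: (le_lt_trans (ler_normD _ _)).
apply: (le_lt_trans (lerD H1 H2)).
rewrite (_ : _ + _ = 3 * M ^+ 2 * (h * m) + 3 * M ^+ 2 * ((h^-1 + 1) * n));
  last first.
  rewrite -mE -En !massE /mass_ip.
  by move: (L2ip _ _ _) (L2ip tail _ _) (L2ip loop _ _) (L2ip tail _ _) => *; ring.
clear mE En EN.
have W2 : n < e / (2 * (3 * M ^+ 2) * (h^-1 + 1)).
  by apply: (le_lt_trans nN); apply: (lt_le_trans Nd); rewrite /d ge_min lexx orbT.
have K1 : 3 * M ^+ 2 * (h * m) <= e / 2.
  have -> : 3 * M ^+ 2 * (h * m) = e / 2 * (m / (m + 1)).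
    by rewrite /h; field; rewrite !gt_eqF//; lra.
  rewrite ler_piMr ?divr_ge0 ?(ltW e0)// ler_pdivrMr ?mul1r; lra.
have K2 : 3 * M ^+ 2 * ((h^-1 + 1) * n) < e / 2.
  have -> : e / 2 = 3 * M ^+ 2 * ((h^-1 + 1) * (e / (2 * (3 * M ^+ 2) * (h^-1 + 1)))).
    by field; rewrite !gt_eqF//; lra.
  by rewrite ltr_pM2l// ltr_pM2l.
lra.
Qed.

Lemma L6int_scale c U : H1C U -> L6int (tad_scale c U) = c ^+ 6 * L6int U.
Proof.
move=> HU; have [bU1 bU2] := H1C_bounded HU.
have [[u1 _] [u2 _] _ _] := HU.
rewrite /L6int mulrDr -!RintegralZl//.
- congr (_ + _); apply: eq_Rintegral => x _ /=.
    have -> : dotc (c%:C * U.1 x) (c%:C * U.1 x) = c ^+ 2 * dotc (U.1 x) (U.1 x).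
      by rewrite /dotc; case: (U.1 x) => a b /=; ring.
    by rewrite exprMn -exprM.
  have -> : dotc (c%:C * U.2 x) (c%:C * U.2 x) = c ^+ 2 * dotc (U.2 x) (U.2 x).
    by rewrite /dotc; case: (U.2 x) => a b /=; ring.
  by rewrite exprMn -exprM.
- exact: mtail.
- exact: (rintegrable_sixth mtail u2 bU2).
- exact: mloop.
- exact: (rintegrable_sixth mloop u1 bU1).
Qed.

Lemma Bform_scale w c U : H1C U -> Bform w (tad_scale c U) = c ^+ 2 * Bform w U.
Proof. by move=> HU; rewrite /Bform dirichlet_scale// mass_scale//; ring. Qed.

Lemma Bform_ge0 w U : w < 0 -> 0 <= Bform w U.
Proof.
move=> w0; rewrite /Bform subr_ge0 (le_trans _ (dirichlet_ge0 U))//.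
by rewrite nmulr_rle0 ?mass_ge0.
Qed.

Lemma Lq_norm6E U : Lq_norm 6 U = L6int U `^ (6%:R)^-1.
Proof. by rewrite /Lq_norm Lq_pow6. Qed.

Lemma Binf_lbound w : w < 0 ->
  lbound [set Bform w U | U in [set U | H1C U /\ Lq_norm 6 U = 1]] 0.
Proof. by move=> w0 _ [U _ <-]; exact: Bform_ge0. Qed.

Lemma Binf_ge0 w : w < 0 -> 0 <= Binf w.
Proof.
move=> w0; rewrite /Binf; set S := [set _ | _ in _].
have [->|S0] := eqVneq S set0; first by rewrite inf0.
by apply: lb_le_inf; [exact/set0P|exact: Binf_lbound].
Qed.

(** [B_w(U) >= B(w) |U|_6^2] by homogeneity, cubed so that both sides are
    polynomial along lines. *)
Lemma Binf_cubed w U : w < 0 -> H1C U -> Binf w ^+ 3 * L6int U <= Bform w U ^+ 3.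
Proof.
move=> w0 HU; have := L6int_ge0 U; rewrite le_eqVlt => /predU1P[<-|p0].
  by rewrite mulr0 exprn_ge0// Bform_ge0.
(* the factor that normalizes U in L^6 *)
pose c := L6int U `^ (- (6%:R)^-1).
have c0 : 0 < c by rewrite powR_gt0.
have c6 : c ^+ 6 * L6int U = 1.
  rewrite /c -powR_mulrn ?powR_ge0// -powRrM mulNr mulVf ?pnatr_eq0//.
  by rewrite powR_inv1 ?ltW// mulVf// gt_eqF.
have HV : H1C (tad_scale c U) by exact: H1C_scale.
have : Binf w <= Bform w (tad_scale c U).
  apply: ge_inf; first by exists 0; exact: Binf_lbound.
  by exists (tad_scale c U) => //; split => //; rewrite Lq_norm6E L6int_scale// c6 powR1.
rewrite Bform_scale// => BV.
have : Binf w ^+ 3 <= (c ^+ 2 * Bform w U) ^+ 3.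
  by rewrite lerXn2r ?nnegrE ?Binf_ge0// mulr_ge0 ?sqr_ge0 ?Bform_ge0.
rewrite exprMn -exprM => H; rewrite -(ler_pM2l (exprn_gt0 6 c0)).
by apply: le_trans H; rewrite mulrCA c6 mulr1.
Qed.

Lemma wderiv_eq (D : set R) (u v : R -> R[i]) : (forall x, D x -> u x = v x) ->
  wderiv D u = wderiv D v.
Proof.
move=> uv; rewrite /wderiv; congr xget; apply/seteqP; split=> g ug x y Dx Dy xy.
  by rewrite -!uv//; exact: ug.
by rewrite !uv//; exact: ug.
Qed.

Lemma tad_eq_H1C U V : tad_eq U V -> H1C U -> H1C V.
Proof.
have H1eq (D : set R) (u v : R -> R[i]) : measurable D ->
    (forall x, D x -> u x = v x) -> H1 D u -> H1 D v.
  move=> mD uv [[mu1 mu2 ui] [g ug gi]].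
  have uv' : {in D, u =1 v} by move=> x /set_mem; exact: uv.
  split; last first.
    by exists g => // x y Dx Dy xy; rewrite -!uv//; exact: ug.
  split.
  - by apply: eq_measurable_fun mu1 => x /uv' /= ->.
  - by apply: eq_measurable_fun mu2 => x /uv' /= ->.
  - by apply: eq_integrable ui => // x /uv' /= ->.
have p1 := @pi_ge1 R.
have lp : loop (pi : R) by rewrite /loop/= in_itv/= lexx andbT; lra.
have lm : loop (- pi : R) by rewrite /loop/= in_itv/= lexx/=; lra.
have t0 : tail (0 : R) by rewrite /tail/= in_itv/= lexx.
move=> [e1 e2] [h1 h2 ep e0]; split.
- exact: (H1eq _ _ _ mloop e1 h1).
- exact: (H1eq _ _ _ mtail e2 h2).
- by rewrite -!e1.
- by rewrite -e1// -e2.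
Qed.

Lemma tad_eq_forms U V : tad_eq U V ->
  [/\ mass U = mass V, dirichlet U = dirichlet V & L6int U = L6int V].
Proof.
move=> [e1 e2]; split.
- rewrite !massE /mass_ip /L2ip.
  by congr (_ + _); apply: eq_Rintegral => x /set_mem Dx; rewrite ?e1 ?e2.
- by rewrite !dirichletE /grad_ip /grad (wderiv_eq e1) (wderiv_eq e2).
- by congr (_ + _); apply: eq_Rintegral => x /set_mem Dx; rewrite ?e1 ?e2.
Qed.

(** All that is used of the variational characterization of the wave at
    frequency [w]: the scale-invariant inequality, freed from the value of the
    infimum, and the fact that the wave makes it an equality. *)
Definition ground_state w F : Prop :=
  [/\ H1C F, 0 < L6int F, Bform w F = 3 * L6int F &
      forall U, H1C U -> 27 * L6int F ^+ 2 * L6int U <= Bform w U ^+ 3].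

(** With [k = (B(w)/3)^(1/4)], the wave satisfies [|F|_6^6 = k^6] and
    [B_w(F) = 3 k^6], while [B(w)^3 = 27 k^12]. *)
Lemma scaled_minimizer_ground_state w F : w < 0 -> real_positive F ->
  scaled_minimizer w F -> ground_state w F.
Proof.
move=> w0 [F0 _] [V [[HV nV BV] V0 FV]].
have PV : L6int V = 1.
  have := congr1 (fun x => x `^ 6%:R) nV.
  by rewrite Lq_norm6E -powRrM mulVf ?pnatr_eq0// powRr1 ?L6int_ge0// powR1.
set k := (Binf w / 3) `^ (4^-1) in FV.
have B0 : 0 < Binf w.
  rewrite lt_neqAle Binf_ge0// andbT eq_sym; apply/negP => /eqP B0.
  have l0 : loop (0 : R).
    by rewrite /loop/= in_itv/= oppr_le0 pi_ge0.
  have := F0 _ l0; rewrite FV.1// /= /k B0 mul0r powR0 ?invr_eq0 ?pnatr_eq0//.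
  by rewrite mul0r ltxx.
have k4 : k ^+ 4 = Binf w / 3.
  rewrite /k -powR_mulrn ?powR_ge0// -powRrM mulVf ?pnatr_eq0//.
  by rewrite powRr1// divr_ge0// ltW.
have k0 : 0 < k by rewrite powR_gt0// divr_gt0.
have [mF dF pF] := tad_eq_forms FV.
have PF : L6int F = k ^+ 6 by rewrite pF (L6int_scale _ HV) PV mulr1.
have B3 : Binf w = 3 * k ^+ 4 by rewrite k4; field.
have FV' : tad_eq (tad_scale k V) F by split=> x Dx; rewrite ?FV.1 ?FV.2.
split.
- exact: tad_eq_H1C FV' (H1C_scale _ HV).
- by rewrite PF exprn_gt0.
- have -> : Bform w F = Bform w (tad_scale k V) by rewrite /Bform mF dF.
  by rewrite (Bform_scale _ _ HV) BV PF B3; ring.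
- move=> U HU; apply: le_trans (Binf_cubed w0 HU).
  by rewrite PF B3 le_eqVlt; apply/orP; left; apply/eqP; ring.
Qed.

End Variational.

(** * Derivatives from expansions *)

Section Calculus.
Context {R : realType}.

Lemma is_derive_eps (f : R -> R) (x l : R) :
  (forall e, 0 < e -> exists2 d, 0 < d &
     forall h, `|h| < d -> `|f (x + h) - f x - l * h| <= e * `|h|) ->
  is_derive x 1 f l.
Proof.
move=> H.
have C : h^-1 *: ((f \o shift x) (h *: 1) - f x) @[h --> 0^'] --> l.
  apply/cvgrPdist_le => e e0; have [d d0 Hd] := H _ e0.
  near=> h.
  have h0 : h != 0 by near: h; exact: nbhs_dnbhs_neq.
  have hd : `|h| < d by near: h; exact: dnbhs0_lt.
  have := Hd _ hd; rewrite /= [x + h]addrC => K.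
  rewrite /shift/= scaler1/=.
  have -> : l - h^-1 *: (f (h + x) - f x) = - (h^-1 * (f (h + x) - f x - l * h)).
    by rewrite /GRing.scale/=; field.
  rewrite normrN normrM normfV ler_pdivrMl ?normr_gt0//.
  by rewrite [leRHS]mulrC.
apply: DeriveDef; first exact: cvgP C.
exact: cvg_lim C.
Unshelve. all: by end_near. Qed.

Lemma is_derive_quad (f : R -> R) (x l K d : R) : 0 < d ->
  (forall h, `|h| < d -> `|f (x + h) - f x - l * h| <= K * h ^+ 2) ->
  is_derive x 1 f l.
Proof.
move=> d0 H; apply: is_derive_eps => e e0.
have K0 : 0 < `|K| + 1 by rewrite ltr_pwDr.
exists (Num.min d (e / (`|K| + 1))); first by rewrite lt_min d0 divr_gt0.
move=> h; rewrite lt_min => /andP[hd he].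
apply: (le_trans (H _ hd)).
have -> : h ^+ 2 = `|h| * `|h| by rewrite -expr2 real_normK ?num_real.
rewrite mulrA ler_wpM2r//.
apply: (@le_trans _ _ ((`|K| + 1) * `|h|)).
  by rewrite ler_wpM2r// (le_trans (ler_norm K))// lerDl.
by rewrite mulrC -ler_pdivlMr// ltW.
Qed.

Lemma is_derive_unique (f : R -> R) (x l l' : R) :
  is_derive x 1 f l -> is_derive x 1 f l' -> l = l'.
Proof. by move=> [_ <-] [_ <-]. Qed.

Lemma is_derive_within_continuous (f df : R -> R) (a b : R) :
  (forall x, a <= x -> x <= b -> is_derive x 1 f (df x)) ->
  {within `[a, b], continuous f}.
Proof.
move=> fd; apply: derivable_within_continuous => x; rewrite in_itv/= => /andP[ax xb].
by have [] := fd x ax xb.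
Qed.

Lemma is_derive_MVT (f df : R -> R) (a b : R) : a < b ->
  (forall x, a <= x -> x <= b -> is_derive x 1 f (df x)) ->
  exists c, [/\ a < c, c < b & f b - f a = df c * (b - a)].
Proof.
move=> ab fd.
have fd' x : x \in `]a, b[ -> is_derive x 1 f (df x).
  by rewrite in_itv/= => /andP[ax xb]; apply: fd; exact: ltW.
have [c] := MVT ab fd' (is_derive_within_continuous fd).
by rewrite in_itv/= => /andP[ac cb] ->; exists c.
Qed.

End Calculus.

(** * The action as a function of the frequency *)

Section Frequency.
Context {R : realType}.
Variables (Phi : R -> tadfun R) (mu : R -> R).
Hypothesis groundP : forall w, w < 0 -> ground_state w (Phi w).
Hypothesis muE : forall w, w < 0 -> mu w = mass (Phi w).
Hypothesis mu_derivable : forall w, w < 0 -> derivable mu w 1.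
Implicit Types w : R.

Let p w := L6int (Phi w).

Lemma p_gt0 w : w < 0 -> 0 < p w.
Proof. by move=> /groundP[]. Qed.

Lemma mu_ge0 w : w < 0 -> 0 <= mu w.
Proof. by move=> w0; rewrite muE// mass_ge0. Qed.

Lemma energy_wave w : w < 0 -> energy (Phi w) = 2 * p w + w * mu w.
Proof.
move=> w0; have [_ _ + _] := groundP w0; rewrite /Bform -muE// energyE -/(p w).
by move: (dirichlet _) => x H; rewrite (_ : x = 3 * p w + w * mu w); [ring|rewrite -H; ring].
Qed.

Lemma Bform_wave w w' : w < 0 -> Bform w' (Phi w) = 3 * p w - (w' - w) * mu w.
Proof.
move=> w0; have [_ _ + _] := groundP w0; rewrite /Bform -muE// -/(p w) => <-.
by move: (dirichlet _) => x; ring.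
Qed.

Lemma p_cubed w w' : w < 0 -> w' < 0 ->
  27 * p w' ^+ 2 * p w <= (3 * p w - (w' - w) * mu w) ^+ 3.
Proof.
move=> w0 w'0; have [HF _ _ _] := groundP w0; have [_ _ _ H] := groundP w'0.
by have := H _ HF; rewrite Bform_wave.
Qed.

(** The wave of frequency [w] is a competitor at the frequency [w'].  Solving the
    cubed inequality for [p w'] calls for the power 3/2, which is replaced by an
    upper bound: [(1 - x)^(3/2) <= 1 - 3x/2 + x^2]. *)
Lemma p_upper w w' : w < 0 -> w' < 0 ->
  p w' <= p w - (w' - w) * mu w / 2 + ((w' - w) * mu w) ^+ 2 / (9 * p w).
Proof.
move=> w0 w'0; have P := p_gt0 w0; have P' := p_gt0 w'0.
have := p_cubed w0 w'0; set y := (w' - w) * mu w => H.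
pose x := y / (3 * p w).
have yE : y = 3 * p w * x by rewrite /x; field; rewrite gt_eqF.
have -> : p w - y / 2 + y ^+ 2 / (9 * p w) = p w * (1 - 3 / 2 * x + x ^+ 2).
  by rewrite yE; field; rewrite gt_eqF.
have z0 : 0 < 1 - 3 / 2 * x + x ^+ 2.
  have -> : 1 - 3 / 2 * x + x ^+ 2 = (x - 3 / 4) ^+ 2 + 7 / 16 by field.
  by rewrite ltr_wpDl ?sqr_ge0.
have -> : (p w' <= p w * (1 - 3 / 2 * x + x ^+ 2)) =
    (p w' ^+ 2 <= (p w * (1 - 3 / 2 * x + x ^+ 2)) ^+ 2).
  by rewrite ler_pXn2r// nnegrE ltW// mulr_gt0.
have H2 : p w' ^+ 2 <= p w ^+ 2 * (1 - x) ^+ 3.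
  rewrite -(ler_pM2l (_ : 0 < 27 * p w)) ?mulr_gt0//.
  have -> : 27 * p w * p w' ^+ 2 = 27 * p w' ^+ 2 * p w by ring.
  by apply: (le_trans H); rewrite yE le_eqVlt; apply/orP; left; apply/eqP; ring.
apply: (le_trans H2); rewrite exprMn ler_wpM2l ?sqr_ge0// -subr_ge0.
have -> : (1 - 3 / 2 * x + x ^+ 2) ^+ 2 - (1 - x) ^+ 3 =
   x ^+ 2 * ((x - 1) ^+ 2 + 1 / 4) by field.
by rewrite mulr_ge0 ?sqr_ge0// addr_ge0 ?sqr_ge0.
Qed.

(** Together with [p_gt0], a lower bound on [p] that is uniform near any
    frequency: it controls the remainder in [p_upper] when the roles of the two
    frequencies are exchanged. *)
Lemma p_nonincreasing w w' : w < 0 -> w' < 0 -> w' <= w -> p w <= p w'.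
Proof.
move=> w0 w'0 ww'; have P := p_gt0 w0; have P' := p_gt0 w'0.
have := p_cubed w'0 w0; have B0 := Bform_ge0 (Phi w') w0.
rewrite (Bform_wave _ w'0) in B0.
have B1 : 3 * p w' - (w - w') * mu w' <= 3 * p w'.
  by rewrite gerBl mulr_ge0 ?mu_ge0// subr_ge0.
move=> H; have := lerXn2r 3 B0 (mulr_ge0 (ler0n _ 3) (ltW P')) B1.
move/(le_trans H).
have -> : (3 * p w') ^+ 3 = 27 * p w' * p w' ^+ 2 by ring.
have -> : 27 * p w ^+ 2 * p w' = 27 * p w' * p w ^+ 2 by ring.
rewrite ler_pM2l ?mulr_gt0//.
by rewrite ler_pXn2r// nnegrE ltW.
Qed.

Lemma mu_near w : w < 0 -> forall e, 0 < e -> exists2 d, 0 < d &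
  forall h, `|h| < d -> `|mu (w + h) - mu w| < e.
Proof.
move=> w0 e e0.
have /differentiable_continuous/cvgrPdist_lt/(_ _ e0) : differentiable mu w.
  exact/derivable1_diffP/mu_derivable.
move=> /nbhs_ballP[d /= d0 H]; exists d => // h hd.
by rewrite distrC; apply: H; rewrite /ball/= opprD addNKr normrN.
Qed.

(** The action [2 p] has derivative [- mu]: the envelope theorem, by squeezing
    the increment of [p] between the bounds of [p_upper] at the two frequencies;
    the continuity of [mu] makes both bounds agree to first order. *)
Lemma p_derive w : w < 0 -> is_derive w 1 p (- mu w / 2).
Proof.
move=> w0; apply: is_derive_eps => e e0.
have [d1 d10 H1] := mu_near w0 e0.
have [d2 d20 H2] := mu_near w0 ltr01.
have v0 : w / 2 < 0 by rewrite pmulr_llt0.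
pose q := p (w / 2); have q0 : 0 < q by exact: p_gt0.
pose C := (mu w + 1) ^+ 2 / (9 * q).
have m0 := mu_ge0 w0.
have C0 : 0 < C by rewrite divr_gt0 ?exprn_gt0 ?mulr_gt0//; lra.
exists (Num.min (Num.min d1 d2) (Num.min (- w / 2) (e / (2 * C)))).
  rewrite !lt_min d10 d20/=; apply/andP; split; first by lra.
  by rewrite divr_gt0// mulr_gt0.
move=> h; rewrite !lt_min => /andP[/andP[hd1 hd2] /andP[hw he]].
have hw' : w + h < w / 2 by have := ler_norm h; lra.
have w'0 : w + h < 0 by exact: lt_trans v0.
have m'0 := mu_ge0 w'0.
have mu1 : mu (w + h) <= mu w + 1.
  by have := H2 _ hd2; rewrite ltr_norml => /andP[_]; lra.
have E1 := H1 _ hd1.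
have U1 := p_upper w0 w'0; have U2 := p_upper w'0 w0.
have Q v : v < 0 -> v <= w / 2 -> mu v <= mu w + 1 -> 
    (h * mu v) ^+ 2 / (9 * p v) <= C * h ^+ 2.
  move=> v0' vw mv; have Pv := p_gt0 v0'.
  have qp : q <= p v by exact: p_nonincreasing.
  rewrite ler_pdivrMr ?mulr_gt0// exprMn.
  have -> : C * h ^+ 2 * (9 * p v) = h ^+ 2 * ((mu w + 1) ^+ 2 * (p v / q)).
    by rewrite /C; field; rewrite gt_eqF.
  rewrite ler_wpM2l ?sqr_ge0// -[leLHS]mulr1 ler_pM ?sqr_ge0//.
    by rewrite lerXn2r ?nnegrE ?mu_ge0//; lra.
  by rewrite ler_pdivlMr// mul1r.
have Q1 : (h * mu w) ^+ 2 / (9 * p w) <= C * h ^+ 2 by apply: Q => //; lra.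
have Q2 : (h * mu (w + h)) ^+ 2 / (9 * p (w + h)) <= C * h ^+ 2.
  by apply: Q => //; exact: ltW.
rewrite (_ : w + h - w = h) in U1; last by ring.
rewrite (_ : w - (w + h) = - h) in U2; last by ring.
rewrite mulNr sqrrN in U2.
have hC : C * h ^+ 2 <= e * `|h| / 2.
  have -> : h ^+ 2 = `|h| * `|h| by rewrite -expr2 real_normK ?num_real.
  rewrite mulrCA (_ : e * `|h| / 2 = `|h| * (e / 2)); last by field.
  rewrite ler_wpM2l//.
  have -> : e / 2 = C * (e / (2 * C)) by field; rewrite gt_eqF.
  by rewrite ler_wpM2l// ltW.
have hm : `|h * (mu (w + h) - mu w)| <= e * `|h|.
  by rewrite normrM mulrC ler_wpM2r// ltW.
move: hm; rewrite !ler_norml => /andP[hm1 hm2].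
set A := (h * mu w) ^+ 2 / _ in U1 Q1; set B := (h * mu (w + h)) ^+ 2 / _ in U2 Q2.
set X := h * mu w in U1 *; set Y := h * mu (w + h) in U2 *.
have XY : h * (mu (w + h) - mu w) = Y - X by rewrite /X /Y; ring.
rewrite XY in hm1 hm2.
have -> : p (w + h) - p w - - mu w / 2 * h = p (w + h) - p w + X / 2 by rewrite /X; field.
move: A B X Y {XY} U1 U2 Q1 Q2 hm1 hm2 hC => A B X Y; move: (C * h ^+ 2) (e * `|h|).
by move: (p (w + h)) (p w) => *; apply/andP; split; lra.
Qed.

Lemma mu_MVT w w' : w < w' -> w' < 0 -> exists c, [/\ w < c, c < w' &
  mu w' - mu w = derive1 mu c * (w' - w)].
Proof.
move=> ww' w'0; apply: is_derive_MVT => // x _ xw'.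
by rewrite derive1E; apply/derivableP/mu_derivable; exact: le_lt_trans w'0.
Qed.

Lemma p_MVT w w' : w < w' -> w' < 0 -> exists c, [/\ w < c, c < w' &
  p w' = p w - mu c / 2 * (w' - w)].
Proof.
move=> ww' w'0; have [|c [wc cw' E]] := @is_derive_MVT _ p (fun w => - mu w / 2) _ _ ww'.
  by move=> x _ xw'; apply: p_derive; exact: le_lt_trans w'0.
by exists c; split => //; rewrite -[LHS](subrK (p w)) E; move: (p w) => x; ring.
Qed.

Lemma p_continuous (a b : R) : b < 0 -> {within `[a, b], continuous p}.
Proof.
move=> b0; apply: (@is_derive_within_continuous _ _ (fun w => - mu w / 2)).
by move=> x _ xb; apply: p_derive; exact: le_lt_trans b0.
Qed.

Lemma H1_norm_lt (U : tadfun R) (e : R) : 0 < e ->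
  (H1_norm U < e) = (dirichlet U + mass U < e ^+ 2).
Proof.
move=> e0; rewrite /H1_norm; have := dirichlet_ge0 U; have := mass_ge0 U.
move: (dirichlet U) (mass U) => x y y0 x0.
by rewrite -[X in X < e ^+ 2]sqr_sqrtr ?addr_ge0// ltr_pXn2r// nnegrE ?sqrtr_ge0// ltW.
Qed.

Section Decreasing.
Variable w1 : R.
Hypothesis mu_decr : forall w, w1 < w -> w < 0 -> derive1 mu w < 0.

Lemma mu_decreasing w w' : w1 < w -> w < w' -> w' < 0 -> mu w' < mu w.
Proof.
move=> w1w ww' w'0; have [c [wc cw' E]] := mu_MVT ww' w'0.
rewrite -subr_lt0 E nmulr_rlt0 ?subr_gt0//.
by apply: mu_decr; [exact: lt_trans wc|exact: lt_trans w'0].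
Qed.

Lemma mu_gt0 w : w1 < w -> w < 0 -> 0 < mu w.
Proof.
move=> w1w w0; have h0 : w / 2 < 0 by rewrite pmulr_llt0.
by apply: le_lt_trans (mu_ge0 h0) _; apply: mu_decreasing => //; lra.
Qed.

Lemma p_decreasing w w' : w1 < w -> w < w' -> w' < 0 -> p w' < p w.
Proof.
move=> w1w ww' w'0; have [c [wc cw' E]] := p_MVT ww' w'0.
have m0 : 0 < mu c by apply: mu_gt0; [exact: lt_trans wc|exact: lt_trans w'0].
by rewrite E gtrBl mulr_gt0 ?divr_gt0 ?subr_gt0.
Qed.

Lemma p_convex w w' : w1 < w -> w < 0 -> w1 < w' -> w' < 0 ->
  2 * p w - mu w * (w' - w) <= 2 * p w'.
Proof.
move=> w1w w0 w1w' w'0; have [ww'|w'w|->] := ltgtP w w'; last by rewrite subrr mulr0 subr0.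
  have [c [wc cw' E]] := p_MVT ww' w'0.
  have m : mu c < mu w by apply: mu_decreasing => //; exact: lt_trans w'0.
  have : 0 <= (mu w - mu c) * (w' - w) by rewrite mulr_ge0// subr_ge0 ltW.
  by rewrite E; move: (p w) => x; lra.
have [c [wc cw' E]] := p_MVT w'w w0.
have m : mu w < mu c by apply: mu_decreasing => //; exact: lt_trans wc.
have : 0 <= (mu c - mu w) * (w - w') by rewrite mulr_ge0// subr_ge0 ltW.
by rewrite E; move: (p w') => x; lra.
Qed.

(** Shatah's argument: near the wave, compare [V] with the wave of frequency
    [w'] that has the same L^6 norm; then convexity of the action concludes. *)
Lemma wave_local_min w : w1 < w -> w < 0 -> local_constrained_min (mu w) (Phi w).
Proof.
move=> w1w w0; have [HF P0 _ _] := groundP w0; split => //; first by rewrite muE.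
pose a := (w1 + w) / 2; pose b := w / 2.
have [w1a aw wb b0] : [/\ w1 < a, a < w, w < b & b < 0] by rewrite /a /b; split; lra.
have pa : p w < p a by exact: p_decreasing.
have pb : p b < p w by exact: p_decreasing.
have e0 : 0 < Num.min (p a - p w) (p w - p b) by rewrite lt_min !subr_gt0 pa.
have [d d0 Hd] := L6int_continuous HF e0.
exists (Num.sqrt d); first by rewrite sqrtr_gt0.
move=> V HV mV; have sd : 0 < Num.sqrt d by rewrite sqrtr_gt0.
rewrite (H1_norm_lt _ sd) (sqr_sqrtr (ltW d0)) => /(Hd _ HV).
rewrite -/(p w) lt_min !ltr_norml => /andP[/andP[_ Va] /andP[Vb _]].
have ab : a <= b by lra.
(* the frequency whose wave has the L^6 norm of V *)
have [|c] := IVT (v := L6int V) ab (p_continuous b0).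
  rewrite ge_min le_max; apply/andP; split; apply/orP; [right|left]; lra.
rewrite in_itv/= => /andP[ac cb] pc.
have c0 : c < 0 by exact: le_lt_trans b0.
have w1c : w1 < c by exact: lt_le_trans ac.
have [_ _ _ /(_ _ HV)] := groundP c0; rewrite -/(p c) -pc => G.
have G3 : 3 * p c <= Bform c V.
  rewrite -(@ler_pXn2r _ 3)// ?nnegrE; last 2 first.
  - by rewrite mulr_ge0// ltW// p_gt0.
  - exact: Bform_ge0.
  by apply: le_trans G; rewrite le_eqVlt; apply/orP; left; apply/eqP; ring.
rewrite energy_wave// energyE -pc.
have := p_convex w1w w0 w1c c0; move: G3; rewrite /Bform mV.
by move: (dirichlet V) (p c) (p w) (mu w) => *; lra.
Qed.

End Decreasing.

Section Increasing.
Variable w1 : R.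
Hypothesis w1_lt0 : w1 < 0.
Hypothesis mu_incr : forall w, w < w1 -> 0 < derive1 mu w.

Lemma mu_increasing w w' : w < w' -> w' < w1 -> mu w < mu w'.
Proof.
move=> ww' w'w1; have [c [wc cw' E]] := mu_MVT ww' (lt_trans w'w1 w1_lt0).
by rewrite -subr_gt0 E mulr_gt0 ?subr_gt0//; apply: mu_incr; exact: lt_trans w'w1.
Qed.

Lemma p_concave w w' : w < w1 -> w' < w1 -> w' != w ->
  2 * p w' < 2 * p w - mu w * (w' - w).
Proof.
move=> ww1 w'w1; have [w0 w'0] := (lt_trans ww1 w1_lt0, lt_trans w'w1 w1_lt0).
rewrite neq_lt => /orP[w'w|ww']; last first.
  have [c [wc cw' E]] := p_MVT ww' w'0.
  have m : mu w < mu c by apply: mu_increasing => //; exact: lt_trans w'w1.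
  have : 0 < (mu c - mu w) * (w' - w) by rewrite mulr_gt0// subr_gt0.
  by rewrite E; move: (p w) => x; lra.
have [c [wc cw' E]] := p_MVT w'w w0.
have m : mu c < mu w by apply: mu_increasing.
have : 0 < (mu w - mu c) * (w - w') by rewrite mulr_gt0// subr_gt0.
by rewrite E; move: (p w') => x; lra.
Qed.

End Increasing.
End Frequency.

(** * Elementary expansions and the fundamental theorem of calculus *)

Section Quadratics.
Context {R : realType}.

Lemma linear_coef0 (a K : R) : (forall t, `|t| <= 1 -> a * t <= K * t ^+ 2) -> a = 0.
Proof.
move=> H; apply/eqP; case: (eqVneq a 0) => // a0.
(* t = a / L is small enough for the linear term to dominate *)
pose L := `|K| + `|a| + 1.
have L0 : 0 < L by rewrite /L ltr_wpDl// addr_ge0.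
have aL : `|a / L| <= 1.
  by rewrite normrM normfV (gtr0_norm L0) ler_pdivrMr// mul1r /L -addrA addrCA lerDl addr_ge0.
have := H _ aL; rewrite leNgt; suff -> : K * (a / L) ^+ 2 < a * (a / L) by [].
have -> : a * (a / L) = L * (a / L) ^+ 2 by field; rewrite gt_eqF.
rewrite ltr_pM2r.
  by rewrite (le_lt_trans (ler_norm _))// /L -addrA ltrDl ltr_wpDl.
by rewrite exprn_even_gt0//= mulf_neq0// invr_eq0 gt_eqF.
Qed.

Lemma cube_linear_le (a b c t : R) : 0 <= a -> `|t| <= 1 ->
  (a + t * b + t ^+ 2 * c) ^+ 3 <= a ^+ 3 + 3 * a ^+ 2 * b * t +
    (3 * a ^+ 2 * `|c| + 3 * a * (`|b| + `|c|) ^+ 2 + (`|b| + `|c|) ^+ 3) * t ^+ 2.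
Proof.
move=> a0 t1; set S := `|b| + `|c|; have S0 : 0 <= S by exact: addr_ge0.
pose d := t * b + t ^+ 2 * c.
have tt : t ^+ 2 <= `|t| by rewrite -(real_normK (num_real t)) expr2 ler_piMr.
have ds : `|d| <= `|t| * S.
  rewrite /S mulrDr; apply: (le_trans (ler_normD _ _)); apply: lerD.
    by rewrite normrM.
  by rewrite normrM (ger0_norm (sqr_ge0 t)) ler_wpM2r.
have d2 : d ^+ 2 <= t ^+ 2 * S ^+ 2.
  rewrite -exprMn -(real_normK (num_real d)) -[leRHS](real_normK (num_real _)).
  by rewrite lerXn2r ?nnegrE// normrM (ger0_norm S0).
have dS : d <= S.
  by apply: (le_trans (ler_norm _)); apply: (le_trans ds); rewrite ler_piMl.
have d3 : d ^+ 3 <= t ^+ 2 * S ^+ 3.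
  have -> : t ^+ 2 * S ^+ 3 = S * (t ^+ 2 * S ^+ 2) by ring.
  rewrite exprS; apply: (@le_trans _ _ (S * d ^+ 2)).
    by rewrite ler_wpM2r// sqr_ge0.
  by rewrite ler_wpM2l.
have c1 : t ^+ 2 * c <= t ^+ 2 * `|c| by rewrite ler_wpM2l ?sqr_ge0// ler_norm.
have -> : (a + t * b + t ^+ 2 * c) ^+ 3 = a ^+ 3 + 3 * a ^+ 2 * b * t +
   (3 * a ^+ 2 * (t ^+ 2 * c) + 3 * a * d ^+ 2 + d ^+ 3) by rewrite /d; ring.
rewrite lerD2l.
have -> : (3 * a ^+ 2 * `|c| + 3 * a * S ^+ 2 + S ^+ 3) * t ^+ 2 =
  3 * a ^+ 2 * (t ^+ 2 * `|c|) + 3 * a * (t ^+ 2 * S ^+ 2) + t ^+ 2 * S ^+ 3 by ring.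
have a20 := sqr_ge0 a.
by apply: lerD => //; apply: lerD; rewrite ler_wpM2l// mulr_ge0.
Qed.

Lemma Rintegral_eq0 (D : set R) (f : R -> R) : (forall x, D x -> f x = 0) ->
  \int[lebesgue_measure]_(x in D) f x = 0.
Proof.
move=> f0; have -> : \int[lebesgue_measure]_(x in D) f x =
    \int[lebesgue_measure]_(x in D) 0.
  by apply: eq_Rintegral => x /set_mem/f0.
by rewrite /Rintegral integral0.
Qed.

Lemma FTC_itv (f F : R -> R) (x y : R) : x <= y ->
  {within `[x, y], continuous f} -> {within `[x, y], continuous F} ->
  (forall t, x < t -> t < y -> is_derive t 1 F (f t)) ->
  rintegrable `[x, y] f /\
  \int[lebesgue_measure]_(t in `[x, y]) f t = F y - F x.
Proof.
move=> xy cf cF dF; split.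
  by apply: continuous_compact_integrable => //; exact: segment_compact.
move: xy; rewrite le_eqVlt => /predU1P[->|xy].
  by rewrite set_itv1 Rintegral_set1 subrr.
have [_ Fx Fy] := (continuous_within_itvP F xy).1 cF.
rewrite /Rintegral (continuous_FTC2 (F := F) xy cf) ?EFinB//.
  by split=> // t; rewrite in_itv/= => /andP[xt ty]; have [] := dF t xt ty.
move=> t; rewrite in_itv/= => /andP[xt ty]; rewrite derive1E.
by have [_ ->] := dF t xt ty.
Qed.

Lemma is_derive_scale (f : R -> R) (n x l : R) : is_derive (n * x) 1 f l ->
  is_derive x 1 (fun x => f (n * x)) (n * l).
Proof.
move=> fl; rewrite mulrC; apply: is_derive1_comp => //.
by apply: (@is_derive_quad _ _ _ _ 0 1) => // h _; rewrite (_ : _ - _ - _ = 0) ?normr0 ?mul0r//; ring.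
Qed.

End Quadratics.

(** * Criticality, ascent and descent directions *)

Section Saddle.
Local Open Scope complex_scope.
Context {R : realType}.
Local Notation leb := (@lebesgue_measure R).
Implicit Types (U V W F : tadfun R) (w t c m : R).

Lemma Bform_line w U W t : H1C U -> H1C W -> Bform w (tad_line U W t) =
  Bform w U + t * (2 * (grad_ip U W - w * mass_ip U W)) + t ^+ 2 * Bform w W.
Proof.
move=> HU HW; rewrite /Bform dirichlet_line// mass_line//.
by move: (dirichlet U) (dirichlet W) (mass U) (mass W) (grad_ip U W) (mass_ip U W) => *; ring.
Qed.

(** The weak form of the stationary equation, as the Euler-Lagrange equation of
    the cubed inequality. *)
Lemma ground_state_critical w F W : w < 0 -> ground_state w F -> H1C W ->
  grad_ip F W - w * mass_ip F W = 3 * quintic F W.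
Proof.
move=> w0 [HF P0 BF G] HW; have [K HK] := L6int_line HF HW.
set b := 2 * (grad_ip F W - w * mass_ip F W).
have K0 : 0 <= K.
  have := HK 1; rewrite normr1 expr1n !mulr1 => /(_ (lexx _)).
  by move=> /(le_trans (normr_ge0 _)).
suff : 27 * L6int F ^+ 2 * (6 * quintic F W - b) = 0.
  move=> /eqP; rewrite mulf_eq0 mulf_eq0 pnatr_eq0/= expf_eq0/= (gt_eqF P0)/=.
  rewrite subr_eq0 => /eqP; rewrite /b; move: (grad_ip F W) (mass_ip F W) (quintic F W).
  by clear; move=> x y z; lra.
have G' t : `|t| <= 1 -> 27 * L6int F ^+ 2 * (L6int F + 6 * t * quintic F W - K * t ^+ 2) <=
    (3 * L6int F + t * b + t ^+ 2 * Bform w W) ^+ 3.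
  move=> t1; have := G _ (H1C_line t HF HW); rewrite Bform_line// BF; apply: le_trans.
  rewrite ler_wpM2l ?(mulr_ge0 (ler0n _ 27) (sqr_ge0 _))//.
  have := HK t t1; rewrite ler_norml => /andP[+ _].
  have ab (x y z : R) : - z <= x - y -> y - z <= x by clear; lra.
  exact: ab.
move: (L6int F) (quintic F W) (Bform w W) b G' P0 => p q B b G' P0.
apply: (@linear_coef0 _ _ (27 * p ^+ 2 * K +
  (3 * (3 * p) ^+ 2 * `|B| + 3 * (3 * p) * (`|b| + `|B|) ^+ 2 + (`|b| + `|B|) ^+ 3))).
move=> t t1.
have p30 : 0 <= 3 * p by rewrite mulr_ge0// ltW.
have := le_trans (G' t t1) (cube_linear_le b B p30 t1).
move: (3 * (3 * p) ^+ 2 * `|B| + _ + _) => L H.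
rewrite -subr_ge0 in H; rewrite -subr_ge0; move: H; congr (is_true (0 <= _)); ring.
Qed.

Lemma mass_line_derive U W : H1C U -> H1C W ->
  is_derive (0 : R) (1 : R) (fun t => mass (tad_line U W t)) (2 * mass_ip U W).
Proof.
move=> HU HW; apply: (@is_derive_quad _ _ _ _ (mass W) 1) => // h _.
rewrite add0r !mass_line//; have W0 := mass_ge0 W.
move: (mass U) (mass W) (mass_ip U W) W0 => x y z y0.
rewrite (_ : _ - _ = y * h ^+ 2); last by ring.
by rewrite ger0_norm// mulr_ge0 ?sqr_ge0.
Qed.

Lemma energy_line_derive U W : H1C U -> H1C W ->
  is_derive (0 : R) (1 : R) (fun t => energy (tad_line U W t))
    (2 * grad_ip U W - 6 * quintic U W).
Proof.
move=> HU HW; have [K HK] := L6int_line HU HW.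
apply: (@is_derive_quad _ _ _ _ (dirichlet W + K) 1) => // h h1.
have := HK h (ltW h1); have : tad_line U W 0 = U.
  rewrite /tad_line; case: U {HU HK} => u v /=.
  by congr pair; apply/funext => x; rewrite rmorph0 mul0r addr0.
rewrite add0r !energyE => ->; rewrite dirichlet_line//.
have W0 := dirichlet_ge0 W.
move: (L6int _) (L6int U) (quintic U W) (dirichlet U) (dirichlet W) (grad_ip U W) W0.
move=> p' p q x y z y0 H.
rewrite (_ : _ - _ = y * h ^+ 2 - (p' - (p + 6 * h * q))); last by ring.
apply: (le_trans (ler_normB _ _)); rewrite [leRHS]mulrDl lerD//.
by rewrite ger0_norm// mulr_ge0 ?sqr_ge0.
Qed.

(** Since [E = S_w + w Q], a direction that is tangent to the mass constraint
    kills the derivative of [E] as soon as that of the action [S_w] vanishes. *)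
Lemma ground_state_constrained_critical w F : w < 0 -> ground_state w F ->
  constrained_critical (mass F) F.
Proof.
move=> w0 gF; have [HF _ _ _] := gF; split; [exact: HF|by []|move=> W HW dm].
have m0 := is_derive_unique (mass_line_derive HF HW) dm.
have := energy_line_derive HF HW.
have E := ground_state_critical w0 gF HW.
suff -> : 2 * grad_ip F W - 6 * quintic F W = 0 by [].
move: (grad_ip F W) (mass_ip F W) (quintic F W) m0 E => x y z y0 E.
have {}y0 : y = 0 by move: y0; clear; lra.
by move: E; rewrite y0; clear; lra.
Qed.

Definition H1sq U : R := dirichlet U + mass U.

Lemma H1sq_ge0 U : 0 <= H1sq U.
Proof. exact: addr_ge0 (dirichlet_ge0 U) (mass_ge0 U). Qed.

Lemma H1sq_scale c U : H1C U -> H1sq (tad_scale c U) = c ^+ 2 * H1sq U.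
Proof. by move=> HU; rewrite /H1sq dirichlet_scale// mass_scale// mulrDr. Qed.

(** The parallelogram inequality: the energy norm of [U - t W] is nonnegative. *)
Lemma H1sq_line_le U W t : H1C U -> H1C W ->
  H1sq (tad_line U W t) <= 2 * H1sq U + 2 * t ^+ 2 * H1sq W.
Proof.
move=> HU HW; have := H1sq_ge0 (tad_line U W (- t)); rewrite /H1sq.
rewrite !mass_line// !dirichlet_line//.
move: (mass U) (mass W) (mass_ip U W) (dirichlet U) (dirichlet W) (grad_ip U W).
by clear; move=> a b c d e f; rewrite sqrrN; move: (t ^+ 2) => s H; lra.
Qed.

Lemma scaled_line_sub U W c t :
  tad_sub (tad_scale c (tad_line U W t)) U = tad_line (tad_scale (c - 1) U) W (c * t).
Proof.
rewrite /tad_sub /tad_scale /tad_line; congr pair; apply/funext => x /=;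
by rewrite rmorphB rmorph1 rmorphM; ring.
Qed.

(** Purely imaginary, hence pointwise orthogonal to a real wave; zero at the
    vertex, hence extended by zero to the half-line. *)
Definition ripple (n : nat) : tadfun R :=
  (fun x => 0 +i* sin (n%:R * x), fun=> 0).

Lemma sin_npi n : sin (n%:R * (pi : R)) = 0.
Proof.
elim: n => [|n IH]; first by rewrite mul0r sin0.
by rewrite -natr1 mulrDl mul1r sinDpi IH oppr0.
Qed.

Lemma sin_scale_derive (n x : R) :
  is_derive x 1 (fun x => sin (n * x)) (n * cos (n * x)).
Proof. exact: is_derive_scale. Qed.

Lemma cos_scale_derive (n x : R) :
  is_derive x 1 (fun x => cos (n * x)) (n * - sin (n * x)).
Proof. exact: is_derive_scale. Qed.

Lemma derive_continuous (f df : R -> R) : (forall x : R, is_derive x 1 f (df x)) ->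
  continuous f.
Proof.
move=> fd x; apply/differentiable_continuous/derivable1_diffP.
by have [] := fd x.
Qed.

Lemma continuous_measurable (f : R -> R) D : measurable D -> continuous f ->
  measurable_fun D f.
Proof.
by move=> mD cf; apply: measurable_funS (continuous_measurable_fun cf).
Qed.

Definition ripple_grad (n : nat) : tadfun R :=
  (fun x => 0 +i* (n%:R * cos (n%:R * x)), fun=> 0).

Lemma continuous_square_integrable_loop (f : R -> R) : continuous f ->
  square_integrable loop (fun x => 0 +i* f x).
Proof.
move=> cf; apply/square_integrableP; split.
- exact: measurable_cst.
- by apply: continuous_measurable => //; exact: (branch_measurable loop_branch).
- rewrite (_ : (fun _ => _) = (fun x => f x * f x)); last first.
    by apply/funext => x; rewrite /dotc/= mul0r add0r.
  apply: continuous_compact_integrable; first exact: segment_compact.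
  by apply: continuous_subspaceT => x; apply: continuousM; exact: cf.
Qed.

Lemma zero_square_integrable D : measurable D ->
  square_integrable D (fun=> 0 : R[i]).
Proof.
move=> mD; apply/square_integrableP; split; try exact: measurable_cst.
rewrite (_ : (fun _ => _) = cst 0); first exact: integrable0.
by apply/funext => x; rewrite /dotc/= mul0r addr0.
Qed.

Lemma zero_weak_derivative D : weak_derivative D (fun=> 0 : R[i]) (fun=> 0).
Proof.
move=> x y _ _ _; rewrite /Cintegrable /Cintegral.
have i0 : leb.-integrable `[x, y] (EFin \o (fun=> (0 : R))) by exact: integrable0.
split; first by split; exact: i0.
rewrite (_ : \int[leb]_(x in _) _ = 0); last first.
  by rewrite /Rintegral integral0.
by rewrite subrr.
Qed.

Lemma ripple_is_grad n : is_grad (ripple n) (ripple_grad n).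
Proof.
split => /=; last exact: zero_weak_derivative.
move=> x y _ _ xy.
have cS : continuous (fun x : R => sin (n%:R * x)).
  exact: derive_continuous (sin_scale_derive _).
have cC : continuous (fun x : R => n%:R * cos (n%:R * x)).
  have cc := derive_continuous (cos_scale_derive n%:R).
  by move=> z; apply: cvgM; [exact: cvg_cst|exact: cc].
have [i e] := FTC_itv xy (continuous_subspaceT cC) (continuous_subspaceT cS)
  (fun t _ _ => sin_scale_derive n%:R t).
have i0 : leb.-integrable `[x, y] (EFin \o (fun=> (0 : R))) by exact: integrable0.
split; first by split; [exact: i0|exact: i].
rewrite /Cintegral/= e (_ : \int[leb]_(x in _) _ = 0); last first.
  by rewrite /Rintegral integral0.
by apply/eqP; rewrite eq_complex/= subr0 !eqxx.
Qed.

Lemma H1C_ripple n : H1C (ripple n).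
Proof.
have [g1 g2] := ripple_is_grad n.
have cS : continuous (fun x : R => sin (n%:R * x)).
  exact: derive_continuous (sin_scale_derive _).
have cC : continuous (fun x : R => n%:R * cos (n%:R * x)).
  have cc := derive_continuous (cos_scale_derive n%:R).
  by move=> z; apply: cvgM; [exact: cvg_cst|exact: cc].
have mt := branch_measurable (@tail_branch R).
split => /=.
- split; first exact: continuous_square_integrable_loop.
  by exists (ripple_grad n).1 => //; exact: continuous_square_integrable_loop.
- split; first exact: zero_square_integrable.
  by exists (fun=> 0) => //; exact: zero_square_integrable.
- by rewrite mulrN sinN sin_npi oppr0.
- by rewrite sin_npi.
Qed.

Lemma dotc_ripple n x : dotc ((ripple n).1 x) ((ripple n).1 x) = sin (n%:R * x) ^+ 2.
Proof. by rewrite /dotc/= mul0r add0r expr2. Qed.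

Lemma ripple_forms n : (0 < n)%N ->
  mass (ripple n) = pi /\ dirichlet (ripple n) = n%:R ^+ 2 * pi.
Proof.
move=> n0; have nR : (n%:R : R) != 0 by rewrite pnatr_eq0 -lt0n.
have p0 := pi_ge0 R; have p2 : - pi <= (pi : R) by lra.
have z0 D : L2ip D (fun=> 0) (fun=> 0) = 0 :> R.
  rewrite /L2ip /Rintegral (_ : (fun _ => _) = cst 0%E) ?integral0//.
  by apply/funext => x; rewrite /dotc/= mul0r addr0.
have cS : continuous (fun x : R => sin (n%:R * x)).
  exact: derive_continuous (sin_scale_derive _).
have cC : continuous (fun x : R => cos (n%:R * x)).
  exact: (derive_continuous (cos_scale_derive _)).
pose s2 x := sin (n%:R * x) ^+ 2 : R; pose c2 x := cos (n%:R * x) ^+ 2 : R.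
have ct (f : R -> R) : continuous f -> rintegrable loop f.
  move=> cf; apply: continuous_compact_integrable; first exact: segment_compact.
  exact: continuous_subspaceT.
have cs2 : continuous s2 by move=> x; apply: continuousM; exact: cS.
have cc2 : continuous c2 by move=> x; apply: continuousM; exact: cC.
have is2 := ct _ cs2; have ic2 := ct _ cc2.
have ml := branch_measurable (@loop_branch R).
have S1 : \int[leb]_(x in loop) s2 x + \int[leb]_(x in loop) c2 x = 2 * pi.
  rewrite -RintegralD//.
  rewrite (_ : (fun _ => _) = (fun=> 1)); last first.
    by apply/funext => x; rewrite /s2 /c2 addrC cos2Dsin2.
  by rewrite /loop Rintegral_cst_itv//; ring.
have S2 : \int[leb]_(x in loop) c2 x - \int[leb]_(x in loop) s2 x = 0.
  have dF t : is_derive t 1 (fun x => sin (n%:R * x) * cos (n%:R * x))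
      (n%:R * (c2 t - s2 t)).
    have := is_deriveM (sin_scale_derive n%:R t) (cos_scale_derive n%:R t).
    move=> D; apply: (is_derive_eq D).
    by rewrite /GRing.scale/= /c2 /s2; ring.
  have cf : continuous (fun t => n%:R * (c2 t - s2 t)).
    have cd : continuous (fun t => c2 t - s2 t).
      by move=> t; apply: continuousB; [exact: cc2|exact: cs2].
    by move=> t; apply: cvgM; [exact: cvg_cst|exact: cd].
  have [_] := FTC_itv p2 (continuous_subspaceT cf)
    (continuous_subspaceT (derive_continuous dF)) (fun t _ _ => dF t).
  rewrite mulrN sinN sin_npi oppr0 !mul0r subrr RintegralZl//; last first.
    exact: rintegrableB.
  rewrite RintegralB// => /eqP; rewrite mulf_eq0 (negPf nR)/=.
  by move=> /eqP.
have Es : \int[leb]_(x in loop) s2 x = pi.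
  by move: S1 S2; move: (Rintegral _ _ _) (Rintegral _ _ _) => a b; clear; lra.
have Ec : \int[leb]_(x in loop) c2 x = pi.
  by move: S1 S2; move: (Rintegral _ _ _) (Rintegral _ _ _) => a b; clear; lra.
split.
  rewrite massE /mass_ip z0 addr0 -Es /L2ip.
  by apply: eq_Rintegral => x _; rewrite dotc_ripple.
rewrite (dirichlet_grad (H1C_ripple n) (ripple_is_grad n)) /mass_ip z0 addr0 -Ec /L2ip.
rewrite -RintegralZl//; apply: eq_Rintegral => x _.
by rewrite /dotc/= mul0r add0r /c2 -expr2 exprMn.
Qed.

Lemma H1_norm_H1sq_lt U (e : R) : 0 < e -> H1sq U < e ^+ 2 -> H1_norm U < e.
Proof. by move=> e0; rewrite H1_norm_lt. Qed.

Lemma sqrt_dist_le1 (s c : R) : 0 <= c -> c ^+ 2 = s -> s <= 1 ->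
  (c - 1) ^+ 2 <= (1 - s) ^+ 2.
Proof.
move=> c0 <- s1; have c1 : c <= 1 by rewrite -(@ler_pXn2r _ 2)// ?nnegrE// expr1n.
rewrite -sqrrN opprB; apply: lerXn2r; rewrite ?nnegrE ?subr_ge0//.
by rewrite lerD2l lerN2 expr2 ler_piMl.
Qed.

(** In the lemmas on rescaling, [x = t^2] measures a perturbation [t W] of a wave
    [F] with [W] orthogonal to [F], [r] is the quotient of their masses, and
    [s = c^2] is the factor that restores the mass after the perturbation. *)
Lemma rescaling_le (s c x r : R) : 0 <= c -> c ^+ 2 = s -> 0 <= s -> s <= 1 ->
  s * (1 + x * r) = 1 -> 0 <= x -> x <= 1 -> (c - 1) ^+ 2 <= x * r ^+ 2.
Proof.
move=> c0 c2 s0 s1 sE x0 x1; apply: (le_trans (sqrt_dist_le1 c0 c2 s1)).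
have -> : 1 - s = s * (x * r) by rewrite -sE; ring.
have -> : (s * (x * r)) ^+ 2 = s ^+ 2 * x ^+ 2 * r ^+ 2 by ring.
rewrite ler_wpM2r ?sqr_ge0//.
have s2 : s ^+ 2 <= 1 by rewrite exprn_ile1.
apply: (@le_trans _ _ (x ^+ 2)); last by rewrite expr2 ler_piMl.
by rewrite ler_piMl ?sqr_ge0.
Qed.

Lemma rescaling_close (s c x r a b A : R) : 0 <= c -> c ^+ 2 = s -> 0 <= s ->
  s <= 1 -> s * (1 + x * r) = 1 -> 0 < x -> x <= 1 -> 0 <= a -> 0 <= b ->
  2 * r ^+ 2 * a + 2 * b < A -> 2 * ((c - 1) ^+ 2 * a) + 2 * (s * x) * b < x * A.
Proof.
move=> c0 c2 s0 s1 sE x0 x1 a0 b0 AE.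
have h0 := rescaling_le c0 c2 s0 s1 sE (ltW x0) x1.
have sx : s * x <= x by rewrite ler_piMl// ltW.
have h1 : (c - 1) ^+ 2 * a <= x * r ^+ 2 * a by rewrite ler_wpM2r.
have h2 : s * x * b <= x * b by rewrite ler_wpM2r.
have h3 : x * (2 * r ^+ 2 * a + 2 * b) < x * A by rewrite ltr_pM2l.
apply: le_lt_trans h3.
have -> : x * (2 * r ^+ 2 * a + 2 * b) = 2 * (x * r ^+ 2 * a) + 2 * (x * b) by ring.
by rewrite -mulrA lerD// ler_wpM2l.
Qed.

(** The rescaling costs only [(1 - s)^2], of order [x^2], because [3 s - s^3] is
    stationary at [s = 1]; the gain [x (B - K)] is of order [x]. *)
Lemma rescaled_gain (P P' r s x B K : R) : 0 <= P -> 0 <= K -> 0 <= r ->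
  0 < x -> s * (1 + x * r) = 1 -> P' <= P + x * K ->
  3 * x * r ^+ 2 * P < B - K ->
  2 * P < s * (3 * P + x * B) - s ^+ 3 * P'.
Proof.
move=> P0 K0 r0 x0 sE P'le gap.
have d0 : 0 < 1 + x * r by rewrite ltr_pwDl// mulr_ge0// ltW.
have s0 : 0 < s by rewrite -(pmulr_lgt0 _ d0) sE.
have s1 : s <= 1.
  by rewrite -sE ler_peMr ?(ltW s0)// lerDl mulr_ge0// ltW.
have E1 : 1 - s = s * (x * r) by rewrite -sE; ring.
have s3 : s ^+ 3 <= s by rewrite exprS ler_piMr ?(ltW s0)// exprn_ile1// ltW.
have A1 : s ^+ 3 * P' <= s ^+ 3 * P + s * (x * K).
  apply: (@le_trans _ _ (s ^+ 3 * (P + x * K))).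
    by rewrite ler_wpM2l// exprn_ge0// ltW.
  by rewrite mulrDr lerD2l ler_wpM2r// mulr_ge0// ltW.
apply: (@lt_le_trans _ _ (s * (3 * P + x * B) - (s ^+ 3 * P + s * (x * K)))); last first.
  by rewrite lerD2l lerN2.
rewrite -subr_gt0.
have -> : s * (3 * P + x * B) - (s ^+ 3 * P + s * (x * K)) - 2 * P =
   s * x * (B - K) - (1 - s) * (1 - s) * ((s + 2) * P) by ring.
rewrite {1}E1.
have -> : s * (x * r) * (1 - s) * ((s + 2) * P) =
   s * x * (r * (1 - s) * ((s + 2) * P)) by ring.
rewrite -mulrBr mulr_gt0 ?mulr_gt0// subr_gt0; apply: le_lt_trans gap.
have -> : 3 * x * r ^+ 2 * P = r * (x * r) * (3 * P) by ring.
have xr0 : 0 <= x * r by rewrite mulr_ge0// ltW.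
have e1 : 1 - s <= x * r by rewrite E1 ler_piMl.
apply: ler_pM; rewrite ?mulr_ge0 ?subr_ge0 ?addr_ge0 ?(ltW s0)//.
  by rewrite ler_wpM2l.
by rewrite ler_wpM2r//; lra.
Qed.

(** A wave is never a local maximum: a ripple of high frequency, out of phase
    with the wave, changes neither the mass nor the L^6 norm to first order but
    costs an arbitrarily large amount of Dirichlet energy. *)
Lemma ground_state_not_local_max w F : w < 0 -> ground_state w F -> real_positive F ->
  0 < mass F -> ~ local_constrained_max (mass F) F.
Proof.
move=> w0 gF [F1 F2] m0 [_ _ [e e0 H]]; have [HF P0 BF _] := gF.
have [M0 [M00 bF1 bF2]] := H1C_bound HF; pose M := M0 + 1.
have [n nM] : exists n : nat, 7 * M ^+ 2 < n%:R.
  by exists (Num.bound (7 * M ^+ 2)); apply: archi_boundP; rewrite mulr_ge0 ?sqr_ge0.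
have n0 : (0 < n)%N.
  by rewrite -(ltr_nat R) (le_lt_trans _ nM)// mulr_ge0 ?sqr_ge0.
set W := ripple n; have HW : H1C W := H1C_ripple n.
have [mW dW] := ripple_forms n0.
have o1 x : loop x -> dotc (F.1 x) (W.1 x) = 0.
  move=> /F1; rewrite /dotc/=; case: (F.1 x) => a b; rewrite ltcE/= => /andP[/eqP + _].
  by move=> ->; rewrite mulr0 mul0r addr0.
have o2 x : tail x -> dotc (F.2 x) (W.2 x) = 0 by rewrite /dotc/= !mulr0 addr0.
have tip0 : mass_ip F W = 0.
  by rewrite /mass_ip /L2ip (Rintegral_eq0 o1) (Rintegral_eq0 o2) addr0.
have q0 : quintic F W = 0.
  rewrite /quintic /quintic_on !Rintegral_eq0 ?addr0// => x.
    by move=> /o2 ->; rewrite mulr0.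
  by move=> /o1 ->; rewrite mulr0.
have dip0 : grad_ip F W = 0.
  by have := ground_state_critical w0 gF HW; rewrite tip0 q0 !mulr0 subr0.
have Lt t : `|t| <= 1 -> L6int (tad_line F W t) <= L6int F + t ^+ 2 * (7 * M ^+ 2 * mass W).
  move=> t1; rewrite mulrA [t ^+ 2 * _]mulrC.
  apply: L6int_line_ortho => // x Dx; split.
  - by rewrite (le_trans (bF1 _ Dx))// lerDl.
  - rewrite dotc_ripple; have := cos2Dsin2 (n%:R * x).
    have := sqr_ge0 (cos (n%:R * x)); move: M00; rewrite /M.
    move: (sin _ ^+ 2) (cos _ ^+ 2) => a b.
    by move: M0 {bF1 bF2 M nM HF P0 BF gF}; clear; move=> m M00 b0 ab; lra.
  - by rewrite (le_trans (bF2 _ Dx))// lerDl.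
  - by rewrite /dotc/= !mulr0 addr0 addr_ge0.
set K := 7 * M ^+ 2 * mass W in Lt.
have pi0 := pi_gt0 R.
have K0 : 0 <= K.
  by rewrite /K mW; exact: (mulr_ge0 (mulr_ge0 (ler0n _ 7) (sqr_ge0 _)) (ltW pi0)).
have gap : 0 < Bform w W - K.
  have -> : Bform w W - K = (n%:R ^+ 2 - 7 * M ^+ 2 - w) * pi.
    by rewrite /Bform /K mW dW; ring.
  rewrite mulr_gt0//.
  have : (n%:R : R) <= n%:R ^+ 2 by rewrite expr2 ler_peMl// ler1n.
  move: nM w0; move: (7 * M ^+ 2) (n%:R : R) => a N; clear.
  by move: (N ^+ 2) => N2 *; lra.
pose r := mass W / mass F.
have r0 : 0 <= r by rewrite divr_ge0 ?mass_ge0.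
have rE x : mass F + x * mass W = (1 + x * r) * mass F.
  rewrite /r; move: (mass F) (mass W) m0; clear => a b a0; field.
  by rewrite gt_eqF.
clearbody r K.
have [A [A0 AE]] : exists A, 0 < A /\ 2 * r ^+ 2 * H1sq F + 2 * H1sq W < A.
  exists (2 * r ^+ 2 * H1sq F + 2 * H1sq W + 1); split; last by rewrite ltrDl.
  rewrite ltr_wpDl// addr_ge0//; last by rewrite mulr_ge0// H1sq_ge0.
  exact: (mulr_ge0 (mulr_ge0 (ler0n _ 2) (sqr_ge0 _)) (H1sq_ge0 _)).
have [C [C0 CE]] : exists C, 0 < C /\ 3 * r ^+ 2 * L6int F < C.
  exists (3 * r ^+ 2 * L6int F + 1); split; last by rewrite ltrDl.
  rewrite ltr_wpDl//.
  exact: (mulr_ge0 (mulr_ge0 (ler0n _ 3) (sqr_ge0 _)) (ltW P0)).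
pose x := Num.min 1 (Num.min (e ^+ 2 / A) ((Bform w W - K) / C)).
have x0 : 0 < x.
  by rewrite !lt_min ltr01 (divr_gt0 (exprn_gt0 2 e0) A0) (divr_gt0 gap C0).
have x1 : x <= 1 by rewrite ge_min lexx.
have xA : x * A <= e ^+ 2 by rewrite -ler_pdivlMr// !ge_min lexx orbT.
have xC : x * C <= Bform w W - K by rewrite -ler_pdivlMr// !ge_min lexx !orbT.
clearbody x.
pose t := Num.sqrt x; have t2 : t ^+ 2 = x by rewrite sqr_sqrtr// ltW.
have t1 : `|t| <= 1.
  by rewrite ger0_norm ?sqrtr_ge0// -(@ler_pXn2r _ 2)// ?nnegrE ?sqrtr_ge0// t2 expr1n.
pose s := (1 + x * r)^-1.
have d0 : 0 < 1 + x * r by rewrite ltr_pwDl// mulr_ge0// ltW.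
have s0 : 0 < s by rewrite invr_gt0.
have sE : s * (1 + x * r) = 1 by rewrite mulVf// gt_eqF.
have s1 : s <= 1 by rewrite invf_le1// lerDl mulr_ge0// ltW.
clearbody t s.
pose c := Num.sqrt s; have c2 : c ^+ 2 = s by rewrite sqr_sqrtr// ltW.
have c0 : 0 <= c by exact: sqrtr_ge0.
clearbody c.
have HL : H1C (tad_line F W t) by exact: H1C_line.
set V := tad_scale c (tad_line F W t).
have HV : H1C V by exact: H1C_scale.
have mV : mass V = mass F.
  rewrite mass_scale// mass_line// tip0 mulr0 addr0 t2 c2.
  have -> : mass F + x * mass W = (1 + x * r) * mass F.
    exact: rE.
  by rewrite mulrA sE mul1r.
have nV : H1_norm (tad_sub V F) < e.
  apply: (H1_norm_H1sq_lt e0); rewrite scaled_line_sub.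
  apply: (le_lt_trans (H1sq_line_le _ (H1C_scale _ HF) HW)).
  rewrite (H1sq_scale _ HF) exprMn c2 t2; apply: lt_le_trans xA.
  exact: (rescaling_close c0 c2 (ltW s0) s1 sE x0 x1 (H1sq_ge0 F) (H1sq_ge0 W) AE).
have := H V HV mV nV; rewrite leNgt => /negP; apply.
rewrite (energyE F) (energyE V) /V (dirichlet_scale c HL) (dirichlet_line t HF HW).
have c6 : c ^+ 6 = s ^+ 3 by rewrite -c2 -exprM.
rewrite (L6int_scale c HL) dip0 mulr0 addr0 c6 c2 t2.
have gap' : 3 * x * r ^+ 2 * L6int F < Bform w W - K.
  apply: lt_le_trans xC; rewrite (_ : 3 * x * r ^+ 2 * L6int F = x * (3 * r ^+ 2 * L6int F)).
    by rewrite ltr_pM2l.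
  by move: (L6int F) => P; clear; ring.
have Lx : L6int (tad_line F W t) <= L6int F + x * K by rewrite -t2; exact: Lt.
have := rescaled_gain (ltW P0) K0 r0 x0 sE Lx gap'.
have : s * (mass F + x * mass W) = mass F.
  rewrite -[RHS]mul1r -sE -mulrA; congr (_ * _).
  exact: rE.
move: BF; rewrite /Bform.
move: (dirichlet F) (dirichlet W) (mass F) (mass W) (L6int F) (L6int (tad_line F W t)).
clear; move=> dF dW mF mW p p' E1 E2.
have -> : dF = 3 * p + w * mF by rewrite -E1; ring.
have -> : s * (3 * p + w * mF + x * dW) =
    s * (3 * p + x * (dW - w * mW)) + w * (s * (mF + x * mW)) by ring.
by rewrite E2; lra.
Qed.

(** If the wave is an H^1 limit of waves of other frequencies and the action is
    strictly concave, then rescaling these waves to the same mass lowers the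
    energy, because [3 s - s^3 <= 2]. *)
Lemma wave_not_local_min (Phi : R -> tadfun R) (mu : R -> R) w1 w :
  (forall w, w < 0 -> ground_state w (Phi w)) ->
  (forall w, w < 0 -> mu w = mass (Phi w)) ->
  (forall w, w < 0 -> derivable mu w 1) -> w1 < 0 ->
  (forall w, w < w1 -> 0 < derive1 mu w) -> w < w1 ->
  (forall d, 0 < d -> exists w', [/\ `|w' - w| < d, w' != w &
     H1sq (tad_sub (Phi w') (Phi w)) < d]) ->
  ~ local_constrained_min (mu w) (Phi w).
Proof.
move=> gP muE mud w10 mui ww1 lim [_ _ [e e0 H]].
have w0 : w < 0 by exact: lt_trans w10.
have [HF _ _ _] := gP w w0.
have m0 : 0 < mu w.
  have wm : w - 1 < w by rewrite ltrBlDr ltrDl.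
  apply: le_lt_trans (mu_increasing mud w10 mui wm ww1).
  by apply: (mu_ge0 muE); exact: lt_trans w0.
set N := H1sq (Phi w); have N0 : 0 <= N := H1sq_ge0 _.
pose A := 2 * N + 2.
have A0 : 0 < A by rewrite ltr_wpDl// mulr_ge0.
pose k := Num.min (mu w / 2) (mu w / 2 * (e ^+ 2 / 4 / A)).
have e20 : 0 < e ^+ 2 by exact: exprn_gt0.
have k0 : 0 < k.
  by rewrite lt_min divr_gt0//= mulr_gt0// ?divr_gt0// ?mulr_gt0.
have [d1 d10 Hd1] := mu_near mud w0 k0.
pose d := Num.min (Num.min d1 (w1 - w)) (Num.min 1 (e ^+ 2 / 4)).
have dp : 0 < d.
  by rewrite !lt_min d10 subr_gt0 ww1 ltr01/= divr_gt0.
have [w' [w'd w'w nw']] := lim d dp.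
move: w'd nw'; rewrite /d !lt_min => /andP[/andP[wd1 wd2] _] /andP[_ /andP[n1 n2]].
have w'w1 : w' < w1.
  by rewrite -(ltrD2r (- w)) (le_lt_trans (ler_norm _)).
have w'0 : w' < 0 by exact: lt_trans w10.
have [HF' _ _ _] := gP w' w'0.
have := Hd1 _ wd1; rewrite addrCA subrr addr0 => mk.
have mh : `|mu w' - mu w| < mu w / 2 by rewrite (lt_le_trans mk)// ge_min lexx.
have mh2 : `|mu w' - mu w| < mu w / 2 * (e ^+ 2 / 4 / A).
  by rewrite (lt_le_trans mk)// ge_min lexx orbT.
have m'2 : mu w / 2 < mu w'.
  by move: mh; rewrite ltr_norml => /andP[+ _]; clear; lra.
have m'0 : 0 < mu w' by apply: lt_trans m'2; rewrite divr_gt0.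
pose s := mu w / mu w'; have s0 : 0 < s by rewrite divr_gt0.
pose c := Num.sqrt s; have c2 : c ^+ 2 = s by rewrite sqr_sqrtr// ltW.
have c0 : 0 <= c by exact: sqrtr_ge0.
set V := tad_scale c (Phi w').
have HV : H1C V by exact: H1C_scale.
have mV : mass V = mu w.
  by rewrite mass_scale// c2 -(muE _ w'0) /s; field; rewrite gt_eqF.
have cs : (c - 1) ^+ 2 < e ^+ 2 / 4 / A.
  apply: (@le_lt_trans _ _ `|s - 1|).
    rewrite -c2 -[X in _ <= `|_ - X|](expr1n _ 2) subr_sqr normrM.
    rewrite -(real_normK (num_real _)) expr2 ler_wpM2l//.
    by rewrite (le_trans (ler_normB _ _))// normr1 !ger0_norm// addr_ge0.
  have -> : s - 1 = - (mu w' - mu w) / mu w' by rewrite /s; field; rewrite gt_eqF.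
  rewrite normrM normrN normfV (gtr0_norm m'0) ltr_pdivrMr// mulrC.
  apply: (lt_le_trans mh2); rewrite ler_wpM2r ?(ltW m'2)//.
  by rewrite ltW// !divr_gt0.
have nN : H1sq (Phi w') <= A.
  have E : Phi w' = tad_line (Phi w) (tad_sub (Phi w') (Phi w)) 1 by rewrite tad_line_sub.
  rewrite E; apply: (le_trans (H1sq_line_le _ HF (H1C_sub HF' HF))).
  by rewrite expr1n mulr1 /A lerD2l -[leRHS]mulr1 ler_wpM2l// ltW.
have nV : H1_norm (tad_sub V (Phi w)) < e.
  apply: (H1_norm_H1sq_lt e0).
  have -> : tad_sub V (Phi w) =
     tad_line (tad_scale (c - 1) (Phi w')) (tad_sub (Phi w') (Phi w)) 1.
    rewrite /V /tad_sub /tad_scale /tad_line; congr pair; apply/funext => z /=;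
    by rewrite rmorphB rmorph1; ring.
  apply: (le_lt_trans (H1sq_line_le _ (H1C_scale _ HF') (H1C_sub HF' HF))).
  rewrite H1sq_scale// expr1n mulr1.
  have : (c - 1) ^+ 2 * H1sq (Phi w') <= e ^+ 2 / 4.
    apply: (@le_trans _ _ (e ^+ 2 / 4 / A * A)); last by rewrite divfK// gt_eqF.
    exact: ler_pM (sqr_ge0 _) (H1sq_ge0 _) (ltW cs) nN.
  move: n2; move: (H1sq (tad_sub _ _)) ((c - 1) ^+ 2 * _) (e ^+ 2); clear.
  by move=> x y z; lra.
have := H V HV mV nV; rewrite leNgt => /negP; apply.
have P0 := p_gt0 gP w'0.
have := p_concave gP muE mud w10 mui ww1 w'w1 w'w.
rewrite (energy_wave gP muE w0) energyE.
have -> : dirichlet V = Bform w' V + w' * mu w by rewrite /Bform mV; ring.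
have [_ _ BF' _] := gP w' w'0.
rewrite /V Bform_scale// BF' L6int_scale// c2 (_ : c ^+ 6 = s ^+ 3); last first.
  by rewrite -c2 -exprM.
have s3 : 3 * s - s ^+ 3 <= 2.
  rewrite -subr_ge0 (_ : _ - _ = (s - 1) ^+ 2 * (s + 2)); last by ring.
  by rewrite mulr_ge0 ?sqr_ge0// addr_ge0// ltW.
have := ler_wpM2l (ltW P0) s3.
move: (L6int (Phi w')) (L6int (Phi w)) (mu w); clear; move=> a b m.
by move: (s ^+ 3) => s'; rewrite mulrBr; lra.
Qed.

End Saddle.

(** * Second-order equations and Gronwall's inequality *)

Section Tangent.
Context {R : realType}.
Local Notation leb := (@lebesgue_measure R).
Implicit Types (D : set R) (u g k : R -> R) (a b x y t C : R).

(** [g] is the derivative of [u] on [D] with a uniform second-order remainder.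
    Contrary to the integral or the limit form of this relation, this one
    passes to pointwise limits at once and needs no care at end points. *)
Definition tangent D u g C : Prop := forall x y, D x -> D y ->
  `|u y - u x - g x * (y - x)| <= C * (y - x) ^+ 2.

(** A solution of [u'' = k], with [g = u'].  One constant bounds everything, so
    that a family of solutions sharing it is equicontinuous. *)
Definition flow D u g k C : Prop :=
  [/\ tangent D u g C, tangent D g k C, forall x, D x -> `|g x| <= C &
      forall x, D x -> `|k x| <= C].

Lemma flow_subset D D' u g k C : D' `<=` D -> flow D u g k C -> flow D' u g k C.
Proof.
move=> DD' [h1 h2 h3 h4]; split.
- by move=> x y D'x D'y; apply: h1; exact: DD'.
- by move=> x y D'x D'y; apply: h2; exact: DD'.
- by move=> x /DD'; exact: h3.
- by move=> x /DD'; exact: h4.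
Qed.

Lemma flow_reflect a b u g k C : flow `[a, b] u g k C ->
  flow `[- b, - a] (fun x => u (- x)) (fun x => - g (- x)) (fun x => k (- x)) C.
Proof.
have I x : `[- b, - a]%classic x -> `[a, b]%classic (- x).
  by rewrite /= !in_itv/= lerNr lerNl andbC.
move=> [h1 h2 h3 h4]; split.
- move=> x y /I Dx /I Dy; have := h1 _ _ Dx Dy.
  have -> : - y - - x = - (y - x) by ring.
  by rewrite sqrrN mulrN mulNr.
- move=> x y /I Dx /I Dy; have := h2 _ _ Dx Dy.
  have -> : - y - - x = - (y - x) by ring.
  rewrite sqrrN mulrN opprK -normrN; congr (`|_| <= _); ring.
- by move=> x /I/h3; rewrite normrN.
- by move=> x /I/h4.
Qed.

(** Precomposition with [clamp] extends a function from a segment to the line,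
    where continuity and derivability need no restriction to subspaces. *)
Definition clamp a b t := Num.max a (Num.min t b).

Lemma clamp_itv a b t : a <= b -> `[a, b]%classic (clamp a b t).
Proof.
by move=> ab; rewrite /= in_itv/= /clamp le_max lexx/= ge_max ab/= ge_min lexx orbT.
Qed.

Lemma clamp_id a b t : a <= t -> t <= b -> clamp a b t = t.
Proof. by move=> at_ tb; rewrite /clamp (min_idPl tb) (max_idPr at_). Qed.

Lemma clamp_dist a b s t : `|clamp a b s - clamp a b t| <= `|s - t|.
Proof.
wlog st : s t / s <= t.
  by move=> H; have [/H//|/ltW/H] := leP s t; rewrite distrC [leRHS]distrC.
rewrite (ler0_norm (_ : s - t <= 0)) ?subr_le0// ler_norml /clamp.
by case: (leP s b) => h1; case: (leP t b) => h2; case: (leP a s) => h3;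
  case: (leP a t) => h4; case: (leP a b) => h5; apply/andP; split; lra.
Qed.

Lemma lipschitz_continuous (f : R -> R) C : (forall x y, `|f x - f y| <= C * `|x - y|) ->
  continuous f.
Proof.
move=> fC x; apply/cvgrPdist_lt => e e0.
have C0 : 0 < `|C| + 1 by rewrite ltr_pwDr.
apply/nbhs_ballP; exists (e / (`|C| + 1)); first by rewrite /= divr_gt0.
move=> y; rewrite /ball/= => xy; apply: (le_lt_trans (fC x y)).
apply: (@le_lt_trans _ _ ((`|C| + 1) * `|x - y|)).
  by rewrite ler_wpM2r// (le_trans (ler_norm C))// lerDl.
by rewrite mulrC -ltr_pdivlMr.
Qed.

Section OnSegment.
Variables (a b : R) (u g k : R -> R) (C : R).
Hypotheses (ab : a < b) (fl : flow `[a, b] u g k C).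

Lemma flow_C_ge0 : 0 <= C.
Proof.
have [_ _ + _] := fl; move=> /(_ a); rewrite /= in_itv/= lexx (ltW ab) => /(_ erefl).
exact: le_trans.
Qed.

Lemma tangent_clamp_continuous (f df : R -> R) : tangent `[a, b] f df C ->
  (forall x, `[a, b]%classic x -> `|df x| <= C) -> continuous (f \o clamp a b).
Proof.
move=> T dC; have C0 := flow_C_ge0.
apply: (@lipschitz_continuous _ (C * (1 + (b - a)))) => x y /=.
have Ix := clamp_itv x (ltW ab); have Iy := clamp_itv y (ltW ab).
apply: (@le_trans _ _ (C * (1 + (b - a)) * `|clamp a b x - clamp a b y|)); last first.
  rewrite ler_wpM2l ?clamp_dist// mulr_ge0// addr_ge0// subr_ge0 ltW//.
move: (clamp a b x) (clamp a b y) Ix Iy => {}x {}y Ix Iy.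
have xy : `|x - y| <= b - a.
  move: Ix Iy; rewrite /= !in_itv/= => /andP[? ?] /andP[? ?].
  by rewrite ler_norml; apply/andP; split; lra.
have := T _ _ Iy Ix; rewrite -(real_normK (num_real (x - y))) => H.
have -> : f x - f y = (f x - f y - df y * (x - y)) + df y * (x - y) by ring.
have -> : C * (1 + (b - a)) * `|x - y| = C * ((b - a) * `|x - y|) + C * `|x - y| by ring.
apply: (le_trans (ler_normD _ _)); apply: lerD; last by rewrite normrM ler_wpM2r// dC.
by apply: (le_trans H); rewrite expr2 ler_wpM2l// ler_wpM2r.
Qed.

Lemma tangent_clamp_derive (f df : R -> R) t : tangent `[a, b] f df C ->
  a < t -> t < b -> is_derive t 1 (f \o clamp a b) (df t).
Proof.
move=> T at_ tb; apply: (@is_derive_quad _ _ _ _ C (Num.min (t - a) (b - t))).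
  by rewrite lt_min !subr_gt0 at_.
move=> h; rewrite lt_min !ltr_norml => /andP[/andP[h1 h2] /andP[h3 h4]] /=.
have [? ?] : a <= t + h /\ t + h <= b by split; lra.
rewrite !clamp_id ?(ltW at_) ?(ltW tb)//.
have := T t (t + h); rewrite /= !in_itv/= (ltW at_) (ltW tb)/=.
rewrite (_ : t + h - t = h); last by ring.
by apply => //; exact/andP.
Qed.

Lemma flow_continuous_u : continuous (u \o clamp a b).
Proof. by have [h1 _ h3 _] := fl; exact: tangent_clamp_continuous h1 h3. Qed.

Lemma flow_continuous_g : continuous (g \o clamp a b).
Proof. by have [_ h2 _ h4] := fl; exact: tangent_clamp_continuous h2 h4. Qed.

End OnSegment.

(** Gronwall's inequality: with [y] the squared distance of the Cauchy data, the
    function [(y + e^2) exp (- (2 + L) t)] is nonincreasing. *)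
Lemma gronwall a b u1 g1 k1 u2 g2 k2 C L e : a < b -> 0 <= L -> 0 <= e ->
  flow `[a, b] u1 g1 k1 C -> flow `[a, b] u2 g2 k2 C ->
  (forall x, a <= x -> x <= b -> `|k1 x - k2 x| <= L * `|u1 x - u2 x| + e) ->
  (u1 b - u2 b) ^+ 2 + (g1 b - g2 b) ^+ 2 + e ^+ 2 <=
  ((u1 a - u2 a) ^+ 2 + (g1 a - g2 a) ^+ 2 + e ^+ 2) * expR ((2 + L) * (b - a)).
Proof.
move=> ab L0 e0 f1 f2 kk; set K := 2 + L.
pose U t := (u1 \o clamp a b) t - (u2 \o clamp a b) t.
pose G t := (g1 \o clamp a b) t - (g2 \o clamp a b) t.
pose E t := expR (- K * (t - a)).
pose F t := (U t * U t + G t * G t + e ^+ 2) * E t.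
have cU : continuous U.
  by move=> t; apply: cvgB; [exact: (flow_continuous_u ab f1)|exact: (flow_continuous_u ab f2)].
have cG : continuous G.
  by move=> t; apply: cvgB; [exact: (flow_continuous_g ab f1)|exact: (flow_continuous_g ab f2)].
have dE t : is_derive t 1 E (- K * E t).
  have H : is_derive t 1 (fun t => - K * (t - a)) (- K).
    apply: (@is_derive_quad _ _ _ _ 0 1) => // h _.
    by rewrite (_ : _ - _ = 0) ?normr0 ?mul0r//; ring.
  by rewrite mulrC; exact: (is_derive1_comp (is_derive_expR _) H).
have cE : continuous E by exact: derive_continuous dE.
have cF : continuous F.
  move=> t; apply: cvgM; last exact: cE.
  apply: cvgD; last exact: cvg_cst.
  by apply: cvgD; apply: cvgM; [exact: cU|exact: cU|exact: cG|exact: cG].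
pose dU t := g1 t - g2 t; pose dG t := k1 t - k2 t.
pose dF t := (2 * U t * dU t + 2 * G t * dG t - K * (U t * U t + G t * G t + e ^+ 2)) * E t.
have DF t : a < t -> t < b -> is_derive t 1 F (dF t).
  move=> at_ tb; have [h1 h2 _ _] := f1; have [h1' h2' _ _] := f2.
  have DU : is_derive t 1 U (dU t).
    have D1 := tangent_clamp_derive h1 at_ tb; have D2 := tangent_clamp_derive h1' at_ tb.
    exact: is_deriveB D1 D2.
  have DG : is_derive t 1 G (dG t).
    have D1 := tangent_clamp_derive h2 at_ tb; have D2 := tangent_clamp_derive h2' at_ tb.
    exact: is_deriveB D1 D2.
  have D := is_deriveM (is_deriveD (is_deriveD (is_deriveM DU DU) (is_deriveM DG DG))
    (is_derive_cst (e ^+ 2) t 1)) (dE t).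
  apply: (is_derive_eq D); rewrite /dF /GRing.scale/=.
  rewrite !fctE; ring.
have [||c cab] := @MVT _ F dF a b ab.
- by move=> t; rewrite in_itv/= => /andP[? ?]; exact: DF.
- exact: continuous_subspaceT.
move: cab; rewrite in_itv/= => /andP[ac cb] FE.
have Fba : F b <= F a.
  rewrite -subr_le0 FE mulr_le0_ge0 ?subr_ge0 ?(ltW ab)//.
  rewrite /dF mulr_le0_ge0 ?expR_ge0//.
  have Gc : G c = dU c by rewrite /G /dU /= clamp_id ?ltW.
  have Uc : U c = u1 c - u2 c by rewrite /U /= clamp_id ?ltW.
  have kc := kk c (ltW ac) (ltW cb).
  rewrite -Uc -/(dG c) in kc.
  rewrite -Gc; move: (U c) (G c) (dG c) kc => x y z kc.
  have s1 : 2 * x * y <= x * x + y * y.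
    by rewrite -subr_ge0 (_ : _ - _ = (x - y) ^+ 2) ?sqr_ge0//; ring.
  have s2 : 2 * y * z <= L * (x * x + y * y) + (y * y + e ^+ 2).
    apply: (@le_trans _ _ (2 * (`|y| * `|z|))).
      by rewrite -mulrA ler_wpM2l// -normrM ler_norm.
    have yy : y * y = `|y| ^+ 2 by rewrite real_normK ?num_real// expr2.
    have xx : x * x = `|x| ^+ 2 by rewrite real_normK ?num_real// expr2.
    rewrite yy xx; move: (`|y|) (`|x|) (`|z|) (normr_ge0 y) (normr_ge0 x) kc.
    move=> Y X Z Y0 X0 kc.
    have h1 : Y * Z <= Y * (L * X + e) by rewrite ler_wpM2l.
    have h2 : 0 <= L * (X - Y) ^+ 2 by rewrite mulr_ge0 ?sqr_ge0.
    have h3 : 0 <= (Y - e) ^+ 2 by rewrite sqr_ge0.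
    have e1 : L * (X - Y) ^+ 2 = L * X ^+ 2 + L * Y ^+ 2 - 2 * (L * X * Y) by ring.
    have e2 : (Y - e) ^+ 2 = Y ^+ 2 + e ^+ 2 - 2 * (Y * e) by ring.
    have e3 : Y * (L * X + e) = L * X * Y + Y * e by ring.
    rewrite e1 in h2; rewrite e2 in h3; rewrite e3 in h1.
    by rewrite mulrDr; clear -h1 h2 h3; lra.
  have e20 := sqr_ge0 e.
  have Le : 0 <= L * e ^+ 2 by rewrite mulr_ge0.
  have xx := sqr_ge0 x; rewrite expr2 in xx.
  rewrite /K (_ : (2 + L) * (x * x + y * y + e ^+ 2) = 2 * (x * x) + 2 * (y * y) +
    2 * e ^+ 2 + L * (x * x + y * y) + L * e ^+ 2); last by ring.
  by clear -s1 s2 e20 Le xx; lra.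
have Eb : E b * expR (K * (b - a)) = 1 by rewrite /E -expRD mulNr addNr expR0.
have Ea : E a = 1 by rewrite /E subrr mulr0 expR0.
have := ler_wpM2r (expR_ge0 (K * (b - a))) Fba.
rewrite /F -mulrA Eb Ea !mulr1 /U /G /= !clamp_id ?lexx ?(ltW ab)//.
Qed.

Lemma gronwall_backward a b u1 g1 k1 u2 g2 k2 C L e : a < b -> 0 <= L -> 0 <= e ->
  flow `[a, b] u1 g1 k1 C -> flow `[a, b] u2 g2 k2 C ->
  (forall x, a <= x -> x <= b -> `|k1 x - k2 x| <= L * `|u1 x - u2 x| + e) ->
  (u1 a - u2 a) ^+ 2 + (g1 a - g2 a) ^+ 2 + e ^+ 2 <=
  ((u1 b - u2 b) ^+ 2 + (g1 b - g2 b) ^+ 2 + e ^+ 2) * expR ((2 + L) * (b - a)).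
Proof.
move=> ab L0 e0 /flow_reflect f1 /flow_reflect f2 kk.
have ab' : - b < - a by rewrite ltrN2.
have := gronwall ab' L0 e0 f1 f2; rewrite !opprK.
have -> : - a + b = b - a by rewrite addrC.
have N (x y : R) : (- x + y) ^+ 2 = (x - y) ^+ 2 by ring.
rewrite !N; apply => x bx xa; apply: kk; first by rewrite lerNr.
by rewrite lerNl.
Qed.

Lemma flow_unique a b u1 g1 k1 u2 g2 k2 C L : a <= b -> 0 <= L ->
  flow `[a, b] u1 g1 k1 C -> flow `[a, b] u2 g2 k2 C ->
  (forall x, a <= x -> x <= b -> `|k1 x - k2 x| <= L * `|u1 x - u2 x|) ->
  (u1 a = u2 a /\ g1 a = g2 a) <-> (u1 b = u2 b /\ g1 b = g2 b).
Proof.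
rewrite le_eqVlt => /predU1P[->//|ab] L0 f1 f2 kk.
have kk' x : a <= x -> x <= b -> `|k1 x - k2 x| <= L * `|u1 x - u2 x| + 0.
  by rewrite addr0; exact: kk.
have sq0 (x y : R) : x ^+ 2 + y ^+ 2 <= 0 -> x = 0 /\ y = 0.
  move=> H; have x0 := sqr_ge0 x; have y0 := sqr_ge0 y.
  have /eqP : x ^+ 2 = 0 by lra.
  have /eqP : y ^+ 2 = 0 by lra.
  by rewrite !expf_eq0/= => /eqP -> /eqP ->.
split=> -[ua ga].
  have := gronwall ab L0 (lexx 0) f1 f2 kk'.
  rewrite ua ga !subrr expr0n/= !addr0 mul0r => /sq0[/eqP + /eqP].
  by rewrite !subr_eq0 => /eqP -> /eqP ->.
have := gronwall_backward ab L0 (lexx 0) f1 f2 kk'.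
rewrite ua ga !subrr expr0n/= !addr0 mul0r => /sq0[/eqP + /eqP].
by rewrite !subr_eq0 => /eqP -> /eqP ->.
Qed.

End Tangent.

(** * The profile equation *)

Section Primitive.
Context {R : realType}.
Local Notation leb := (@lebesgue_measure R).
Implicit Types (D : set R) (u g k : R -> R) (x y C M W w : R).

Definition primitive D u g : Prop := forall x y, D x -> D y -> x <= y ->
  rintegrable `[x, y] g /\ u y - u x = \int[leb]_(t in `[x, y]) g t.

Section OnBranch.
Variables (D : set R) (bD : branch D).

Lemma primitive_lipschitz u g C : primitive D u g ->
  (forall x, D x -> `|g x| <= C) ->
  forall x y, D x -> D y -> `|u y - u x| <= C * `|y - x|.
Proof.
move=> ug gC; have H x y : D x -> D y -> x <= y -> `|u y - u x| <= C * `|y - x|.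
  move=> Dx Dy xy; have [gi ->] := ug _ _ Dx Dy xy.
  rewrite [`|y - x|]ger0_norm ?subr_ge0//; apply: Rintegral_norm_le => // t txy.
  by apply/gC/(branch_itv bD Dx Dy); rewrite /= in_itv.
move=> x y Dx Dy; have [xy|yx] := leP x y; first exact: H.
by rewrite distrC [`|y - x|]distrC; apply: H => //; exact: ltW.
Qed.

Lemma primitive_tangent u g C : primitive D u g ->
  (forall x y, D x -> D y -> `|g y - g x| <= C * `|y - x|) ->
  tangent D u g C.
Proof.
move=> ug gC x y Dx Dy.
have C0 z z' : D z -> D z' -> z < z' -> 0 <= C.
  move=> Dz Dz' zz'; have := le_trans (normr_ge0 _) (gC z z' Dz Dz').
  by rewrite pmulr_lge0// normr_gt0 subr_eq0 gt_eqF.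
have H z z' c : D z -> D z' -> D c -> z <= z' -> z <= c -> c <= z' ->
    `|u z' - u z - g c * (z' - z)| <= C * (z' - z) ^+ 2.
  move=> Dz Dz' Dc zz' zc cz'; have [gi ->] := ug _ _ Dz Dz' zz'.
  rewrite -Rintegral_cst_itv// -RintegralB//; last exact: rintegrable_cst.
  rewrite expr2 mulrA; apply: Rintegral_norm_le => //.
    by apply: rintegrableB => //; exact: rintegrable_cst.
  move=> t tz; have Dt : D t by apply: (branch_itv bD Dz Dz'); rewrite /= in_itv.
  apply: (le_trans (gC _ _ Dc Dt)).
  move: zz' tz; rewrite le_eqVlt => /predU1P[zz'|zz'] /andP[zt tz].
    rewrite -zz' in tz cz'.
    have -> : t = c by apply/eqP; rewrite eq_le (le_trans tz)// (le_trans cz').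
    by rewrite zz' !subrr normr0.
  rewrite ler_wpM2l ?(C0 _ _ Dz Dz')// ler_norml; apply/andP; split; lra.
have [xy|/ltW yx] := leP x y; first exact: H.
have -> : u y - u x - g x * (y - x) = - (u x - u y - g x * (x - y)) by ring.
by rewrite normrN -sqrrN opprB; exact: H.
Qed.

(** A continuous derivative is determined at every point.  It is needed because
    the Kirchhoff condition and the equation may be stated with two different
    representatives of the derivative. *)
Lemma primitive_unique u g1 g2 K : primitive D u g1 -> primitive D u g2 ->
  (forall x y, D x -> D y -> `|y - x| <= 1 -> (g1 y - g1 x) ^+ 2 <= K * `|y - x|) ->
  (forall x y, D x -> D y -> `|y - x| <= 1 -> (g2 y - g2 x) ^+ 2 <= K * `|y - x|) ->
  forall x, D x -> g1 x = g2 x.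
Proof.
move=> ug1 ug2 h1 h2 x Dx; apply/eqP; rewrite -subr_eq0.
set c := g1 x - g2 x; case: (eqVneq c 0) => // c0.
have [y0 [Dy0 Dy1 y0x xy1]] := branch_unit bD Dx.
have K0 : 0 <= K.
  have := le_trans (sqr_ge0 _) (h1 y0 (y0 + 1) Dy0 Dy1 _).
  by rewrite addrAC subrr add0r normr1 mulr1; apply.
pose d := Num.min 2^-1 (c ^+ 2 / (16 * (K + 1))).
have c20 : 0 < c ^+ 2 by rewrite exprn_even_gt0.
have d0 : 0 < d by rewrite lt_min invr_gt0 ltr0n/= divr_gt0// mulr_gt0// ltr_wpDl.
have d1 : d <= 2^-1 by rewrite ge_min lexx.
have dK : 4 * K * d < c ^+ 2 / 2.
  apply: (@le_lt_trans _ _ (4 * K * (c ^+ 2 / (16 * (K + 1))))).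
    by rewrite ler_wpM2l ?mulr_ge0// ge_min lexx orbT.
  have -> : 4 * K * (c ^+ 2 / (16 * (K + 1))) = c ^+ 2 / 4 * (K / (K + 1)).
    by field; rewrite gt_eqF// ltr_wpDl.
  apply: (@le_lt_trans _ _ (c ^+ 2 / 4)); last by lra.
  by rewrite ler_piMr ?divr_ge0 ?(ltW c20)// ler_pdivrMr ?mul1r ?lerDl// ltr_wpDl.
have [z [z' [Dz Dz' zz' zx xz']]] : exists z z', [/\ D z, D z', z' - z = d,
    z <= x & x <= z'].
  have sI := branch_itv bD Dy0 Dy1.
  have [xh|xh] := leP x (y0 + 2^-1).
    by exists x, (x + d); split=> //; try (apply: sI; rewrite /= in_itv/=; apply/andP; split); lra.
  by exists (x - d), x; split=> //; try (apply: sI; rewrite /= in_itv/=; apply/andP; split); lra.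
have zlez' : z <= z' by lra.
have [i1 e1] := ug1 _ _ Dz Dz' zlez'; have [i2 e2] := ug2 _ _ Dz Dz' zlez'.
have i12 := rintegrableB (measurable_itv `[z, z']) i1 i2.
have E : \int[leb]_(t in `[z, z']) (g1 t - g2 t - c) = - c * d.
  rewrite RintegralB//; last exact: rintegrable_cst.
  by rewrite RintegralB// -e1 -e2 subrr Rintegral_cst_itv// zz' sub0r mulNr.
pose m := `|c| * (3 / 4).
have : `|\int[leb]_(t in `[z, z']) (g1 t - g2 t - c)| <= m * (z' - z).
  apply: Rintegral_norm_le => //.
    by apply: rintegrableB => //; exact: rintegrable_cst.
  move=> t tz; have Dt : D t by apply: (branch_itv bD Dz Dz'); rewrite /= in_itv.
  move: tz => /andP[zt tz].
  have td : `|t - x| <= d by rewrite ler_norml; apply/andP; split; lra.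
  have t1 : `|t - x| <= 1 by lra.
  have H1 := h1 _ _ Dx Dt t1; have H2 := h2 _ _ Dx Dt t1.
  rewrite -(@ler_pXn2r _ 2)// ?nnegrE ?mulr_ge0// real_normK ?num_real//.
  have -> : g1 t - g2 t - c = (g1 t - g1 x) - (g2 t - g2 x) by rewrite /c; ring.
  have m2 : m ^+ 2 = c ^+ 2 * (9 / 16).
    by rewrite /m exprMn real_normK ?num_real//; field.
  move: H1 H2; move: (g1 t - g1 x) (g2 t - g2 x) => p q H1 H2.
  have Kd : K * `|t - x| <= K * d by rewrite ler_wpM2l.
  have pq : (p - q) ^+ 2 <= 2 * p ^+ 2 + 2 * q ^+ 2.
    by rewrite -subr_ge0 (_ : _ - _ = (p + q) ^+ 2) ?sqr_ge0//; ring.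
  apply: (le_trans pq); rewrite m2.
  by move: dK; rewrite -mulrA; move: (K * d) (K * _) Kd H1 H2 => *; lra.
rewrite E zz' normrM normrN (gtr0_norm d0) ler_pM2r// /m.
have : 0 < `|c| by rewrite normr_gt0.
by move=> *; exfalso; lra.
Qed.

End OnBranch.

Definition nls w x : R := - 3 * x ^+ 5 - w * x.

Lemma nls_bound w W M x : `|w| <= W -> 0 <= x -> x <= M ->
  `|nls w x| <= 3 * M ^+ 5 + W * M.
Proof.
move=> wW x0 xM; rewrite /nls; apply: (le_trans (ler_normB _ _)).
apply: lerD; rewrite normrM.
  rewrite normrN normr_nat ger0_norm ?exprn_ge0// ler_wpM2l// lerXn2r ?nnegrE//.
  exact: le_trans xM.
by rewrite (ger0_norm x0) ler_pM.
Qed.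

Lemma nls_lipschitz w W M x y : `|w| <= W -> 0 <= x -> x <= M -> 0 <= y -> y <= M ->
  `|nls w x - nls w y| <= (15 * M ^+ 4 + W) * `|x - y|.
Proof.
move=> wW x0 xM y0 yM.
have -> : nls w x - nls w y = - ((3 * (x ^+ 4 + x ^+ 3 * y + x ^+ 2 * y ^+ 2 +
   x * y ^+ 3 + y ^+ 4) + w) * (x - y)) by rewrite /nls; ring.
rewrite normrN normrM ler_wpM2r//; apply: (le_trans (ler_normD _ _)).
apply: lerD => //; have M0 := le_trans x0 xM.
have p n : x ^+ n <= M ^+ n by rewrite lerXn2r.
have q n : y ^+ n <= M ^+ n by rewrite lerXn2r.
have xn n : 0 <= x ^+ n by rewrite exprn_ge0.
have yn n : 0 <= y ^+ n by rewrite exprn_ge0.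
rewrite ger0_norm ?mulr_ge0 ?addr_ge0 ?mulr_ge0//.
have -> : 15 * M ^+ 4 = 3 * (M ^+ 4 + M ^+ 3 * M + M ^+ 2 * M ^+ 2 + M * M ^+ 3 + M ^+ 4).
  by ring.
by rewrite ler_wpM2l// !lerD// ler_pM.
Qed.

Lemma nls_dist w w' M x : 0 <= x -> x <= M -> `|nls w x - nls w' x| <= `|w - w'| * M.
Proof.
move=> x0 xM; have -> : nls w x - nls w' x = - ((w - w') * x) by rewrite /nls; ring.
by rewrite normrN normrM ler_wpM2l// ger0_norm.
Qed.

Definition flow_bound M W : R :=
  let F := 3 * M ^+ 5 + W * M in let G := M + 2 * F in
  F + G + (15 * M ^+ 4 + W) * G.

(** The constant depends on the bounds [M] and [W] only: a bounded family of
    waves with bounded frequencies is equicontinuous together with its first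
    derivatives.  The bound on [g] comes from the boundedness of [u] on a segment
    of length one. *)
Lemma primitive_flow D w W M u g : branch D -> `|w| <= W ->
  (forall x, D x -> 0 <= u x) -> (forall x, D x -> u x <= M) ->
  primitive D u g -> primitive D g (fun x => nls w (u x)) ->
  flow D u g (fun x => nls w (u x)) (flow_bound M W).
Proof.
move=> bD wW u0 uM ug gk; rewrite /flow_bound.
have [a [_ [Da _ _ _]]] := branch_exhaust bD.
have M0 : 0 <= M := le_trans (u0 _ Da) (uM _ Da).
have W0 : 0 <= W by exact: le_trans wW.
set F := 3 * M ^+ 5 + W * M; have F0 : 0 <= F.
  by rewrite addr_ge0 ?mulr_ge0 ?exprn_ge0.
set G := M + 2 * F; have G0 : 0 <= G by rewrite addr_ge0 ?mulr_ge0.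
set L := 15 * M ^+ 4 + W.
have L0 : 0 <= L by rewrite addr_ge0 ?mulr_ge0 ?exprn_ge0.
have LG : 0 <= L * G by rewrite mulr_ge0.
have kF x : D x -> `|nls w (u x)| <= F.
  by move=> Dx; apply: nls_bound => //; [exact: u0|exact: uM].
have gL := primitive_lipschitz bD gk kF.
have tu := primitive_tangent bD ug gL.
have gG x : D x -> `|g x| <= G.
  move=> Dx; have [y [Dy Dy1 yx xy]] := branch_unit bD Dx.
  have := tu y (y + 1) Dy Dy1; have -> : y + 1 - y = 1 by ring.
  rewrite expr1n !mulr1 => H1.
  have H2 : `|g x - g y| <= F.
    apply: (le_trans (gL _ _ Dy Dx)); rewrite ler_piMr// ler_norml; apply/andP; split; lra.
  have := u0 _ Dy; have := u0 _ Dy1; have := uM _ Dy; have := uM _ Dy1.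
  move: H1 H2; rewrite /G !ler_norml => /andP[? ?] /andP[? ?] *.
  by apply/andP; split; lra.
have uL := primitive_lipschitz bD ug gG.
have kL x y : D x -> D y -> `|nls w (u y) - nls w (u x)| <= L * G * `|y - x|.
  move=> Dx Dy; apply: (le_trans (nls_lipschitz wW (u0 _ Dy) (uM _ Dy) (u0 _ Dx) (uM _ Dx))).
  by rewrite -mulrA ler_wpM2l// uL.
have tg := primitive_tangent bD gk kL.
split.
- move=> x y Dx Dy; apply: (le_trans (tu _ _ Dx Dy)).
  by rewrite ler_wpM2r ?sqr_ge0// -addrA lerDl addr_ge0.
- move=> x y Dx Dy; apply: (le_trans (tg _ _ Dx Dy)).
  by rewrite ler_wpM2r ?sqr_ge0// lerDr addr_ge0.
- by move=> x Dx; apply: (le_trans (gG _ Dx)); lra.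
- by move=> x Dx; apply: (le_trans (kF _ Dx)); lra.
Qed.

Lemma primitive_clamp x y u g : x < y -> continuous (g \o clamp x y) ->
  continuous (u \o clamp x y) ->
  (forall t, x < t -> t < y -> is_derive t 1 (u \o clamp x y) (g t)) ->
  rintegrable `[x, y] g /\ u y - u x = \int[leb]_(t in `[x, y]) g t.
Proof.
move=> xy cg cu du.
have [gi e] := FTC_itv (ltW xy) (continuous_subspaceT cg) (continuous_subspaceT cu)
  (fun t xt ty => (eq_ind _ (is_derive t 1 (u \o clamp x y)) (du t xt ty) _
     (esym (congr1 g (clamp_id (ltW xt) (ltW ty)))))).
have eg t : `[x, y]%classic t -> (g \o clamp x y) t = g t.
  by rewrite /= in_itv/= => /andP[xt ty]; rewrite clamp_id.
split.
  by apply: eq_integrable gi => // t /set_mem/eg /= ->.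
have -> : \int[leb]_(t in `[x, y]) g t = \int[leb]_(t in `[x, y]) (g \o clamp x y) t.
  by apply: eq_Rintegral => t /set_mem/eg /= ->.
by rewrite e /= !clamp_id ?lexx ?(ltW xy).
Qed.

Lemma rintegrable_point x g : rintegrable `[x, x] g.
Proof.
apply: eq_integrable (rintegrable_cst x x (g x)) => //= t /set_mem/=.
by rewrite in_itv/= => tx; congr EFin; congr g; apply/eqP; rewrite eq_le.
Qed.

Lemma flow_primitive D f u g C : branch D -> continuous f ->
  flow D u g (f \o u) C -> primitive D u g /\ primitive D g (f \o u).
Proof.
move=> bD cf fl.
have P x y : D x -> D y -> x < y ->
    (rintegrable `[x, y] g /\ u y - u x = \int[leb]_(t in `[x, y]) g t) /\
    (rintegrable `[x, y] (f \o u) /\ g y - g x = \int[leb]_(t in `[x, y]) (f \o u) t).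
  move=> Dx Dy xy; have fxy := flow_subset (branch_itv bD Dx Dy) fl.
  have cu := flow_continuous_u xy fxy; have cg := flow_continuous_g xy fxy.
  have [h1 h2 _ _] := fxy; split.
    by apply: primitive_clamp => // t; exact: (tangent_clamp_derive h1).
  apply: primitive_clamp => // [|t]; last exact: (tangent_clamp_derive h2).
  by move=> t; exact: (continuous_comp (cu t) (cf _)).
split=> x y Dx Dy; rewrite le_eqVlt => /predU1P[<-|xy];
  by [rewrite subrr set_itv1 Rintegral_set1 -set_itv1; split=> //; exact: rintegrable_point|
      have [] := P _ _ Dx Dy xy].
Qed.

Lemma nls_continuous w : continuous (nls w).
Proof.
move=> x; apply: cvgB; last by apply: cvgM; [exact: cvg_cst|exact: cvg_id].
by apply: cvgM; [exact: cvg_cst|exact: exprn_continuous].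
Qed.

(** A positive wave, reduced to the real ordinary differential equation that
    its components solve. *)
Record profile w (u g v h : R -> R) : Prop := Profile {
  profile_u : primitive loop u g;
  profile_g : primitive loop g (fun x => nls w (u x));
  profile_v : primitive tail v h;
  profile_h : primitive tail h (fun x => nls w (v x));
  profile_periodic : u pi = u (- pi);
  profile_vertex : u pi = v 0;
  profile_kirchhoff : g pi - g (- pi) = h 0;
  profile_u_gt0 : forall x, loop x -> 0 < u x;
  profile_v_gt0 : forall x, tail x -> 0 < v x;
  profile_even : forall x, loop x -> u (- x) = u x;
  profile_u_decr : forall x y, 0 <= x -> x < y -> y <= pi -> u y < u x;
  profile_v_decr : forall x y, 0 <= x -> x < y -> v y < v x;
  profile_v_sqr : rintegrable tail (fun x => v x ^+ 2);
  profile_h_sqr : rintegrable tail (fun x => h x ^+ 2) }.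

End Primitive.

Section Bridge.
Local Open Scope complex_scope.
Context {R : realType}.
Local Notation leb := (@lebesgue_measure R).
Local Notation Re := (@complex.Re R).
Local Notation Im := (@complex.Im R).
Implicit Types (D : set R) (F : tadfun R) (w : R).

Lemma Re_primitive D (u g : R -> R[i]) : weak_derivative D u g ->
  primitive D (Re \o u) (Re \o g).
Proof. by move=> ug x y Dx Dy xy; exact: weak_derivative_Re ug Dx Dy xy. Qed.

Lemma primitive_complex D (u g : R -> R) : primitive D u g ->
  weak_derivative D (fun x => (u x)%:C) (fun x => (g x)%:C).
Proof.
move=> ug x y Dx Dy xy; have [gi e] := ug x y Dx Dy xy.
have i0 : leb.-integrable `[x, y] (EFin \o (fun=> (0 : R))) by exact: integrable0.
split; first by split; [exact: gi|exact: i0].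
apply/eqP; rewrite eq_complex/= e /Cintegral/= subrr eqxx/=.
by rewrite /Rintegral integral0.
Qed.

Lemma real_square_integrable D (u : R -> R) : measurable D -> measurable_fun D u ->
  rintegrable D (fun x => u x ^+ 2) -> square_integrable D (fun x => (u x)%:C).
Proof.
move=> mD mu ui; apply/square_integrableP; split => //.
  exact: measurable_cst.
rewrite (_ : (fun _ => _) = (fun x => u x ^+ 2))//.
by apply/funext => x; rewrite /dotc/= mulr0 addr0 expr2.
Qed.

Lemma square_integrable_Re D (u : R -> R[i]) : measurable D -> square_integrable D u ->
  rintegrable D (fun x => Re (u x) ^+ 2) /\
  \int[leb]_(x in D) (Re (u x) ^+ 2) <= L2ip D u u.
Proof.
move=> mD /square_integrableP[mu1 mu2 ui].
have le x : Re (u x) ^+ 2 <= dotc (u x) (u x).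
  by rewrite /dotc -!expr2 lerDl sqr_ge0.
have i2 : rintegrable D (fun x => Re (u x) ^+ 2).
  apply: rintegrable_le ui _ => //; first exact: measurable_funX.
  by move=> x _; rewrite ger0_norm ?sqr_ge0.
by split=> //; apply: le_Rintegral.
Qed.

Lemma Re_gt0 (z : R[i]) : 0 < z -> 0 < Re z /\ z = (Re z)%:C.
Proof. by case: z => a b; rewrite ltcE/= => /andP[/eqP -> ?]. Qed.

Lemma Re_le_bound (z : R[i]) (M : R) : 0 <= M -> dotc z z <= M -> Re z <= M + 1.
Proof.
move=> M0; rewrite /dotc -!expr2 => zM; rewrite leNgt; apply/negP => Mz.
have h1 : (M + 1) ^+ 2 < Re z ^+ 2 by rewrite ltrXn2r ?nnegrE ?addr_ge0.
have h2 := sqr_ge0 (Im z); have h3 := sqr_ge0 M.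
have e : (M + 1) ^+ 2 = M ^+ 2 + 2 * M + 1 by ring.
by move: h1 h2 h3 zM; rewrite e; clear -M0; lra.
Qed.

Lemma ltc_real (a b : R) : (a%:C < b%:C) = (a < b).
Proof. by rewrite ltcE/= eqxx. Qed.

Lemma loop_pi : loop (pi : R) /\ loop (- pi : R).
Proof.
have p1 := @pi_ge1 R; rewrite /loop/= !in_itv/= !lexx/=.
by rewrite andbT; split; lra.
Qed.

Lemma tail0 : tail (0 : R).
Proof. by rewrite /tail/= in_itv/= lexx. Qed.

Lemma loopN (x : R) : loop x -> loop (- x).
Proof. by rewrite /loop/= !in_itv/= lerN2 lerNl andbC. Qed.

Lemma loop_nneg (x : R) : 0 <= x -> x <= pi -> loop x.
Proof. by move=> x0 xp; rewrite /loop/= in_itv/= xp andbT; have := @pi_ge1 R; lra. Qed.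

Lemma nls_complex w (a : R) (l : R[i]) : - l - 3 * a%:C ^+ 5 = w%:C * a%:C ->
  Re l = nls w a.
Proof.
move=> e; have -> : l = (nls w a)%:C; last by [].
have -> : l = - 3 * a%:C ^+ 5 - (- l - 3 * a%:C ^+ 5) by ring.
rewrite e -rmorphXn (_ : (3 : R[i]) = (3 : R)%:C); last by rewrite rmorph_nat.
by rewrite -rmorphN -!rmorphM -rmorphB.
Qed.

Lemma positive_solution_profile w F : positive_solution w F -> exists g h,
  [/\ profile w (Re \o F.1) g (Re \o F.2) h,
      \int[leb]_(x in tail) (Re (F.2 x) ^+ 2) <= mass F &
      \int[leb]_(x in tail) (h x ^+ 2) <= dirichlet F].
Proof.
move=> [[HF [G [[ug vh] Hg Hh NK]]] [F1 F2] [ev de1 de2] [G' [L [[ug' vh'] [gL hL] e1 e2]]]].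
have [M [M0 b1 b2]] := H1C_bound HF.
have bl := @loop_branch R; have bt := @tail_branch R.
have [Hu Hv per ver] := HF.
have [lp lm] := loop_pi; have t0 := tail0.
have R1 x : loop x -> 0 < Re (F.1 x) /\ F.1 x = (Re (F.1 x))%:C by move=> /F1/Re_gt0.
have R2 x : tail x -> 0 < Re (F.2 x) /\ F.2 x = (Re (F.2 x))%:C by move=> /F2/Re_gt0.
have M1 x : loop x -> Re (F.1 x) <= M + 1.
  by move=> Dx; apply: Re_le_bound M0 (b1 x Dx).
have M2 x : tail x -> Re (F.2 x) <= M + 1.
  by move=> Dx; apply: Re_le_bound M0 (b2 x Dx).
(* the weak derivative of the derivative is the nonlinearity *)
have ode D (u g l : R -> R[i]) : branch D -> weak_derivative D u g ->
    weak_derivative D g l -> measurable_fun D (Re \o u) ->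
    (forall x, D x -> u x = (Re (u x))%:C) ->
    {ae leb, forall x, D x -> - l x - 3 * u x ^+ 5 = w%:C * u x} ->
    primitive D (Re \o g) (fun x => nls w (Re (u x))).
  move=> bD _ gl mu uR ae x y Dx Dy xy.
  have [li E] := weak_derivative_Re gl Dx Dy xy.
  have sD := branch_itv bD Dx Dy.
  have mxy : measurable `[x, y] by exact: measurable_itv.
  have mn : measurable_fun `[x, y] (fun x => nls w (Re (u x))).
    apply: (measurableT_comp (continuous_measurable_fun (@nls_continuous R w))).
    exact: (measurable_funS (branch_measurable bD) sD mu).
  have aeE : {ae leb, forall t, `[x, y]%classic t -> Re (l t) = nls w (Re (u t))}.
    apply: aeS ae => t H txy; have Dt := sD _ txy.
    by apply: nls_complex; rewrite -(uR _ Dt); exact: H.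
  split; first by apply: ae_eq_rintegrable li.
  rewrite E; apply: ae_eq_Rintegral => //; exact: rintegrable_measurable.
have [[mu1 _ _] _] := Hu; have [[mv1 _ _] _] := Hv.
have pg := ode _ _ _ _ bl ug' gL mu1 (fun x Dx => (R1 x Dx).2) e1.
have ph := ode _ _ _ _ bt vh' hL mv1 (fun x Dx => (R2 x Dx).2) e2.
have M10 : 0 <= M + 1 by rewrite addr_ge0.
pose C := 3 * (M + 1) ^+ 5 + `|w| * (M + 1).
have C0 : 0 <= C by rewrite addr_ge0 ?mulr_ge0 ?exprn_ge0.
have gLip := primitive_lipschitz bl pg (fun x Dx => nls_bound (lexx _) (ltW (R1 x Dx).1) (M1 x Dx)).
have hLip := primitive_lipschitz bt ph (fun x Dx => nls_bound (lexx _) (ltW (R2 x Dx).1) (M2 x Dx)).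
have sq (D : set R) (f : R -> R) K : 0 <= K ->
    (forall x y, D x -> D y -> `|f y - f x| <= C * `|y - x|) ->
    forall x y, D x -> D y -> `|y - x| <= 1 -> (f y - f x) ^+ 2 <= (C ^+ 2 + K) * `|y - x|.
  move=> K0 fL x y Dx Dy yx1; rewrite -(real_normK (num_real (f y - f x))).
  apply: (@le_trans _ _ ((C * `|y - x|) ^+ 2)).
    by rewrite lerXn2r ?nnegrE ?mulr_ge0// fL.
  rewrite exprMn mulrDl -[leLHS]addr0 lerD ?mulr_ge0//.
  by rewrite ler_wpM2l ?sqr_ge0// expr2 ler_piMl.
have hoel D (f l : R -> R[i]) : branch D -> weak_derivative D f l -> square_integrable D l ->
    forall x y, D x -> D y -> `|y - x| <= 1 ->
    ((Re \o f) y - (Re \o f) x) ^+ 2 <= (C ^+ 2 + L2ip D l l) * `|y - x|.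
  move=> bD fl li.
  have H x y : D x -> D y -> x <= y ->
      ((Re \o f) y - (Re \o f) x) ^+ 2 <= (C ^+ 2 + L2ip D l l) * `|y - x|.
    move=> Dx Dy xy; have := weak_derivative_hoelder bD fl li Dx Dy xy.
    rewrite ger0_norm ?subr_ge0// => H.
    apply: (@le_trans _ _ ((y - x) * L2ip D l l)).
      apply: le_trans H; rewrite /dotc -!expr2 /=; case: (f y) (f x) => a b [c d] /=.
      by rewrite lerDl sqr_ge0.
    by rewrite [leRHS]mulrC ler_wpM2l ?subr_ge0// lerDr sqr_ge0.
  move=> x y Dx Dy _; have [xy|/ltW yx] := leP x y; first exact: H.
  by rewrite -sqrrN opprB distrC; exact: H.
have [_ [l1 gl1 l1i]] := Hg; have [_ [l2 hl2 l2i]] := Hh.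
have gE := primitive_unique bl (Re_primitive ug') (Re_primitive ug)
  (sq _ _ _ (L2ip_ge0 _ _) gLip) (hoel _ _ _ bl gl1 l1i).
have hE := primitive_unique bt (Re_primitive vh') (Re_primitive vh)
  (sq _ _ _ (L2ip_ge0 _ _) hLip) (hoel _ _ _ bt hl2 l2i).
have hi := H1_weak_derivative bt Hv vh'.
have [v2 v2le] := square_integrable_Re (branch_measurable bt) Hv.1.
have [h2 h2le] := square_integrable_Re (branch_measurable bt) hi.
exists (Re \o G'.1), (Re \o G'.2); split.
- split => //; try exact: Re_primitive.
  + by rewrite /= per.
  + by rewrite /= ver.
  + rewrite gE// gE// hE//= -NK; by case: (G.1 pi) (G.1 (- pi)) => a b [c d].
  + by move=> x /R1[].
  + by move=> x /R2[].
  + by move=> x Dx /=; rewrite ev.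
  + move=> x y x0 xy yp; have := de1 x y x0 xy yp.
    have [|_ ->] := R1 x; first by apply: loop_nneg => //; lra.
    have [|_ ->] := R1 y; first by apply: loop_nneg => //; lra.
    by rewrite ltc_real.
  + move=> x y x0 xy; have := de2 x y x0 xy.
    have [|_ ->] := R2 x; first by rewrite /tail/= in_itv/= x0.
    have [|_ ->] := R2 y; first by rewrite /tail/= in_itv/= andbT; lra.
    by rewrite ltc_real.
- by apply: (le_trans v2le); rewrite massE /mass_ip lerDr L2ip_ge0.
- apply: (le_trans h2le); rewrite (dirichlet_grad HF (G := G'))//.
  by rewrite /mass_ip lerDr L2ip_ge0.
Qed.

End Bridge.

(** * Limits of profiles are profiles *)

Section Strictness.
Context {R : realType}.
Local Notation leb := (@lebesgue_measure R).
Implicit Types (D : set R) (u g k v h : R -> R) (x y C M w c : R).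

Lemma le0_small (a C d : R) : 0 < d -> (forall e, 0 < e -> e <= d -> a <= C * e) -> a <= 0.
Proof.
move=> d0 H; rewrite leNgt; apply/negP => a0.
have C0 : 0 < `|C| + 1 by rewrite ltr_pwDr.
pose e := Num.min d (a / (2 * (`|C| + 1))).
have e0 : 0 < e by rewrite lt_min d0 divr_gt0// mulr_gt0.
have ed : e <= d by rewrite ge_min lexx.
have := H e e0 ed; rewrite leNgt => /negP; apply.
apply: (@le_lt_trans _ _ ((`|C| + 1) * e)).
  by rewrite ler_wpM2r ?(ltW e0)// (le_trans (ler_norm C))// lerDl.
apply: (@le_lt_trans _ _ ((`|C| + 1) * (a / (2 * (`|C| + 1))))).
  by rewrite ler_wpM2l ?(ltW C0)// ge_min lexx orbT.
have -> : (`|C| + 1) * (a / (2 * (`|C| + 1))) = a / 2 by field; rewrite gt_eqF.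
by lra.
Qed.

Lemma tangent_constant D u g C x y c : tangent D u g C -> `[x, y] `<=` D -> x < y ->
  (forall t, x <= t -> t <= y -> u t = c) ->
  forall t, x <= t -> t <= y -> g t = 0.
Proof.
move=> T sD xy uc.
have key t s : x <= t -> t <= y -> x <= s -> s <= y -> `|g t| * `|s - t| <= C * `|s - t| ^+ 2.
  move=> xt ty xs sy.
  have Dt : D t by apply: sD; rewrite /= in_itv/= xt.
  have Ds : D s by apply: sD; rewrite /= in_itv/= xs.
  have := T t s Dt Ds; rewrite !uc// subrr sub0r normrN normrM.
  by rewrite -[(s - t) ^+ 2]real_normK ?num_real.
have gle t : x <= t -> t <= y -> `|g t| <= 0.
  move=> xt ty; have d0 : 0 < (y - x) / 2 by rewrite divr_gt0// subr_gt0.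
  apply: (le0_small (C := C) d0) => e e0 ed.
  have [h|h] := leP t ((x + y) / 2).
    have /(key t (t + e) xt ty) : x <= t + e by lra.
    rewrite (_ : t + e - t = e); last by ring.
    rewrite (gtr0_norm e0) expr2 mulrA ler_pM2r//; apply; lra.
  have := key t (t - e) xt ty; rewrite (_ : t - e - t = - e); last by ring.
  rewrite normrN (gtr0_norm e0) expr2 mulrA ler_pM2r//; apply; lra.
by move=> t xt ty; apply/eqP; rewrite -normr_le0 gle.
Qed.

Lemma flow_cst D w c C : 0 <= C -> nls w c = 0 ->
  flow D (fun=> c) (fun=> 0) (fun=> nls w c) C.
Proof.
move=> C0 wc; rewrite wc; split.
- by move=> x y _ _; rewrite subrr mul0r subrr normr0 mulr_ge0 ?sqr_ge0.
- by move=> x y _ _; rewrite subrr mul0r subrr normr0 mulr_ge0 ?sqr_ge0.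
- by move=> x _; rewrite normr0.
- by move=> x _; rewrite normr0.
Qed.

Lemma nls0 w : nls w 0 = 0.
Proof. by rewrite /nls expr0n/= !mulr0 subr0. Qed.

(** A pointwise limit of profiles inherits the equation and the large
    inequalities; strict positivity and monotonicity are recovered from
    uniqueness for the Cauchy problem. *)
Section Limit.
Variables (w C M : R) (u g v h : R -> R).
Hypotheses
  (fu : flow loop u g (fun x => nls w (u x)) C)
  (fv : flow tail v h (fun x => nls w (v x)) C)
  (C0 : 0 <= C) (M0 : 0 <= M)
  (u0 : forall x, loop x -> 0 <= u x) (uM : forall x, loop x -> u x <= M)
  (v0 : forall x, tail x -> 0 <= v x) (vM : forall x, tail x -> v x <= M)
  (per : u pi = u (- pi)) (vtx : u pi = v 0) (kir : g pi - g (- pi) = h 0)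
  (even : forall x, loop x -> u (- x) = u x)
  (udec : forall x y, 0 <= x -> x <= y -> y <= pi -> u y <= u x)
  (vdec : forall x y, 0 <= x -> x <= y -> v y <= v x)
  (u_gt0 : 0 < u 0) (v2 : rintegrable tail (fun x => v x ^+ 2)).

Let tailP x : 0 <= x -> tail x.
Proof. by move=> x0; rewrite /tail/= in_itv/= x0. Qed.

Let tail_seg x y : 0 <= x -> `[x, y] `<=` tail.
Proof. by move=> x0 t; rewrite /= in_itv/= => /andP[xt _]; apply: tailP; lra. Qed.

Let loop_seg x y : - pi <= x -> y <= pi -> `[x, y] `<=` (loop : set R).
Proof.
move=> px yp t; rewrite /loop/= !in_itv/= => /andP[xt ty].
by rewrite (le_trans px xt) (le_trans ty yp).
Qed.

Let L := 15 * M ^+ 4 + `|w|.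
Let L0 : 0 <= L. Proof. by rewrite addr_ge0 ?mulr_ge0 ?exprn_ge0. Qed.

(** On a segment where the solution starts or ends like an equilibrium, it is
    that equilibrium. *)
Let rigid D f df c x y : flow D f df (fun x => nls w (f x)) C -> `[x, y] `<=` D ->
  (forall t, D t -> 0 <= f t /\ f t <= M) -> 0 <= c -> c <= M -> nls w c = 0 ->
  x <= y -> (f x = c /\ df x = 0) <-> (f y = c /\ df y = 0).
Proof.
move=> ff sD fM c0 cM wc xy.
apply: (flow_unique xy L0 (flow_subset sD ff) (flow_cst `[x, y] C0 wc)).
move=> t xt ty; have [] := fM t; first by apply: sD; rewrite /= in_itv/= xt.
by move=> f0 fM'; exact: nls_lipschitz.
Qed.

Let uB t : loop t -> 0 <= u t /\ u t <= M. Proof. by move=> Dt; rewrite u0// uM. Qed.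
Let vB t : tail t -> 0 <= v t /\ v t <= M. Proof. by move=> Dt; rewrite v0// vM. Qed.

Let pi0 : (0 : R) < pi. Proof. exact: pi_gt0. Qed.

(** A zero on the half-line would spread to the vertex by uniqueness; there the
    periodicity, the Kirchhoff condition and [u >= 0] make the derivative vanish
    too, so that uniqueness on the circle gives [u = 0], against [u 0 > 0]. *)
Lemma limit_v_gt0 x : 0 <= x -> 0 < v x.
Proof.
move=> x0; have vx0 := v0 (tailP x0).
rewrite lt_neqAle vx0 andbT eq_sym; apply/negP => /eqP vx.
have vz t : x <= t -> t <= x + 1 -> v t = 0.
  move=> xt _; apply/eqP; rewrite eq_le v0 ?andbT; last by apply: tailP; lra.
  by rewrite -vx vdec.
have [fv1 _ _ _] := fv.
have hx : h x = 0.
  by apply: (tangent_constant fv1 (@tail_seg x (x + 1) x0) _ vz) => //; lra.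
have [v00 h00] : v 0 = 0 /\ h 0 = 0.
  by apply/(rigid fv (@tail_seg 0 x (lexx 0)) vB (lexx 0) M0 (nls0 w) x0).
have up : u pi = 0 by rewrite vtx.
have um : u (- pi) = 0 by rewrite -per.
have [fu1 _ _ _] := fu; have [lp lm] := @loop_pi R.
have gp : g pi <= 0.
  apply: (le0_small (C := C) pi0) => e e0 ep.
  have le : loop (pi - e) by rewrite /loop/= in_itv/=; apply/andP; split; lra.
  have := fu1 _ _ lp le; rewrite up subr0 (_ : pi - e - pi = - e); last by ring.
  rewrite mulrN opprK sqrrN => /(le_trans (ler_norm _)); have := u0 le => ? ?.
  rewrite -(ler_pM2r e0) -mulrA -expr2; lra.
have gm : - g (- pi) <= 0.
  apply: (le0_small (C := C) pi0) => e e0 ep.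
  have le : loop (- pi + e) by rewrite /loop/= in_itv/=; apply/andP; split; lra.
  have := fu1 _ _ lm le; rewrite um subr0 (_ : - pi + e - - pi = e); last by ring.
  move=> /(le_trans (ler_norm _)); have := u0 le => ? ?.
  rewrite -(ler_pM2r e0) -mulrA -expr2 mulNr; lra.
have gm0 : g (- pi) = 0 by move: kir gp gm; rewrite h00; lra.
have [] : u 0 = 0 /\ g 0 = 0.
  have s : `[- pi, 0] `<=` (loop : set R) by apply: loop_seg => //; exact: ltW.
  have n0 : - pi <= (0 : R) by rewrite oppr_le0 ltW.
  by apply/(rigid fu s uB (lexx 0) M0 (nls0 w) n0).
by move=> uz _; move: u_gt0; rewrite uz ltxx.
Qed.

Lemma limit_u_gt0 x : loop x -> 0 < u x.
Proof.
have H t : 0 <= t -> t <= pi -> 0 < u t.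
  move=> t0 tp; apply: (@lt_le_trans _ _ (u pi)); last exact: udec.
  by rewrite vtx limit_v_gt0.
move=> Dx; have := Dx; rewrite /loop/= in_itv/= => /andP[px xp].
have [x0|x0] := leP 0 x; first exact: H.
by rewrite -even//; apply: H; lra.
Qed.

Let stationary D f df c x y : flow D f df (fun x => nls w (f x)) C -> `[x, y] `<=` D ->
  x < y -> (forall t, x <= t -> t <= y -> f t = c) -> df x = 0 /\ nls w c = 0.
Proof.
move=> [f1 f2 _ _] sD xy fc; have d0 := tangent_constant f1 sD xy fc.
split; first by apply: d0 => //; exact: ltW.
rewrite -(fc x (lexx x) (ltW xy)).
exact: (tangent_constant f2 sD xy d0 (lexx x) (ltW xy)).
Qed.

(** An equilibrium other than zero has infinite mass on the half-line. *)
Let not_equilibrium x c : 0 <= x -> 0 < c -> c <= M -> nls w c = 0 ->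
  v x = c -> h x = 0 -> False.
Proof.
move=> x0 c0 cM wc vx hx.
have vc t : x <= t -> v t = c.
  move=> xt.
  by have [] := (rigid fv (@tail_seg x t x0) vB (ltW c0) cM wc xt).1 (conj vx hx).
pose I := \int[leb]_(t in tail) (v t ^+ 2).
pose z := x + (`|I| + 1) / c ^+ 2.
have c20 : 0 < c ^+ 2 by rewrite exprn_gt0.
have I0 : 0 < (`|I| + 1) / c ^+ 2 by rewrite divr_gt0// ltr_pwDr.
have xz : x <= z by rewrite lerDl ltW.
have := Rintegral_subset (branch_measurable (@tail_branch R)) (measurable_itv `[x, z])
  (@tail_seg x z x0) (fun t _ => sqr_ge0 (v t)) v2.
rewrite (_ : \int[leb]_(t in `[x, z]) (v t ^+ 2) = \int[leb]_(t in `[x, z]) (c ^+ 2)); last first.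
  by apply: eq_Rintegral => t /set_mem/=; rewrite in_itv/= => /andP[xt _]; rewrite vc.
rewrite Rintegral_cst_itv// -/I /z addrAC subrr add0r mulrCA divff ?gt_eqF// mulr1.
by have := ler_norm I; lra.
Qed.

Lemma limit_v_decr x y : 0 <= x -> x < y -> v y < v x.
Proof.
move=> x0 xy; rewrite ltNge; apply/negP => vxy.
have vc t : x <= t -> t <= y -> v t = v x.
  move=> xt ty; apply/eqP; rewrite eq_le vdec//= (le_trans vxy)// vdec//; lra.
have [hx wc] := stationary fv (@tail_seg x y x0) xy vc.
exact: (not_equilibrium x0 (limit_v_gt0 x0) (vM (tailP x0)) wc erefl hx).
Qed.

(** If [u] is constant on a segment, it is an equilibrium up to the vertex, which
    the half-line inherits. *)
Lemma limit_u_decr x y : 0 <= x -> x < y -> y <= pi -> u y < u x.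
Proof.
move=> x0 xy yp; rewrite ltNge; apply/negP => uxy.
have lx : loop x by rewrite /loop/= in_itv/=; apply/andP; split; lra.
have uc t : x <= t -> t <= y -> u t = u x.
  move=> xt ty; apply/eqP; rewrite eq_le udec//=; last by lra.
  by rewrite (le_trans uxy)// udec//; lra.
have sx z : z <= pi -> `[x, z] `<=` (loop : set R).
  by move=> zp; apply: loop_seg => //; lra.
have [gx wc] := stationary fu (sx y yp) xy uc.
have cM := uM lx; have c0 := u0 lx.
have uc' t : x <= t -> t <= pi -> u t = u x /\ g t = 0.
  by move=> xt tp; exact: ((rigid fu (sx t tp) uB c0 cM wc xt).1 (conj erefl gx)).
have xp : x < pi by lra.
have [up gp] := uc' pi (ltW xp) (lexx _).
have [fu1 _ _ _] := fu.
have gm : g (- pi) = 0.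
  have s : `[- pi, - x] `<=` (loop : set R) by apply: loop_seg => //; lra.
  apply: (tangent_constant (c := u x) fu1 s) => //; try lra.
  move=> t pt tx; have [h1 h2] : x <= - t /\ - t <= pi by split; lra.
  have [e _] := uc' _ h1 h2.
  rewrite -e even// /loop/= in_itv/=; apply/andP; split; lra.
have h0 : h 0 = 0 by rewrite -kir gp gm subrr.
apply: (not_equilibrium (lexx 0) (limit_u_gt0 lx) cM wc _ h0).
by rewrite -vtx up.
Qed.

Lemma limit_profile : rintegrable tail (fun x => h x ^+ 2) -> profile w u g v h.
Proof.
move=> h2.
have [pu pg] := flow_primitive (@loop_branch R) (@nls_continuous R w) fu.
have [pv ph] := flow_primitive (@tail_branch R) (@nls_continuous R w) fv.
split=> //.
- exact: limit_u_gt0.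
- by move=> x; rewrite /tail/= in_itv/= andbT; exact: limit_v_gt0.
- exact: limit_u_decr.
- exact: limit_v_decr.
Qed.

End Limit.

Lemma flow_rintegrable D (f : R -> R) u g k C x y : branch D -> continuous f ->
  flow D u g k C -> D x -> D y -> x <= y ->
  rintegrable `[x, y] (fun t => f (u t)) /\ rintegrable `[x, y] (fun t => f (g t)).
Proof.
move=> bD cf fl Dx Dy; rewrite le_eqVlt => /predU1P[<-|xy].
  by split; exact: rintegrable_point.
have fxy := flow_subset (branch_itv bD Dx Dy) fl.
have cu := flow_continuous_u xy fxy; have cg := flow_continuous_g xy fxy.
have key (q : R -> R) : continuous (q \o clamp x y) -> rintegrable `[x, y] (fun t => f (q t)).
  move=> cq.
  have : rintegrable `[x, y] (fun t => f ((q \o clamp x y) t)).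
    apply: continuous_compact_integrable; first exact: segment_compact.
    by apply: continuous_subspaceT => t; exact: (continuous_comp (cq t) (cf _)).
  apply: eq_integrable => // t /set_mem/=; rewrite in_itv/= => /andP[xt ty].
  by rewrite clamp_id.
by split; exact: key.
Qed.

Lemma profile_bounded w u g v h : profile w u g v h ->
  (forall x, loop x -> u x <= u 0) /\ (forall x, tail x -> v x <= u 0).
Proof.
move=> [_ _ _ _ per vtx _ _ _ ev ud vd _ _]; have p0 := pi_gt0 R.
have uM x : loop x -> u x <= u 0.
  move=> Dx; have := Dx; rewrite /loop/= in_itv/= => /andP[px xp].
  case: (ltgtP x 0) => [x0|x0|-> //]; last by rewrite ltW// ud.
  by rewrite -ev// ltW// ud//; lra.
split=> // x; rewrite /tail/= in_itv/= andbT le_eqVlt => /predU1P[<-|x0].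
  by rewrite -vtx ltW// ud.
by rewrite (le_trans (ltW (vd 0 x (lexx 0) x0)))// -vtx ltW// ud.
Qed.

Lemma flow_measurable D u g k C : branch D -> flow D u g k C ->
  measurable_fun D u /\ measurable_fun D g.
Proof.
move=> bD fl; have cid : continuous (fun x : R => x) by move=> x; exact: cvg_id.
split; apply: (branch_measurable_fun bD) => x y Dx Dy xy.
  exact: (flow_rintegrable bD cid fl Dx Dy xy).1.
exact: (flow_rintegrable bD cid fl Dx Dy xy).2.
Qed.

Lemma profile_positive_solution w u g v h : profile w u g v h ->
  positive_solution w ((fun x => (u x)%:C)%C, (fun x => (v x)%:C)%C).
Proof.
move=> P; have [pu pg pv ph per vtx kir u0 v0 ev ud vd v2 h2] := P.
have bl := @loop_branch R; have bt := @tail_branch R.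
have ml := branch_measurable bl; have mt := branch_measurable bt.
have [lp lm] := @loop_pi R; have p0 := pi_gt0 R.
pose M := u 0; have [uM vM] := profile_bounded P.
have fu := primitive_flow bl (lexx `|w|) (fun x Dx => ltW (u0 x Dx)) uM pu pg.
have fv := primitive_flow bt (lexx `|w|) (fun x Dx => ltW (v0 x Dx)) vM pv ph.
have csq : continuous (fun x : R => x ^+ 2) by exact: exprn_continuous.
have M0 : 0 <= M by rewrite /M ltW// u0// /loop/= in_itv/=; apply/andP; split; lra.
have [mu mg] := flow_measurable bl fu; have [mv mh] := flow_measurable bt fv.
have pmle : - pi <= (pi : R) by lra.
have [u2 g2] := flow_rintegrable bl csq fu lm lp pmle.
have mn D q : measurable_fun D q -> measurable_fun D (fun x => nls w (q x)).
  exact: (measurableT_comp (continuous_measurable_fun (@nls_continuous R w))).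
have k2 : rintegrable loop (fun x => nls w (u x) ^+ 2).
  have cn : continuous (fun s => nls w s ^+ 2).
    by move=> s; exact: (continuous_comp (nls_continuous (x := s)) (@exprn_continuous R 2 _)).
  exact: (flow_rintegrable bl cn fu lm lp pmle).1.
have l2 : rintegrable tail (fun x => nls w (v x) ^+ 2).
  apply: rintegrable_le (rintegrableZ ((15 * M ^+ 4 + `|w|) ^+ 2) mt v2) _ => //.
    by apply: measurable_funX; exact: mn.
  move=> x Dx; rewrite ger0_norm ?sqr_ge0// -exprMn.
  have := nls_lipschitz (lexx `|w|) (ltW (v0 x Dx)) (vM x Dx) (lexx 0) M0.
  rewrite nls0 !subr0 (gtr0_norm (v0 x Dx)) => H.
  rewrite -(real_normK (num_real (nls _ _))) lerXn2r ?nnegrE//.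
  by rewrite mulr_ge0 ?(ltW (v0 x Dx))// addr_ge0 ?mulr_ge0 ?exprn_ge0.
have Hu : H1 loop (fun x => (u x)%:C)%C.
  split; first exact: real_square_integrable.
  by exists (fun x => (g x)%:C)%C; [exact: primitive_complex|exact: real_square_integrable].
have Hv : H1 tail (fun x => (v x)%:C)%C.
  split; first exact: real_square_integrable.
  by exists (fun x => (h x)%:C)%C; [exact: primitive_complex|exact: real_square_integrable].
have Hg : H1 loop (fun x => (g x)%:C)%C.
  split; first exact: real_square_integrable.
  exists (fun x => (nls w (u x))%:C)%C; first exact: primitive_complex.
  by apply: real_square_integrable => //; exact: mn.
have Hh : H1 tail (fun x => (h x)%:C)%C.
  split; first exact: real_square_integrable.
  exists (fun x => (nls w (v x))%:C)%C; first exact: primitive_complex.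
  by apply: real_square_integrable => //; exact: mn.
split.
- split; first by split=> //=; [rewrite per|rewrite vtx].
  exists ((fun x => (g x)%:C)%C, (fun x => (h x)%:C)%C); split=> //=.
    by split; exact: primitive_complex.
  by rewrite -rmorphB kir.
- by split=> x Dx /=; rewrite ltcR ?u0 ?v0.
- split=> /=.
  + by move=> x Dx; rewrite ev.
  + by move=> x y x0 xy yp; rewrite ltcR ud.
  + by move=> x y x0 xy; rewrite ltcR vd.
- exists ((fun x => (g x)%:C)%C, (fun x => (h x)%:C)%C),
    ((fun x => (nls w (u x))%:C)%C, (fun x => (nls w (v x))%:C)%C).
  have E (a : R) : (- (nls w a)%:C - 3 * a%:C ^+ 5 = w%:C * a%:C)%C.
    rewrite -rmorphXn (_ : (3 : R[i]) = (3 : R)%:C%C); last by rewrite rmorph_nat.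
    by rewrite -rmorphN -!rmorphM -rmorphB /nls; congr (_%:C)%C; ring.
  split; try by split; exact: primitive_complex.
  + by apply: aeW => x _; exact: E.
  + by apply: aeW => x _; exact: E.
Qed.

End Strictness.

(** * Compactness of the profiles *)

Section Compactness.
Context {R : realType}.
Local Notation leb := (@lebesgue_measure R).
Implicit Types (D : set R) (w s x : R).

Lemma ultra_bounded_cvg (G : set_system R) (f : R -> R) (M : R) : UltraFilter G ->
  G [set s | `|f s| <= M] -> exists l : R, f @ G --> l.
Proof.
move=> GU GM; have GP : ProperFilter G by exact: ultra_proper.
have H : G (f @^-1` `[- M, M]%classic).
  by apply: filterS GM => s /= fs; rewrite in_itv/= -ler_norml.
have [l [_ cl]] := @segment_compact R (- M) M (f @ G) _ H.
exists l => A lA; have [//|GA] := in_ultra_setVsetC (f @^-1` A) GU.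
by have [t [nA /nA]] := cl (~` A) A GA lA.
Qed.

Section Ultra.
Variables (G : set_system R) (GP : ProperFilter G).

Lemma lim_eq (f f' : R -> R) (l l' : R) : f @ G --> l -> f' @ G --> l' ->
  G [set s | f s = f' s] -> l = l'.
Proof.
move=> fl fl' ff'; have d0 : (fun s => f s - f' s) @ G --> l - l' by exact: cvgB.
apply/eqP; rewrite -subr_eq0 eq_le; apply/andP; split.
  by apply: (cvgr_to_le d0); apply: filterS ff' => s /= ->; rewrite subrr.
by apply: (cvgr_to_ge d0); apply: filterS ff' => s /= ->; rewrite subrr.
Qed.

Lemma lim_le (f f' : R -> R) (l l' : R) : f @ G --> l -> f' @ G --> l' ->
  G [set s | f s <= f' s] -> l <= l'.
Proof.
move=> fl fl' ff'; rewrite -subr_ge0.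
have d0 : (fun s => f' s - f s) @ G --> l' - l by exact: cvgB.
by apply: (cvgr_to_ge d0); apply: filterS ff' => s /=; rewrite subr_ge0.
Qed.

Lemma tangent_lim D (u g : R -> R -> R) u' g' C :
  (forall x, D x -> u^~ x @ G --> u' x) -> (forall x, D x -> g^~ x @ G --> g' x) ->
  G [set s | tangent D (u s) (g s) C] -> tangent D u' g' C.
Proof.
move=> uu gg T x y Dx Dy.
have c : (fun s => `|u s y - u s x - g s x * (y - x)|) @ G -->
    `|u' y - u' x - g' x * (y - x)|.
  apply: cvg_norm; apply: cvgB; first by apply: cvgB; exact: uu.
  by apply: cvgM; [exact: gg|exact: cvg_cst].
by apply: (cvgr_to_le c); apply: filterS T => s Ts; exact: Ts.
Qed.

Lemma bound_lim D (g : R -> R -> R) g' C : (forall x, D x -> g^~ x @ G --> g' x) ->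
  G [set s | forall x, D x -> `|g s x| <= C] -> forall x, D x -> `|g' x| <= C.
Proof.
move=> gg B x Dx; apply: (cvgr_to_le (cvg_norm (gg x Dx))).
by apply: filterS B => s; apply.
Qed.

Lemma flow_lim D (u g k : R -> R -> R) u' g' k' C :
  (forall x, D x -> u^~ x @ G --> u' x) -> (forall x, D x -> g^~ x @ G --> g' x) ->
  (forall x, D x -> k^~ x @ G --> k' x) ->
  G [set s | flow D (u s) (g s) (k s) C] -> flow D u' g' k' C.
Proof.
move=> uu gg kk T; split.
- by apply: (tangent_lim uu gg); apply: filterS T => s [].
- by apply: (tangent_lim gg kk); apply: filterS T => s [].
- by apply: (bound_lim gg); apply: filterS T => s [].
- by apply: (bound_lim kk); apply: filterS T => s [].
Qed.

Lemma nls_lim w (f : R -> R) l : (fun s => s) @ G --> w -> f @ G --> l ->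
  (fun s => nls s (f s)) @ G --> nls w l.
Proof.
move=> sw fl; apply: cvgB; last exact: cvgM.
by apply: cvgM; [exact: cvg_cst|exact: (continuous_cvg _ (@exprn_continuous R 5 l))].
Qed.

End Ultra.

Lemma sqr_cvg (f : nat -> R) (l K : R) :
  (forall n, (f n - l) ^+ 2 <= K * harmonic n) -> f @ \oo --> l.
Proof.
move=> H; apply/cvgrPdist_lt => e e0.
have c : (fun n => K * harmonic n) @ \oo --> K * 0.
  by apply: cvgM; [exact: cvg_cst|exact: cvg_harmonic].
rewrite mulr0 in c; have e2 : 0 < e ^+ 2 by exact: exprn_gt0.
near=> n.
rewrite -(@ltr_pXn2r _ 2)// ?nnegrE ?(ltW e0)// real_normK ?num_real//.
rewrite -sqrrN opprB; apply: (le_lt_trans (H n)).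
by near: n; exact: (cvgr_lt _ c).
Unshelve. all: by end_near. Qed.

Let in_segment (a b t : R) : a <= t -> t <= b -> `[a, b]%classic t.
Proof. by move=> at_ tb; rewrite /= in_itv/= at_. Qed.

Lemma flow_seq_cvg D (u g k : nat -> R -> R) u' g' k' a x C L M : branch D ->
  D a -> D x -> a <= x -> 0 <= L -> 0 <= M ->
  (forall n, flow D (u n) (g n) (k n) C) -> flow D u' g' k' C ->
  (forall n t, D t -> `|k n t - k' t| <= L * `|u n t - u' t| + M * harmonic n) ->
  (forall n, `|u n a - u' a| <= harmonic n) ->
  (forall n, `|g n a - g' a| <= harmonic n) ->
  u^~ x @ \oo --> u' x /\ g^~ x @ \oo --> g' x.
Proof.
move=> bD Da Dx ax L0 M0 fn f' kk ua ga.
have h0 n : 0 <= harmonic n :> R by rewrite invr_ge0.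
have h1 n : harmonic n <= 1 :> R by rewrite invf_le1// ler1n.
have sq n (z : R) : `|z| <= harmonic n -> z ^+ 2 <= harmonic n.
  move=> zh; rewrite -(real_normK (num_real z)) expr2.
  apply: (@le_trans _ _ (harmonic n * harmonic n)); first by rewrite ler_pM.
  by rewrite ler_piMl.
pose E := expR ((2 + L) * (x - a)).
have E1 : 1 <= E by rewrite -expR0 ler_expR mulr_ge0 ?subr_ge0// addr_ge0.
(* Gronwall's bound: squared Cauchy data plus squared forcing, times E *)
pose K := (2 + M ^+ 2) * E.
suff H n : (u n x - u' x) ^+ 2 + (g n x - g' x) ^+ 2 <= K * harmonic n.
  split; apply: (@sqr_cvg _ _ K) => n; apply: le_trans (H n).
    by rewrite lerDl sqr_ge0.
  by rewrite lerDr sqr_ge0.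
have Mh : (M * harmonic n) ^+ 2 <= M ^+ 2 * harmonic n.
  rewrite exprMn ler_wpM2l ?sqr_ge0//; apply: sq; by rewrite ger0_norm.
have S : (u n a - u' a) ^+ 2 + (g n a - g' a) ^+ 2 + (M * harmonic n) ^+ 2 <=
    (2 + M ^+ 2) * harmonic n.
  rewrite mulrDl; apply: lerD => //; rewrite mulr_natl mulr2n.
  by apply: lerD; apply: sq.
move: ax; rewrite le_eqVlt => /predU1P[<-|ax].
  apply: (@le_trans _ _ ((2 + M ^+ 2) * harmonic n)).
    by apply: le_trans S; rewrite lerDl sqr_ge0.
  by rewrite /K ler_wpM2r// ler_peMr// addr_ge0 ?sqr_ge0.
have sD := branch_itv bD Da Dx.
have := gronwall ax L0 (mulr_ge0 M0 (h0 n)) (flow_subset sD (fn n)) (flow_subset sD f').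
move=> H; have {H} := H (fun t at_ tx => kk n t (sD t (in_segment at_ tx))).
rewrite -/E => H.
apply: (@le_trans _ _ ((u n x - u' x) ^+ 2 + (g n x - g' x) ^+ 2 + (M * harmonic n) ^+ 2)).
  by rewrite lerDl sqr_ge0.
apply: (le_trans H); rewrite /K [leRHS]mulrAC ler_wpM2r// (le_trans _ E1)//.
Qed.

Lemma fatou_sqr D (f_ : nat -> R -> R) (f : R -> R) (m : R) : measurable D ->
  (forall n, measurable_fun D (f_ n)) -> measurable_fun D f ->
  (forall n, rintegrable D (fun x => f_ n x ^+ 2)) ->
  (forall n, \int[leb]_(x in D) (f_ n x ^+ 2) <= m) ->
  (forall x, D x -> f_^~ x @ \oo --> f x) -> rintegrable D (fun x => f x ^+ 2).
Proof.
move=> mD mf_ mf fi fm ff.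
have m2 n : measurable_fun D (fun x => (f_ n x ^+ 2)%:E).
  by apply/measurable_EFinP; exact: measurable_funX.
have p2 n x : D x -> (0 <= (f_ n x ^+ 2)%:E)%E by move=> _; rewrite lee_fin sqr_ge0.
apply/integrableP; split; first by apply/measurable_EFinP; exact: measurable_funX.
apply: (@le_lt_trans _ _ m%:E); last exact: ltry.
have -> : (\int[leb]_(x in D) `|(f x ^+ 2)%:E| =
    \int[leb]_(x in D) limn_einf (fun n => (f_ n x ^+ 2)%:E))%E.
  apply: eq_integral => x /set_mem Dx /=; rewrite ger0_norm ?sqr_ge0//.
  have c : (fun n => (f_ n x ^+ 2)%:E) @ \oo --> (f x ^+ 2)%:E.
    by apply: cvg_EFin; [exact: nearW|exact: (continuous_cvg _ (@exprn_continuous R 2 _) (ff x Dx))].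
  by rewrite (cvg_limn_einf_sup c).1.
apply: (le_trans (fatou leb mD m2 p2)).
rewrite limn_einf_lim; apply: lime_le; first exact: is_cvg_einfs.
apply: nearW => n; apply: (@le_trans _ _ (\int[leb]_(x in D) (f_ n x ^+ 2)%:E)%E).
  by apply: ereal_inf_lbound; exists n => //=.
have fin : (\int[leb]_(x in D) (f_ n x ^+ 2)%:E)%E \is a fin_num.
  by apply: integrable_fin_num => //; exact: fi.
by have := fm n; rewrite -lee_fin /Rintegral fineK.
Qed.

(** Sequential compactness of the waves: near a frequency [w] their profiles
    accumulate at a profile of frequency [w].  The candidate is a pointwise
    limit along an ultrafilter, which exists because everything is bounded; it
    solves the limit equation because [flow] passes to pointwise limits.  Next,
    a sequence of frequencies is chosen along which the Cauchy data at [- pi] on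
    the circle and at [0] on the half-line converge, and Gronwall's inequality
    upgrades this to convergence at every point. *)
Lemma profile_compact w d M m c (u g v h : R -> R -> R) : 0 < d -> 0 < c ->
  (forall s, `|s - w| < d -> [/\ profile s (u s) (g s) (v s) (h s),
     u s 0 <= M, \int[leb]_(x in tail) (v s x ^+ 2) <= m,
     \int[leb]_(x in tail) (h s x ^+ 2) <= m & c <= u s 0]) ->
  exists (s_ : nat -> R) (u' g' v' h' : R -> R), [/\ profile w u' g' v' h',
    forall n, `|s_ n - w| < d /\ s_ n != w,
    forall n, `|s_ n - w| <= harmonic n,
    forall x, loop x -> (fun n => u (s_ n) x) @ \oo --> u' x &
    forall x, tail x -> (fun n => v (s_ n) x) @ \oo --> v' x].
Proof.
move=> d0 c0 Hs; have bl := @loop_branch R; have bt := @tail_branch R.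
have ml := branch_measurable bl; have mt := branch_measurable bt.
have [lp lm] := @loop_pi R; have t0 := @tail0 R; have p0 := pi_gt0 R.
have l0 : loop (0 : R) by rewrite /loop/= in_itv/=; apply/andP; split; lra.
pose W := `|w| + d.
have sW s : `|s - w| < d -> `|s| <= W.
  move=> sd; rewrite -[s](subrK w) addrC (le_trans (ler_normD _ _))// lerD2l.
  exact: ltW.
have M0 : 0 <= M.
  have [|P uM _ _ cu] := Hs w; first by rewrite subrr normr0.
  by rewrite (le_trans _ uM)// (le_trans (ltW c0)).
have B s : `|s - w| < d -> [/\ forall x, loop x -> 0 <= u s x,
    forall x, loop x -> u s x <= M, forall x, tail x -> 0 <= v s x &
    forall x, tail x -> v s x <= M].
  move=> /Hs[P uM _ _ _]; have [b1 b2] := profile_bounded P.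
  have [_ _ _ _ _ _ _ u0 v0 _ _ _ _ _] := P; split=> x Dx.
  - exact/ltW/u0.
  - exact: le_trans (b1 x Dx) uM.
  - exact/ltW/v0.
  - exact: le_trans (b2 x Dx) uM.
pose C := flow_bound M W.
have Fu s : `|s - w| < d -> flow loop (u s) (g s) (fun x => nls s (u s x)) C.
  move=> sd; have [P _ _ _ _] := Hs s sd; have [b1 b2 _ _] := B s sd.
  exact: (primitive_flow bl (sW s sd) b1 b2 (profile_u P) (profile_g P)).
have Fv s : `|s - w| < d -> flow tail (v s) (h s) (fun x => nls s (v s x)) C.
  move=> sd; have [P _ _ _ _] := Hs s sd; have [_ _ b1 b2] := B s sd.
  exact: (primitive_flow bt (sW s sd) b1 b2 (profile_v P) (profile_h P)).
have C0 : 0 <= C.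
  have [_ _ + _] : flow loop (u w) (g w) (fun x => nls w (u w x)) C.
    by apply: Fu; rewrite subrr normr0.
  by move=> /(_ 0 l0); exact: le_trans.
have [G [GU wG]] := ultraFilterLemma (Proper_dnbhs_numFieldType w).
have GP : ProperFilter G by exact: ultra_proper.
have N : G [set s | `|s - w| < d /\ s != w].
  apply: filterS (wG _ (dnbhs_ball w d0)) => s [/= + sw].
  by rewrite /ball/= distrC => ?; split=> //; apply/eqP.
have sw : (fun s : R => s) @ G --> w by move=> A wA; apply: wG; exact: cvg_within wA.
have lim D (f : R -> R -> R) K : (forall s, `|s - w| < d -> forall x, D x -> `|f s x| <= K) ->
    exists f' : R -> R, forall x, D x -> f^~ x @ G --> f' x.
  move=> fK; have H x : exists l : R, D x -> f^~ x @ G --> l.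
    have [Dx|nDx] := pselect (D x); last by exists 0.
    have [|l fl] := @ultra_bounded_cvg G (f^~ x) K GU; last by exists l.
    by apply: filterS N => s [sd _]; exact: fK.
  by have [f' Hf'] := choice H; exists f'.
have [u' uu] : exists u' : R -> R, forall x, loop x -> u^~ x @ G --> u' x.
  apply: (lim _ _ M) => s sd x Dx; have [b1 b2 _ _] := B s sd.
  by rewrite ger0_norm ?b1 ?b2.
have [v' vv] : exists v' : R -> R, forall x, tail x -> v^~ x @ G --> v' x.
  apply: (lim _ _ M) => s sd x Dx; have [_ _ b1 b2] := B s sd.
  by rewrite ger0_norm ?b1 ?b2.
have [g' gg] : exists g' : R -> R, forall x, loop x -> g^~ x @ G --> g' x.
  by apply: (lim _ _ C) => s sd; have [_ _ ] := Fu s sd.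
have [h' hh] : exists h' : R -> R, forall x, tail x -> h^~ x @ G --> h' x.
  by apply: (lim _ _ C) => s sd; have [_ _ ] := Fv s sd.
have Fu' : flow loop u' g' (fun x => nls w (u' x)) C.
  apply: (flow_lim GP uu gg (k := fun s x => nls s (u s x))).
    by move=> x Dx; exact: nls_lim sw (uu x Dx).
  by apply: filterS N => s [sd _]; exact: Fu.
have Fv' : flow tail v' h' (fun x => nls w (v' x)) C.
  apply: (flow_lim GP vv hh (k := fun s x => nls s (v s x))).
    by move=> x Dx; exact: nls_lim sw (vv x Dx).
  by apply: filterS N => s [sd _]; exact: Fv.
have pick n : exists s, [/\ `|s - w| < d /\ s != w, `|s - w| <= harmonic n,
    `|u s (- pi) - u' (- pi)| <= harmonic n /\ `|g s (- pi) - g' (- pi)| <= harmonic n,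
    `|v s 0 - v' 0| <= harmonic n & `|h s 0 - h' 0| <= harmonic n].
  have hn : 0 < harmonic n :> R by rewrite invr_gt0.
  have near1 (f : R -> R) (l : R) : f @ G --> l -> G [set s | `|f s - l| <= harmonic n].
    by move=> /cvgrPdist_le/(_ _ hn); apply: filterS => s /=; rewrite distrC.
  have := near1 _ _ (hh 0 t0); have := near1 _ _ (vv 0 t0); have := near1 _ _ (gg _ lm).
  have := near1 _ _ (uu _ lm); have := near1 _ _ sw => a1 a2 a3 a4 a5.
  have [s [N1 [s1 [s2 [s3 [s4 s5]]]]]] := filter_ex (filterI N (filterI a1 (filterI a2
    (filterI a3 (filterI a4 a5))))).
  by exists s.
have [s_ Hs_] := choice pick.
pose L := 15 * M ^+ 4 + W.
have W0 : 0 <= W by rewrite addr_ge0// ltW.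
have L0 : 0 <= L by rewrite addr_ge0// mulr_ge0// exprn_ge0.
have u0 x : loop x -> 0 <= u' x.
  by move=> Dx; apply: (cvgr_to_ge (uu x Dx)); apply: filterS N => s [sd _]; have [+ _ _ _] := B s sd; exact.
have uM x : loop x -> u' x <= M.
  by move=> Dx; apply: (cvgr_to_le (uu x Dx)); apply: filterS N => s [sd _]; have [_ + _ _] := B s sd; exact.
have v0 x : tail x -> 0 <= v' x.
  by move=> Dx; apply: (cvgr_to_ge (vv x Dx)); apply: filterS N => s [sd _]; have [_ _ + _] := B s sd; exact.
have vM x : tail x -> v' x <= M.
  by move=> Dx; apply: (cvgr_to_le (vv x Dx)); apply: filterS N => s [sd _]; have [_ _ _] := B s sd; exact.
have kk s (y y' : R) n : `|s - w| < d -> `|s - w| <= harmonic n -> 0 <= y -> y <= M ->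
    0 <= y' -> y' <= M -> `|nls s y - nls w y'| <= L * `|y - y'| + M * harmonic n.
  move=> sd sn y0 yM y'0 y'M.
  rewrite (_ : _ - _ = (nls s y - nls s y') + (nls s y' - nls w y')); last by ring.
  apply: (le_trans (ler_normD _ _)); apply: lerD.
    by apply: nls_lipschitz => //; exact: sW.
  by apply: (le_trans (nls_dist s w y'0 y'M)); rewrite mulrC ler_wpM2l.
have cvL x : loop x -> (fun n => u (s_ n) x) @ \oo --> u' x.
  move=> Dx; have px : - pi <= x by move: Dx; rewrite /loop/= in_itv/= => /andP[].
  have [] // := @flow_seq_cvg loop (fun n => u (s_ n)) (fun n => g (s_ n))
    (fun n x => nls (s_ n) (u (s_ n) x)) u' g' (fun x => nls w (u' x)) (- pi) x C L M
    bl lm Dx px L0 M0 _ Fu' _ _ _.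
  - by move=> n; have [[sd _] _ _ _ _] := Hs_ n; exact: Fu.
  - move=> n t Dt; have [[sd _] sn _ _ _] := Hs_ n; have [b1 b2 _ _] := B _ sd.
    by apply: kk => //; [exact: b1|exact: b2|exact: u0|exact: uM].
  - by move=> n; have [_ _ [] ] := Hs_ n.
  - by move=> n; have [_ _ [] ] := Hs_ n.
have cvT x : tail x -> (fun n => v (s_ n) x) @ \oo --> v' x /\ (fun n => h (s_ n) x) @ \oo --> h' x.
  move=> Dx; have px : 0 <= x by move: Dx; rewrite /tail/= in_itv/= => /andP[].
  apply: (@flow_seq_cvg tail (fun n => v (s_ n)) (fun n => h (s_ n))
    (fun n x => nls (s_ n) (v (s_ n) x)) v' h' (fun x => nls w (v' x)) 0 x C L M
    bt t0 Dx px L0 M0 _ Fv' _ _ _).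
  - by move=> n; have [[sd _] _ _ _ _] := Hs_ n; exact: Fv.
  - move=> n t Dt; have [[sd _] sn _ _ _] := Hs_ n; have [_ _ b1 b2] := B _ sd.
    by apply: kk => //; [exact: b1|exact: b2|exact: v0|exact: vM].
  - by move=> n; have [] := Hs_ n.
  - by move=> n; have [] := Hs_ n.
have [mv mh] := flow_measurable bt Fv'.
have sd n : `|s_ n - w| < d by have [[]] := Hs_ n.
have v2 : rintegrable tail (fun x => v' x ^+ 2).
  apply: (fatou_sqr mt (f_ := fun n => v (s_ n)) (m := m)) => // [n|n|n|x Dx].
  - exact: (flow_measurable bt (Fv _ (sd n))).1.
  - by have [P _ _ _ _] := Hs _ (sd n); exact: profile_v_sqr P.
  - by have [_ _ + _ _] := Hs _ (sd n).
  - exact: (cvT x Dx).1.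
have h2 : rintegrable tail (fun x => h' x ^+ 2).
  apply: (fatou_sqr mt (f_ := fun n => h (s_ n)) (m := m)) => // [n|n|n|x Dx].
  - exact: (flow_measurable bt (Fv _ (sd n))).2.
  - by have [P _ _ _ _] := Hs _ (sd n); exact: profile_h_sqr P.
  - by have [_ _ _ + _] := Hs _ (sd n).
  - exact: (cvT x Dx).2.
have Prof : G [set s | profile s (u s) (g s) (v s) (h s)].
  by apply: filterS N => s [sd' _]; have [] := Hs s sd'.
exists s_, u', g', v', h'; split=> //; last 3 first.
- by move=> n; have [] := Hs_ n.
- by move=> n; have [] := Hs_ n.
- by move=> x /cvT[].
apply: (limit_profile Fu' Fv' C0 M0 u0 uM v0 vM _ _ _ _ _ _ _ v2 h2).
- by apply: (lim_eq GP (uu _ lp) (uu _ lm)); apply: filterS Prof => s /profile_periodic.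
- by apply: (lim_eq GP (uu _ lp) (vv _ t0)); apply: filterS Prof => s /profile_vertex.
- have c1 : (fun s => g s pi - g s (- pi)) @ G --> g' pi - g' (- pi).
    by apply: cvgB; exact: gg.
  by apply: (lim_eq GP c1 (hh _ t0)); apply: filterS Prof => s /profile_kirchhoff.
- move=> x Dx; apply: (lim_eq GP (uu _ (loopN Dx)) (uu _ Dx)).
  by apply: filterS Prof => s /profile_even; exact.
- move=> x y x0; rewrite le_eqVlt => /predU1P[->//|xy] yp.
  have Dx : loop x by apply: loop_nneg => //; lra.
  have Dy : loop y by apply: loop_nneg => //; lra.
  apply: (lim_le GP (uu _ Dy) (uu _ Dx)); apply: filterS Prof => s P /=.
  by rewrite ltW// (profile_u_decr P).
- move=> x y x0; rewrite le_eqVlt => /predU1P[->//|xy].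
  have Dx : tail x by rewrite /tail/= in_itv/= x0.
  have Dy : tail y by rewrite /tail/= in_itv/= andbT; lra.
  apply: (lim_le GP (vv _ Dy) (vv _ Dx)); apply: filterS Prof => s P /=.
  by rewrite ltW// (profile_v_decr P).
- apply: (lt_le_trans c0); apply: (cvgr_to_ge (uu _ l0)).
  by apply: filterS N => s [sd' _]; have [] := Hs s sd'.
Qed.

End Compactness.

(** * Convergence of the waves in the energy norm *)

Section Convergence.
Local Open Scope complex_scope.
Context {R : realType}.
Local Notation leb := (@lebesgue_measure R).
Local Notation Re := (@complex.Re R).
Local Notation Im := (@complex.Im R).
Implicit Types (D : set R) (U V F : tadfun R) (w s : R).

Lemma Rintegral_dominated_cvg D (f_ : nat -> R -> R) (f g : R -> R) : measurable D ->
  (forall n, measurable_fun D (f_ n)) -> measurable_fun D f -> rintegrable D g ->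
  (forall n x, D x -> `|f_ n x| <= g x) -> (forall x, D x -> f_^~ x @ \oo --> f x) ->
  (fun n => \int[leb]_(x in D) f_ n x) @ \oo --> \int[leb]_(x in D) f x.
Proof.
move=> mD mf_ mf gi fg ff.
have mE_ n : measurable_fun D (EFin \o f_ n) by apply/measurable_EFinP.
have mE : measurable_fun D (EFin \o f) by apply/measurable_EFinP.
have cE : {ae leb, forall x, D x -> (fun n => (EFin \o f_ n) x) @ \oo --> (EFin \o f) x}.
  apply: aeW => x Dx; apply: cvg_EFin; first exact: nearW.
  exact: ff.
have bE : {ae leb, forall x n, D x -> (`|(EFin \o f_ n) x| <= (EFin \o g) x)%E}.
  by apply: aeW => x n Dx /=; rewrite lee_fin fg.
have [i _ c] := @dominated_convergence _ _ _ leb D mD _ _ _ mE_ mE cE gi bE.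
have fin : (\int[leb]_(x in D) (f x)%:E)%E \is a fin_num.
  by apply: integrable_fin_num => //; exact: i.
have : (fun n => \int[leb]_(x in D) (f_ n x)%:E)%E @ \oo -->
    (fine (\int[leb]_(x in D) (f x)%:E)%E)%:E by rewrite fineK.
by move=> /fine_cvg.
Qed.

Lemma L6int_le_mass F (K : R) : H1C F -> (forall x, loop x -> dotc (F.1 x) (F.1 x) <= K) ->
  (forall x, tail x -> dotc (F.2 x) (F.2 x) <= K) -> L6int F <= K ^+ 2 * mass F.
Proof.
move=> HF b1 b2; have [[u1 _] [u2 _] _ _] := HF.
have H D (u : R -> R[i]) : measurable D -> square_integrable D u ->
    (forall x, D x -> dotc (u x) (u x) <= K) ->
    \int[leb]_(x in D) (dotc (u x) (u x) ^+ 3) <= K ^+ 2 * L2ip D u u.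
  move=> mD ui bu; rewrite /L2ip -RintegralZl//; last exact: rintegrable_dotc.
  apply: le_Rintegral => //; first exact: (rintegrable_sixth mD ui bu).
    by apply: rintegrableZ => //; exact: rintegrable_dotc.
  move=> x Dx; rewrite exprSr ler_wpM2r ?dotc_ge0// lerXn2r ?nnegrE ?dotc_ge0 ?bu//.
  exact: le_trans (dotc_ge0 _) (bu x Dx).
rewrite massE /mass_ip mulrDr; apply: lerD; apply: H => //.
  exact: (branch_measurable loop_branch).
exact: (branch_measurable tail_branch).
Qed.

Lemma dotc_real (z z' : R[i]) : Im z = 0 -> dotc z z' = Re z * Re z'.
Proof. by rewrite /dotc => ->; rewrite mul0r addr0. Qed.

Lemma real_positive_Im F : real_positive F ->
  (forall x, loop x -> Im (F.1 x) = 0) /\ (forall x, tail x -> Im (F.2 x) = 0).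
Proof. by move=> [h1 h2]; split=> x; [move=> /h1|move=> /h2] => /Re_gt0[_ ->]. Qed.

Lemma quintic_cvg F (F_ : nat -> tadfun R) (K : R) : H1C F -> (forall n, H1C (F_ n)) ->
  (forall x, loop x -> Im (F.1 x) = 0) -> (forall x, tail x -> Im (F.2 x) = 0) ->
  (forall x, loop x -> dotc (F.1 x) (F.1 x) <= K) ->
  (forall x, tail x -> dotc (F.2 x) (F.2 x) <= K) ->
  (forall n x, loop x -> dotc ((F_ n).1 x) ((F_ n).1 x) <= K) ->
  (forall n x, tail x -> dotc ((F_ n).2 x) ((F_ n).2 x) <= K) ->
  (forall x, loop x -> (fun n => Re ((F_ n).1 x)) @ \oo --> Re (F.1 x)) ->
  (forall x, tail x -> (fun n => Re ((F_ n).2 x)) @ \oo --> Re (F.2 x)) ->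
  (fun n => quintic F (F_ n)) @ \oo --> L6int F.
Proof.
move=> HF HF_ r1 r2 b1 b2 b1' b2' c1 c2.
have H D (u : R -> R[i]) (u_ : nat -> R -> R[i]) : measurable D -> square_integrable D u ->
    (forall n, square_integrable D (u_ n)) -> (forall x, D x -> Im (u x) = 0) ->
    (forall x, D x -> dotc (u x) (u x) <= K) ->
    (forall n x, D x -> dotc (u_ n x) (u_ n x) <= K) ->
    (forall x, D x -> (fun n => Re (u_ n x)) @ \oo --> Re (u x)) ->
    (fun n => quintic_on D u (u_ n)) @ \oo --> \int[leb]_(x in D) (dotc (u x) (u x) ^+ 3).
  move=> mD ui u_i ur bu bu_ cu; have [mu1 mu2 _] := ui.
  have md := measurable_dotc mu1 mu2 mu1 mu2.
  apply: (Rintegral_dominated_cvg (g := fun x => K ^+ 2 * dotc (u x) (u x))) => //.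
  - move=> n; have [mn1 mn2 _] := u_i n.
    by apply: measurable_funM; [exact: measurable_funX|exact: measurable_dotc].
  - exact: measurable_funX.
  - by apply: rintegrableZ => //; exact: rintegrable_dotc.
  - move=> n x Dx; have a0 := dotc_ge0 (u x); have aK := bu x Dx.
    have K0 := le_trans a0 aK.
    have dK : `|dotc (u x) (u_ n x)| <= K.
      have := normr_dotc_le (u x) (u_ n x) ltr01; rewrite invr1 !mul1r.
      have := bu_ n x Dx; move: aK; move: (dotc _ _) (dotc _ _) (`|_|).
      by clear; move=> *; lra.
    rewrite normrM ger0_norm ?exprn_ge0//.
    have -> : K ^+ 2 * dotc (u x) (u x) = K * dotc (u x) (u x) * K by ring.
    by apply: ler_pM; rewrite ?exprn_ge0// expr2 ler_wpM2r.
  - move=> x Dx; rewrite [X in _ --> X]exprSr; apply: cvgM; first exact: cvg_cst.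
    rewrite (dotc_real _ (ur x Dx)).
    under eq_cvg do rewrite (dotc_real _ (ur x Dx)).
    by apply: cvgM; [exact: cvg_cst|exact: cu].
have [[u1 _] [u2 _] _ _] := HF.
apply: cvgD.
  apply: (H _ _ (fun n => (F_ n).1)) => //.
    exact: (branch_measurable loop_branch).
  by move=> n; have [[? _] _ _ _] := HF_ n.
apply: (H _ _ (fun n => (F_ n).2)) => //.
  exact: (branch_measurable tail_branch).
by move=> n; have [_ [? _] _ _] := HF_ n.
Qed.

Lemma H1sq_le_Bform w U : w < 0 -> H1sq U <= (1 - w^-1) * Bform w U.
Proof.
move=> w0; rewrite /H1sq /Bform; have D0 := dirichlet_ge0 U; have M0 := mass_ge0 U.
move: (dirichlet U) (mass U) D0 M0 => a b a0 b0.
have -> : (1 - w^-1) * (a - w * b) = a + b + (- w * b) + (- w^-1) * a.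
  by field; rewrite lt_eqF.
have h1 : 0 <= - w * b by rewrite mulr_ge0// oppr_ge0 ltW.
have h2 : 0 <= - w^-1 * a by rewrite mulr_ge0// oppr_ge0 invr_le0 ltW.
lra.
Qed.

Lemma H1sq_sub_sym U V : H1C U -> H1C V -> H1sq (tad_sub U V) = H1sq (tad_sub V U).
Proof.
move=> HU HV; have -> : tad_sub U V = tad_scale (-1) (tad_sub V U).
  rewrite /tad_sub /tad_scale; congr pair; apply/funext => x /=;
  by rewrite rmorphN rmorph1; ring.
by rewrite (H1sq_scale _ (H1C_sub HV HU)) sqrrN expr1n mul1r.
Qed.

End Convergence.

Section Waves.
Local Open Scope complex_scope.
Context {R : realType}.
Local Notation leb := (@lebesgue_measure R).
Local Notation Re := (@complex.Re R).
Local Notation Im := (@complex.Im R).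
Variables (Phi : R -> tadfun R) (mu : R -> R).
Hypothesis solP : forall w, w < 0 -> positive_solution w (Phi w).
Hypothesis uniqP : forall (w : R) (V : tadfun R), w < 0 ->
  positive_solution w V -> tad_eq V (Phi w).
Hypothesis groundP : forall w, w < 0 -> ground_state w (Phi w).
Hypothesis muE : forall w, w < 0 -> mu w = mass (Phi w).
Hypothesis mu_derivable : forall w, w < 0 -> derivable mu w 1.

(** The lower bound [c] keeps the limit away from zero: [|F|_6^6] is at most
    [(max F)^4] times the mass, and the maximum is at the middle of the circle. *)
Lemma waves_bounded w : w < 0 -> exists d m c : R, [/\ 0 < d, 0 <= m, 0 < c &
  forall s, `|s - w| < d -> [/\ s < 0, mass (Phi s) <= m, dirichlet (Phi s) <= m &
    c <= Re ((Phi s).1 0)]].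
Proof.
move=> w0; have [d1 d10 H1] := mu_near mu_derivable w0 (@ltr01 R).
pose p s := L6int (Phi s).
have pw10 : w - 1 < 0 by lra.
have pw20 : w / 2 < 0 by lra.
have P1 : 0 < p (w - 1) by exact: (p_gt0 groundP pw10).
have P2 : 0 < p (w / 2) by exact: (p_gt0 groundP pw20).
have mw0 := mu_ge0 muE w0.
pose m := mu w + 1 + 3 * p (w - 1).
have m0 : 0 < m by rewrite /m; lra.
pose c := Num.min 1 (p (w / 2) / m).
exists (Num.min d1 (Num.min 1 (- w / 2))), m, c; split.
- by rewrite !lt_min d10 ltr01/=; lra.
- exact: ltW.
- by rewrite lt_min ltr01 divr_gt0.
move=> s; rewrite !lt_min => /andP[sd1 /andP[sd2 sd3]].
have [sw1 sw2] : w - 1 < s /\ s < w / 2.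
  by move: sd2 sd3; rewrite !ltr_norml => /andP[? ?] /andP[? ?]; split; lra.
have s0 : s < 0 by lra.
have ms : mu s < mu w + 1.
  have := H1 _ sd1; rewrite addrCA subrr addr0 ltr_norml => /andP[_]; lra.
have ps1 : p s <= p (w - 1) by apply: (p_nonincreasing groundP muE) => //; exact: ltW.
have ps2 : p (w / 2) <= p s by apply: (p_nonincreasing groundP muE) => //; exact: ltW.
have ms0 := mu_ge0 muE s0.
have mm : mass (Phi s) <= m by rewrite -muE// /m; lra.
split; [exact: s0|exact: mm| |].
  have : dirichlet (Phi s) - s * mu s = 3 * p s.
    by have [_ _ BF _] := groundP s0; rewrite (muE s0); exact: BF.
  have h : s * mu s <= 0 by rewrite nmulr_rle0.
  by move: h ps1 ms mw0; rewrite /m; move: (dirichlet _) (s * mu s) (p s) (p _); clear; move=> *; lra.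
have [HF _ _ _] := groundP s0.
have [g [h [P _ _]]] := positive_solution_profile (solP s0).
have [b1 b2] := profile_bounded P; have [_ rp _ _] := solP s0.
have [i1 i2] := real_positive_Im rp.
pose a := Re ((Phi s).1 0).
have a0 : 0 < a.
  by apply: (profile_u_gt0 P); apply: loop_nneg => //; exact: pi_ge0.
have sq (x : R) : 0 < x -> x <= a -> x * x <= a ^+ 2.
  by move=> x0 xa; rewrite expr2 ler_pM// ltW.
have c1 x : loop x -> dotc ((Phi s).1 x) ((Phi s).1 x) <= a ^+ 2.
  move=> Dx; rewrite dotc_real ?i1//.
  by apply: sq; [exact: (profile_u_gt0 P Dx)|exact: (b1 x Dx)].
have c2 x : tail x -> dotc ((Phi s).2 x) ((Phi s).2 x) <= a ^+ 2.
  move=> Dx; rewrite dotc_real ?i2//.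
  by apply: sq; [exact: (profile_v_gt0 P Dx)|exact: (b2 x Dx)].
have H := L6int_le_mass HF c1 c2.
rewrite leNgt; apply/negP => ac.
move: ac; rewrite lt_min => /andP[a1]; rewrite -/a ltr_pdivlMr// => am.
have a4 : (a ^+ 2) ^+ 2 <= a by rewrite -exprM exprS ler_piMr ?(ltW a0)// exprn_ile1 ?(ltW a0)// ltW.
have : p (w / 2) < p (w / 2); last by rewrite ltxx.
apply: (le_lt_trans ps2); apply: (le_lt_trans H); apply: le_lt_trans am.
apply: (@le_trans _ _ (a * mass (Phi s))); first by rewrite ler_wpM2r ?mass_ge0.
by rewrite ler_wpM2l// ltW.
Qed.

(** The waves depend continuously on the frequency, at least along a sequence:
    pointwise convergence suffices, since by the equation the energy norm of
    the difference only involves the integral of the fifth power of one wave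
    against the other. *)
Lemma wave_limit w : w < 0 -> forall e, 0 < e -> exists w', [/\ `|w' - w| < e,
  w' != w & H1sq (tad_sub (Phi w') (Phi w)) < e].
Proof.
move=> w0 e e0; have [d [m [c [d0 m0 c0 Hb]]]] := waves_bounded w0.
pose M := 2 * (m + m) + 1.
have gh s : exists gh : (R -> R) * (R -> R), s < 0 ->
    [/\ profile s (Re \o (Phi s).1) gh.1 (Re \o (Phi s).2) gh.2,
      \int[leb]_(x in tail) (Re ((Phi s).2 x) ^+ 2) <= mass (Phi s) &
      \int[leb]_(x in tail) (gh.2 x ^+ 2) <= dirichlet (Phi s)].
  have [s0|s0] := ltP s 0; last by exists (cst 0, cst 0).
  have [g [h H]] := positive_solution_profile (solP s0).
  by exists (g, h).
have [gh_ Hgh] := choice gh.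
have HN s : `|s - w| < d -> H1C (Phi s).
  by move=> /Hb[s0 _ _ _]; have [HF _ _ _] := groundP s0.
have bd s : `|s - w| < d -> (forall x, loop x -> dotc ((Phi s).1 x) ((Phi s).1 x) <= 2 * (m + m)) /\
    (forall x, tail x -> dotc ((Phi s).2 x) ((Phi s).2 x) <= 2 * (m + m)).
  move=> sd; have [s0 ms ds _] := Hb s sd; have [b1 b2] := H1C_bounded (HN s sd).
  have N : 2 * (dirichlet (Phi s) + mass (Phi s)) <= 2 * (m + m).
    exact: (ler_wpM2l (ler0n _ 2) (lerD ds ms)).
  by split=> x Dx; [apply: le_trans (b1 x Dx) N|apply: le_trans (b2 x Dx) N].
have [s_ [u [g [v [h [P sd sh cu cv]]]]]] : exists (s_ : nat -> R) (u' g' v' h' : R -> R),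
    [/\ profile w u' g' v' h', forall n, `|s_ n - w| < d /\ s_ n != w,
      forall n, `|s_ n - w| <= harmonic n,
      forall x, loop x -> (fun n => (Re \o (Phi (s_ n)).1) x) @ \oo --> u' x &
      forall x, tail x -> (fun n => (Re \o (Phi (s_ n)).2) x) @ \oo --> v' x].
  apply: (@profile_compact R w d M m c (fun s => Re \o (Phi s).1) (fun s => (gh_ s).1)
     (fun s => Re \o (Phi s).2) (fun s => (gh_ s).2) d0 c0) => s sd.
  have [s0 ms ds cs] := Hb s sd; have [P h1 h2] := Hgh s s0.
  split=> //.
  - have l0 : loop (0 : R) by apply: loop_nneg => //; exact: pi_ge0.
    have mm : 0 <= 2 * (m + m) by rewrite mulr_ge0// addr_ge0.
    exact: (Re_le_bound mm ((bd s sd).1 0 l0)).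
  - exact: le_trans h1 ms.
  - exact: le_trans h2 ds.
have [E1 E2] := uniqP w0 (profile_positive_solution P).
have s0 n : s_ n < 0 by have [/Hb[]] := sd n.
have [HF P0 BF _] := groundP w0.
have HFn n : H1C (Phi (s_ n)) by apply: HN; have [] := sd n.
have sw : s_ @ \oo --> w.
  apply: (@sqr_cvg R _ _ 1) => n; rewrite mul1r -(real_normK (num_real _)) expr2.
  have h1 : harmonic n <= 1 :> R by rewrite invf_le1// ler1n.
  apply: (@le_trans _ _ (harmonic n * 1)); last by rewrite mulr1.
  by apply: ler_pM => //; exact: le_trans (sh n) h1.
have q : (fun n => quintic (Phi w) (Phi (s_ n))) @ \oo --> L6int (Phi w).
  have [_ rp _ _] := solP w0; have [i1 i2] := real_positive_Im rp.
  have wd : `|w - w| < d by rewrite subrr normr0.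
  apply: (quintic_cvg (K := 2 * (m + m)) HF HFn i1 i2 (bd w wd).1 (bd w wd).2).
  - by move=> n; have [/bd[b _] _] := sd n.
  - by move=> n; have [/bd[_ b] _] := sd n.
  - by move=> x Dx; have := cu x Dx; rewrite -(E1 x Dx).
  - by move=> x Dx; have := cv x Dx; rewrite -(E2 x Dx).
have pc : (fun n => L6int (Phi (s_ n))) @ \oo --> L6int (Phi w).
  have [dp _] := p_derive groundP muE mu_derivable w0.
  have cp : {for w, continuous (fun s => L6int (Phi s))}.
    exact/differentiable_continuous/derivable1_diffP.
  exact: (continuous_cvg _ cp sw).
have mc : (fun n => mu (s_ n)) @ \oo --> mu w.
  have cm : {for w, continuous mu}.
    by apply/differentiable_continuous/derivable1_diffP; exact: mu_derivable.
  exact: (continuous_cvg _ cm sw).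
(* the form at the difference of the two waves, by the equation of Phi w *)
pose b n := 3 * L6int (Phi w) - 6 * quintic (Phi w) (Phi (s_ n)) +
  (3 * L6int (Phi (s_ n)) - (w - s_ n) * mu (s_ n)).
have bE n : Bform w (tad_sub (Phi w) (Phi (s_ n))) = b n.
  rewrite tad_subE (Bform_line _ _ HF (HFn n)) (ground_state_critical w0 (groundP w0) (HFn n)).
  rewrite BF (Bform_wave groundP muE w (s0 n)) /b.
  move: (s_ n) (mu (s_ n)) (quintic (Phi w) (Phi (s_ n))) (L6int (Phi (s_ n))) (L6int (Phi w)).
  by clear; move=> *; ring.
have bc : b @ \oo --> 3 * L6int (Phi w) - 6 * L6int (Phi w) + (3 * L6int (Phi w) - (w - w) * mu w).
  apply: cvgD.
    by apply: cvgB; [exact: cvg_cst|apply: cvgM; [exact: cvg_cst|exact: q]].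
  apply: cvgB; first by apply: cvgM; [exact: cvg_cst|exact: pc].
  by apply: cvgM; [apply: cvgB; [exact: cvg_cst|exact: sw]|exact: mc].
have b0 : 3 * L6int (Phi w) - 6 * L6int (Phi w) + (3 * L6int (Phi w) - (w - w) * mu w) = 0.
  by move: (L6int (Phi w)) (mu w); clear; move=> x y; ring.
rewrite b0 in bc.
have k0 : 0 < 1 - w^-1 by rewrite subr_gt0 (lt_trans _ ltr01)// invr_lt0.
have ek : 0 < e / (1 - w^-1) by rewrite divr_gt0.
have near0 : \forall n \near \oo, b n < e / (1 - w^-1) /\ `|w - s_ n| < e.
  near=> n; split.
    by near: n; exact: (cvgr_lt _ bc).
  by near: n; move/cvgrPdist_lt : sw; apply.
have [n [bn sn]] := filter_ex near0.
exists (s_ n); split; [by rewrite distrC|by have [] := sd n|].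
rewrite (H1sq_sub_sym (HFn n) HF).
apply: (le_lt_trans (H1sq_le_Bform _ w0)).
by rewrite mulrC -ltr_pdivlMr// bE.
Unshelve. all: by end_near. Qed.

End Waves.

Unset Implicit Arguments.
Set Strict Implicit.

Theorem corollary1p4 (R : realType) (Phi : R -> tadfun R) (mu : R -> R) (w1 : R)
  (Phi_solution : forall w : R, w < 0 ->
     positive_solution w (Phi w) /\ scaled_minimizer w (Phi w))
  (Phi_unique : forall (w : R) (V : tadfun R), w < 0 ->
     positive_solution w V -> tad_eq V (Phi w))
  (muE : forall w : R, w < 0 -> mu w = mass (Phi w))
  (mu_C1 : forall w : R, w < 0 ->
     derivable mu w 1 /\ {for w, continuous (derive1 mu)})
  (w1_neg : w1 < 0)
  (mu_incr : forall w : R, w < w1 -> 0 < derive1 mu w)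
  (mu_decr : forall w : R, w1 < w -> w < 0 -> derive1 mu w < 0) :
  (forall w : R, w1 < w -> w < 0 -> local_constrained_min (mu w) (Phi w)) /\
  (forall w : R, w < w1 -> saddle_point (mu w) (Phi w)).
Proof.
have sol w : w < 0 -> positive_solution w (Phi w) by move=> /Phi_solution[].
have der w : w < 0 -> derivable mu w 1 by move=> /mu_C1[].
have gr w : w < 0 -> ground_state w (Phi w).
  move=> w0; have [[_ rp _ _] sm] := Phi_solution w w0.
  exact: scaled_minimizer_ground_state.
split=> w; first exact: (wave_local_min gr muE der mu_decr).
move=> ww1; have w0 : w < 0 by exact: lt_trans w1_neg.
have [_ rp _ _] := sol w w0.
split.
- by rewrite (muE w w0); exact: (ground_state_constrained_critical w0 (gr w w0)).
- apply: (wave_not_local_min gr muE der w1_neg mu_incr ww1).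
  exact: (wave_limit sol Phi_unique gr muE der w0).
- rewrite (muE w w0); apply: (ground_state_not_local_max w0 (gr w w0) rp).
  rewrite -(muE w w0).
  have wm : w - 1 < w by rewrite ltrBlDr ltrDl.
  apply: le_lt_trans (mu_increasing der w1_neg mu_incr wm ww1).
  by apply: (mu_ge0 muE); exact: lt_trans w0.
Qed.
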